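(* Let $\mathrm X_{J}\colon J\to\mathrm{Top}$ be a diagram all of whose transition maps $\mathrm X_x\to\mathrm X_y$ are closed embeddings and which sends fibre products in $J$ to fibre products in $\mathrm{Top}$. Then the quadruple $(\mathrm H_{\star}^{J},\mathrm H^{\star}_{J},\mathrm H_{!}^{J},\mathrm H^!_{J})$ is a Grothendieck cross functor associated with the ringed $J^{\circ}$-topos $(\mathbf{Sh}^{J}_{\mathrm{top}},\mathrm A)$. The corresponding Mackey $\star!$-functor is the pseudo-functor $\mathrm H^{\star!}_{J}$ and the corresponding Mackey $!\star$-functor is the pseudo-functor $\mathrm H_{!\star}^{J}$.
   Context: $C^{\circ}$ denotes the opposite of a category $C$. $\mathrm{Top}$ is the category of locally compact, locally completely paracompact topological spaces of finite cohomological dimension, with continuous maps. $\mathrm A$ is a field; $\mathrm{Sh}_{\mathrm A}(\mathrm X)$ is the abelian category of sheaves of $\mathrm A$-modules on $\mathrm X$ (modules over the constant sheaf). Index category. $J$ is a small category with fibre products such that $D:=J^{\circ}$ satisfies the standing assumptions: $D$ has pushouts; any two objects $x,y$ of $J$ admit morphisms $x\to z\leftarrow y$ in $J$; and for every parallel pair $u,v\colon x\rightrightarrows y$ in $J$ there are $t\colon y\to w$ in $J$ and an automorphism $\sigma$ of $w$ with $\sigma t u=t v$. The ringed $J^{\circ}$-topos. A $J^{\circ}$-topos is a bifibration over $J^{\circ}$ whose fibres are topoi and whose cobase change and base change functors are the inverse and direct image functors of morphisms of topoi. $\mathbf{Sh}^J_{\mathrm{top}}$ is the $J^{\circ}$-topos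 with fibre over $x$ the topos $\mathrm{Sh}(\mathrm X_x)$ of sheaves of sets on $\mathrm X_x$, with functors $f^*\dashv f_*$ for $f\colon\mathrm X_x\to\mathrm X_y$ the map associated with $x\to y$ in $J$; $\mathrm A$ denotes the constant ring object. Its bifibration of modules has fibres $\mathrm{Sh}_{\mathrm A}(\mathrm X_x)$; it corresponds to the pseudo-functors $\mathrm H^J_\star\colon J\to\mathrm{Cat}$ ($f\mapsto f_*$) and $\mathrm H_J^\star\colon J^{\circ}\to\mathrm{Cat}$ ($f\mapsto f^*$). $\mathrm H^J_!\colon J\to\mathrm{Cat}$ and $\mathrm H^!_J\colon J^{\circ}\to \mathrm{Cat}$ are the pseudo-functors with the same values on objects given by $f\mapsto f_!$ and its right adjoint $f\mapsto f^!$ (for a closed embedding, $f_!=f_*$ and $f^!$ takes the subsheaf of sections supported on the closed subspace). Cross functors. A cross functor on $J$ consists of pseudo-functors $\mathrm H_\star,\mathrm H_!\colon J\to\mathrm{Cat}$, $\mathrm H^\star,\mathrm H^!\colon J^{\circ}\to\mathrm{Cat}$ with the same values on objects, with adjunctions $f^*\dashv f_*$, $f_!\dashv f^!$ compatible with composition, and for every pullback square in $J$ with top $f\colon a\to b$, left $g\colon a\to c$, right $p\colon b\to d$, bottom $h\colon c\to d$, exchange morphisms $p_!f_*\to h_*g_!$ and $f^*p^!\to g^!h^*$, compatible with horizontal and vertical composition of squares and invertible if both horizontal or both vertical morphisms are identities, such that the morphisms $h^*p_!\to g_!f^*$ and $g_!f^*\to h^*p_!$ obtained from them by adjunction are mutually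 inverse. It is a Grothendieck cross functor associated with a ringed $J^{\circ}$-topos if the bifibration over $J^{\circ}$ corresponding to $(\mathrm H_\star,\mathrm H^\star)$ is isomorphic to the bifibration of modules over that ringed $J^{\circ}$-topos and there is an isomorphism $\mathrm H_!\cong\mathrm H_\star$. Mackey functors. $\mathrm{cospan}(J^{\circ})=\mathrm{span}(J)$ has the objects of $J$; morphisms $x\to y$ are equivalence classes (isomorphisms of $z$ compatible with the legs) of diagrams $x\leftarrow z\to y$ in $J$, composed by fibre products. Let $\mathrm i\colon J\to\mathrm{span}(J)$, $(x\to y)\mapsto(x=x\to y)$, and $\mathrm j\colon J^{\circ}\to\mathrm{span}(J)$, $(x\to y \text{ in } J)\mapsto (y\leftarrow x=x)$. A Mackey $\star!$-functor associated with a cross functor is a pseudo-functor $\mathrm H^{\star!}\colon\mathrm{span}(J)\to\mathrm{Cat}$ with $\mathrm i^*\mathrm H^{\star!}\cong\mathrm H_!$, $\mathrm j^*\mathrm H^{\star!}\cong\mathrm H^\star$; a Mackey $!\star$-functor is a pseudo-functor $\mathrm H_{!\star}\colon \mathrm{span}(J)^{\circ}\to\mathrm{Cat}$ with $\mathrm i^*\mathrm H_{!\star}\cong\mathrm H^!$, $\mathrm j^*\mathrm H_{!\star}\cong\mathrm H_\star$. The pseudo-functor $\mathrm H_J^{\star!}$ is the cofibration over $\mathrm{span}(J)$ with fibres $\mathrm{Sh}_{\mathrm A}(\mathrm X_x)$ in which a morphism $K_1\to K_2$ over $x\xleftarrow{}z\xrightarrow{}y$, inducing $\mathrm X_x\xleftarrow{f_l}\mathrm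 X_z\xrightarrow{f_r}\mathrm X_y$, is a morphism of sheaves $f_{r!}f_l^*K_1\to K_2$ (composition by base change). $\mathrm H^J_{!\star}$ is the corresponding fibration, given by the right adjoints $f_{l*}f_r^!$. *)

(* Defs.v *)
From HB Require Import structures.
From mathcomp Require Import all_boot all_order all_algebra.
From mathcomp Require Import boolp classical_sets functions cardinality.
From mathcomp Require Import topology.

Set Implicit Arguments.
Unset Strict Implicit.
Unset Printing Implicit Defensive.

Import GRing.Theory.
Local Open Scope classical_set_scope.

Declare Scope cat_scope.
Local Open Scope cat_scope.

Record category := Category {
  ob :> Type;
  hom : ob -> ob -> Type;
  idm : forall x, hom x x;
  comp : forall x y z, hom y z -> hom x y -> hom x z;
  comp1m : forall x y (f : hom x y), comp (idm y) f = f;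
  compm1 : forall x y (f : hom x y), comp f (idm x) = f;
  compA : forall x y z w (f : hom x y) (g : hom y z) (h : hom z w),
    comp h (comp g f) = comp (comp h g) f }.

Arguments idm {c} x.
Notation "g '\oc' f" := (comp g f) (at level 50, left associativity) : cat_scope.

Definition op (C : category) : category :=
  @Category C (fun x y => hom y x) (fun x => idm x)
    (fun x y z g f => f \oc g)
    (fun x y f => compm1 f) (fun x y f => comp1m f)
    (fun x y z w f g h => esym (compA h g f)).

Definition is_iso (C : category) (x y : C) (f : hom x y) : Prop :=
  exists g : hom y x, g \oc f = idm x /\ f \oc g = idm y.

(*  a --f--> b
    |g       |p
    v        v
    c --h--> d  *)
Definition is_pullback (C : category) (a b c d : C)
    (f : hom a b) (g : hom a c) (p : hom b d) (h : hom c d) : Prop :=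
  p \oc f = h \oc g /\
  forall (t : C) (u : hom t b) (v : hom t c), p \oc u = h \oc v ->
    exists! w : hom t a, f \oc w = u /\ g \oc w = v.

Definition is_terminal (C : category) (t : C) : Prop :=
  forall x : C, exists! f : hom x t, True.

Definition has_pullbacks (C : category) : Prop :=
  forall (b c d : C) (p : hom b d) (h : hom c d),
    exists (a : C) (f : hom a b) (g : hom a c), is_pullback f g p h.

Record functor (C D : category) := Functor {
  fob :> C -> D;
  fmap : forall x y, hom x y -> hom (fob x) (fob y);
  fmap1 : forall x, fmap (idm x) = idm (fob x);
  fmapM : forall x y z (f : hom x y) (g : hom y z),
    fmap (g \oc f) = fmap g \oc fmap f }.

Definition op_functor (C D : category) (F : functor C D) :
    functor (op C) (op D) :=
  @Functor (op C) (op D) F (fun x y f => fmap F f) (fun x => fmap1 F x)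
    (fun x y z f g => fmapM F g f).

Definition preserves_pullbacks (C D : category) (F : functor C D) : Prop :=
  forall (a b c d : C) (f : hom a b) (g : hom a c) (p : hom b d) (h : hom c d),
    is_pullback f g p h ->
    is_pullback (fmap F f) (fmap F g) (fmap F p) (fmap F h).

Definition fully_faithful (C D : category) (F : functor C D) : Prop :=
  forall x y : C, bijective (fun f : hom x y => fmap F f).

Definition is_equivalence (C D : category) (F : functor C D) : Prop :=
  fully_faithful F /\
  forall y : D, exists (x : C) (f : hom (F x) y), is_iso f.

Definition is_cat_iso (C D : category) (F : functor C D) : Prop :=
  fully_faithful F /\ bijective F.

(* L is left adjoint to R *)
Record adjunction (C D : category) (L : functor C D) (R : functor D C) :=
  Adjunction {
  aunit : forall x : C, hom x (R (L x));
  acounit : forall y : D, hom (L (R y)) y;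
  aunit_nat : forall (x x' : C) (f : hom x x'),
    aunit x' \oc f = fmap R (fmap L f) \oc aunit x;
  acounit_nat : forall (y y' : D) (f : hom y y'),
    acounit y' \oc fmap L (fmap R f) = f \oc acounit y;
  atriangleL : forall x : C, acounit (L x) \oc fmap L (aunit x) = idm (L x);
  atriangleR : forall y : D, fmap R (acounit y) \oc aunit (R y) = idm (R y) }.

(* The comparison isomorphisms are given for every arrow u equal to an
   identity and every commutative triangle h = g f, so that the coherence
   axioms need no transport along equalities between arrows of C.  The values
   on objects are a parameter: pseudo-functors on C and on op C can share
   them. *)
Record pseudofunctor (C : category) (O : C -> category) := Pseudofunctor {
  pmap : forall x y : C, hom x y -> functor (O x) (O y);
  punit : forall (x : C) (u : hom x x), u = idm x ->
    forall F : O x, hom F (pmap u F);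
  pcomp : forall (x y z : C) (f : hom x y) (g : hom y z) (h : hom x z),
    g \oc f = h -> forall F : O x, hom (pmap g (pmap f F)) (pmap h F);
  punit_nat : forall x u (e : u = idm x) (F G : O x) (k : hom F G),
    punit e G \oc k = fmap (pmap u) k \oc punit e F;
  punit_iso : forall x u (e : u = idm x) (F : O x), is_iso (punit e F);
  pcomp_nat : forall x y z (f : hom x y) (g : hom y z) h (e : g \oc f = h)
      (F G : O x) (k : hom F G),
    pcomp e G \oc fmap (pmap g) (fmap (pmap f) k) =
    fmap (pmap h) k \oc pcomp e F;
  pcomp_iso : forall x y z (f : hom x y) (g : hom y z) h (e : g \oc f = h)
      (F : O x), is_iso (pcomp e F);
  punit_l : forall x y (f : hom x y) u (eu : u = idm y) (e : u \oc f = f)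
      (F : O x),
    pcomp e F \oc punit eu (pmap f F) = idm (pmap f F);
  punit_r : forall x y (f : hom x y) u (eu : u = idm x) (e : f \oc u = f)
      (F : O x),
    pcomp e F \oc fmap (pmap f) (punit eu F) = idm (pmap f F);
  pcomp_assoc : forall x y z w (f : hom x y) (g : hom y z) (h : hom z w)
      gf hg hgf (e1 : g \oc f = gf) (e2 : h \oc gf = hgf)
      (e3 : h \oc g = hg) (e4 : hg \oc f = hgf) (F : O x),
    pcomp e2 F \oc fmap (pmap h) (pcomp e1 F) =
    pcomp e4 F \oc pcomp e3 (pmap f F) }.

Lemma fmap_eq1 (C D : category) (F : functor C D) x (u : hom x x) :
  u = idm x -> fmap F u = idm (F x).
Proof. by move=> ->; rewrite fmap1. Qed.

Lemma fmap_eqM (C D : category) (F : functor C D) x y z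
    (f : hom x y) (g : hom y z) h :
  g \oc f = h -> fmap F g \oc fmap F f = fmap F h.
Proof. by move=> <-; rewrite fmapM. Qed.

Definition pf_restrict (C D : category) (Phi : functor C D)
    (O : D -> category) (P : pseudofunctor O) :
    pseudofunctor (fun x : C => O (Phi x)) :=
  @Pseudofunctor C (fun x => O (Phi x))
    (fun x y f => pmap P (fmap Phi f))
    (fun x u e F => punit P (fmap_eq1 Phi e) F)
    (fun x y z f g h e F => pcomp P (fmap_eqM Phi e) F)
    (fun x u e F G k => punit_nat P (fmap_eq1 Phi e) k)
    (fun x u e F => punit_iso P (fmap_eq1 Phi e) F)
    (fun x y z f g h e F G k => pcomp_nat P (fmap_eqM Phi e) k)
    (fun x y z f g h e F => pcomp_iso P (fmap_eqM Phi e) F)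
    (fun x y f u eu e F =>
       punit_l P (fmap_eq1 Phi eu) (fmap_eqM Phi e) F)
    (fun x y f u eu e F =>
       punit_r P (fmap_eq1 Phi eu) (fmap_eqM Phi e) F)
    (fun x y z w f g h gf hg hgf e1 e2 e3 e4 F =>
       pcomp_assoc P (fmap_eqM Phi e1) (fmap_eqM Phi e2)
                     (fmap_eqM Phi e3) (fmap_eqM Phi e4) F).

(* Isomorphism of pseudo-functors: a pseudo-natural transformation whose
   components are isomorphisms of categories. *)
Record pf_iso (C : category) (O O' : C -> category)
    (P : pseudofunctor O) (Q : pseudofunctor O') := PfIso {
  pi_fun : forall x : C, functor (O x) (O' x);
  pi_fun_iso : forall x : C, is_cat_iso (pi_fun x);
  pi_hom : forall (x y : C) (f : hom x y) (F : O x),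
    hom (pi_fun y (pmap P f F)) (pmap Q f (pi_fun x F));
  pi_hom_nat : forall x y (f : hom x y) (F G : O x) (k : hom F G),
    pi_hom f G \oc fmap (pi_fun y) (fmap (pmap P f) k) =
    fmap (pmap Q f) (fmap (pi_fun x) k) \oc pi_hom f F;
  pi_hom_iso : forall x y (f : hom x y) (F : O x), is_iso (pi_hom f F);
  pi_punit : forall x (u : hom x x) (e : u = idm x) (F : O x),
    pi_hom u F \oc fmap (pi_fun x) (punit P e F) = punit Q e (pi_fun x F);
  pi_pcomp : forall x y z (f : hom x y) (g : hom y z) h (e : g \oc f = h)
      (F : O x),
    pi_hom h F \oc fmap (pi_fun z) (pcomp P e F) =
    pcomp Q e (pi_fun x F) \oc fmap (pmap Q g) (pi_hom f F)
      \oc pi_hom g (pmap P f F) }.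

(* [cpmap H f] is the functor O y -> O x attached to f : x -> y in J by a
   pseudo-functor H on op J, and [cpcomp], [cpunit] are its constraints. *)
Definition cpmap (J : category) (O : J -> category)
    (H : @pseudofunctor (op J) O) (x y : J) (f : hom x y) :
    functor (O y) (O x) := @pmap (op J) O H y x f.

Definition cpunit (J : category) (O : J -> category)
    (H : @pseudofunctor (op J) O) (x : J) (F : O x) :
    hom F (cpmap H (idm x) F) := @punit (op J) O H x (idm x) erefl F.

Definition cpcomp (J : category) (O : J -> category)
    (H : @pseudofunctor (op J) O) (x y z : J)
    (f : hom x y) (g : hom y z) (h : hom x z) (e : g \oc f = h) (K : O z) :
    hom (cpmap H f (cpmap H g K)) (cpmap H h K) :=
  @pcomp (op J) O H z y x g f h e K.

(* Adjunctions f^* -| f_* compatible with identities and composition. *)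
Record star_adjunction (J : category) (O : J -> category)
    (Hd : @pseudofunctor J O) (Hu : @pseudofunctor (op J) O) :=
  StarAdjunction {
  star_adj : forall (x y : J) (f : hom x y),
    adjunction (cpmap Hu f) (pmap Hd f);
  star_adj_id : forall (x : J) (F : O x),
    aunit (star_adj (idm x)) F =
    punit Hd erefl (cpmap Hu (idm x) F) \oc cpunit Hu F;
  star_adj_comp : forall (x y z : J) (f : hom x y) (g : hom y z) (h : hom x z)
      (e : g \oc f = h) (K : O z),
    aunit (star_adj h) K =
    fmap (pmap Hd h) (cpcomp Hu e K)
      \oc pcomp Hd e (cpmap Hu f (cpmap Hu g K))
      \oc fmap (pmap Hd g) (aunit (star_adj f) (cpmap Hu g K))
      \oc aunit (star_adj g) K }.

(* Adjunctions f_! -| f^! compatible with identities and composition. *)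
Record shriek_adjunction (J : category) (O : J -> category)
    (Hd : @pseudofunctor J O) (Hu : @pseudofunctor (op J) O) :=
  ShriekAdjunction {
  shriek_adj : forall (x y : J) (f : hom x y),
    adjunction (pmap Hd f) (cpmap Hu f);
  shriek_adj_id : forall (x : J) (F : O x),
    aunit (shriek_adj (idm x)) F =
    cpunit Hu (pmap Hd (idm x) F) \oc punit Hd erefl F;
  shriek_adj_comp : forall (x y z : J) (f : hom x y) (g : hom y z)
      (h : hom x z) (e : g \oc f = h) (F : O x),
    aunit (shriek_adj h) F =
    fmap (cpmap Hu h) (pcomp Hd e F)
      \oc cpcomp Hu e (pmap Hd g (pmap Hd f F))
      \oc fmap (cpmap Hu f) (aunit (shriek_adj g) (pmap Hd f F))
      \oc aunit (shriek_adj f) F }.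

Record four_functors (J : category) := FourFunctors {
  fval :> J -> category;
  lower_star : @pseudofunctor J fval;
  upper_star : @pseudofunctor (op J) fval;
  lower_shriek : @pseudofunctor J fval;
  upper_shriek : @pseudofunctor (op J) fval;
  adj_star : star_adjunction lower_star upper_star;
  adj_shriek : shriek_adjunction lower_shriek upper_shriek }.

Notation "f '_*[' H ]" := (pmap (lower_star H) f)
  (at level 2, format "f _*[ H ]") : cat_scope.
Notation "f '^*[' H ]" := (cpmap (upper_star H) f)
  (at level 2, format "f ^*[ H ]") : cat_scope.
Notation "f '_![' H ]" := (pmap (lower_shriek H) f)
  (at level 2, format "f _![ H ]") : cat_scope.
Notation "f '^![' H ]" := (cpmap (upper_shriek H) f)
  (at level 2, format "f ^![ H ]") : cat_scope.

Definition lower_exchange (J : category) (H : four_functors J) : Type :=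
  forall (a b c d : J) (f : hom a b) (g : hom a c) (p : hom b d) (h : hom c d),
  is_pullback f g p h ->
  forall F : H a, hom (p _![H] (f _*[H] F)) (h _*[H] (g _![H] F)).

Definition upper_exchange (J : category) (H : four_functors J) : Type :=
  forall (a b c d : J) (f : hom a b) (g : hom a c) (p : hom b d) (h : hom c d),
  is_pullback f g p h ->
  forall K : H d, hom (f ^*[H] (p ^![H] K)) (g ^![H] (h ^*[H] K)).

(* h^* p_! -> g_! f^*, the adjoint form of a lower exchange morphism *)
Definition lower_mate (J : category) (H : four_functors J)
    (lo : lower_exchange H) (a b c d : J) (f : hom a b) (g : hom a c)
    (p : hom b d) (h : hom c d) (pb : is_pullback f g p h) (M : H b) :
    hom (h ^*[H] (p _![H] M)) (g _![H] (f ^*[H] M)) :=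
  acounit (star_adj (adj_star H) h) (g _![H] (f ^*[H] M))
    \oc fmap (h ^*[H]) (lo _ _ _ _ _ _ _ _ pb (f ^*[H] M))
    \oc fmap (h ^*[H]) (fmap (p _![H]) (aunit (star_adj (adj_star H) f) M)).

(* g_! f^* -> h^* p_!, the adjoint form of an upper exchange morphism *)
Definition upper_mate (J : category) (H : four_functors J)
    (up : upper_exchange H) (a b c d : J) (f : hom a b) (g : hom a c)
    (p : hom b d) (h : hom c d) (pb : is_pullback f g p h) (M : H b) :
    hom (g _![H] (f ^*[H] M)) (h ^*[H] (p _![H] M)) :=
  acounit (shriek_adj (adj_shriek H) g) (h ^*[H] (p _![H] M))
    \oc fmap (g _![H]) (up _ _ _ _ _ _ _ _ pb (p _![H] M))
    \oc fmap (g _![H]) (fmap (f ^*[H]) (aunit (shriek_adj (adj_shriek H) p) M)).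

(* f_* g^! -> p^! h_*, the transpose of lower_mate between right adjoints *)
Definition lower_comate (J : category) (H : four_functors J)
    (lo : lower_exchange H) (a b c d : J) (f : hom a b) (g : hom a c)
    (p : hom b d) (h : hom c d) (pb : is_pullback f g p h) (M : H c) :
    hom (f _*[H] (g ^![H] M)) (p ^![H] (h _*[H] M)) :=
  fmap (p ^![H]) (fmap (h _*[H]) (acounit (shriek_adj (adj_shriek H) g) M))
    \oc fmap (p ^![H]) (lo _ _ _ _ _ _ _ _ pb (g ^![H] M))
    \oc aunit (shriek_adj (adj_shriek H) p) (f _*[H] (g ^![H] M)).

Record is_cross_exchange (J : category) (H : four_functors J)
    (lo : lower_exchange H) (up : upper_exchange H) : Prop := {
  lower_nat : forall (a b c d : J) (f : hom a b) (g : hom a c) (p : hom b d)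
      (h : hom c d) (pb : is_pullback f g p h) (F G : H a) (k : hom F G),
    lo _ _ _ _ _ _ _ _ pb G \oc fmap (p _![H]) (fmap (f _*[H]) k) =
    fmap (h _*[H]) (fmap (g _![H]) k) \oc lo _ _ _ _ _ _ _ _ pb F;
  upper_nat : forall (a b c d : J) (f : hom a b) (g : hom a c) (p : hom b d)
      (h : hom c d) (pb : is_pullback f g p h) (K L : H d) (k : hom K L),
    up _ _ _ _ _ _ _ _ pb L \oc fmap (f ^*[H]) (fmap (p ^![H]) k) =
    fmap (g ^![H]) (fmap (h ^*[H]) k) \oc up _ _ _ _ _ _ _ _ pb K;
  (* Horizontal composition:   a --f--> b --f'--> b'
                               |g       |p        |q
                               c --h--> d --h'--> d'     *)
  lower_horizontal : forall (a b b' c d d' : J)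
      (f : hom a b) (f' : hom b b') (g : hom a c) (p : hom b d) (q : hom b' d')
      (h : hom c d) (h' : hom d d') (ff : hom a b') (hh : hom c d')
      (ef : f' \oc f = ff) (eh : h' \oc h = hh)
      (pb1 : is_pullback f g p h) (pb2 : is_pullback f' p q h')
      (pb : is_pullback ff g q hh) (F : H a),
    lo _ _ _ _ _ _ _ _ pb F \oc fmap (q _![H]) (pcomp (lower_star H) ef F) =
    pcomp (lower_star H) eh (g _![H] F)
      \oc fmap (h' _*[H]) (lo _ _ _ _ _ _ _ _ pb1 F)
      \oc lo _ _ _ _ _ _ _ _ pb2 (f _*[H] F);
  upper_horizontal : forall (a b b' c d d' : J)
      (f : hom a b) (f' : hom b b') (g : hom a c) (p : hom b d) (q : hom b' d')
      (h : hom c d) (h' : hom d d') (ff : hom a b') (hh : hom c d')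
      (ef : f' \oc f = ff) (eh : h' \oc h = hh)
      (pb1 : is_pullback f g p h) (pb2 : is_pullback f' p q h')
      (pb : is_pullback ff g q hh) (K : H d'),
    up _ _ _ _ _ _ _ _ pb K \oc cpcomp (upper_star H) ef (q ^![H] K) =
    fmap (g ^![H]) (cpcomp (upper_star H) eh K)
      \oc up _ _ _ _ _ _ _ _ pb1 (h' ^*[H] K)
      \oc fmap (f ^*[H]) (up _ _ _ _ _ _ _ _ pb2 K);
  (* Vertical composition:   a --f--> b
                             |g       |p
                             c --h--> d
                             |g'      |p'
                             c' -k--> d'     *)
  lower_vertical : forall (a b c d c' d' : J)
      (f : hom a b) (g : hom a c) (p : hom b d) (h : hom c d)
      (g' : hom c c') (p' : hom d d') (k : hom c' d')
      (gg : hom a c') (pp : hom b d')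
      (eg : g' \oc g = gg) (ep : p' \oc p = pp)
      (pb1 : is_pullback f g p h) (pb2 : is_pullback h g' p' k)
      (pb : is_pullback f gg pp k) (F : H a),
    lo _ _ _ _ _ _ _ _ pb F \oc pcomp (lower_shriek H) ep (f _*[H] F) =
    fmap (k _*[H]) (pcomp (lower_shriek H) eg F)
      \oc lo _ _ _ _ _ _ _ _ pb2 (g _![H] F)
      \oc fmap (p' _![H]) (lo _ _ _ _ _ _ _ _ pb1 F);
  upper_vertical : forall (a b c d c' d' : J)
      (f : hom a b) (g : hom a c) (p : hom b d) (h : hom c d)
      (g' : hom c c') (p' : hom d d') (k : hom c' d')
      (gg : hom a c') (pp : hom b d')
      (eg : g' \oc g = gg) (ep : p' \oc p = pp)
      (pb1 : is_pullback f g p h) (pb2 : is_pullback h g' p' k)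
      (pb : is_pullback f gg pp k) (K : H d'),
    up _ _ _ _ _ _ _ _ pb K
      \oc fmap (f ^*[H]) (cpcomp (upper_shriek H) ep K) =
    cpcomp (upper_shriek H) eg (k ^*[H] K)
      \oc fmap (g ^![H]) (up _ _ _ _ _ _ _ _ pb2 K)
      \oc up _ _ _ _ _ _ _ _ pb1 (p' ^![H] K);
  lower_id_horizontal : forall (a c : J) (g : hom a c)
      (pb : is_pullback (idm a) g g (idm c)) (F : H a),
    is_iso (lo _ _ _ _ _ _ _ _ pb F);
  lower_id_vertical : forall (a b : J) (f : hom a b)
      (pb : is_pullback f (idm a) (idm b) f) (F : H a),
    is_iso (lo _ _ _ _ _ _ _ _ pb F);
  upper_id_horizontal : forall (a c : J) (g : hom a c)
      (pb : is_pullback (idm a) g g (idm c)) (K : H c),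
    is_iso (up _ _ _ _ _ _ _ _ pb K);
  upper_id_vertical : forall (a b : J) (f : hom a b)
      (pb : is_pullback f (idm a) (idm b) f) (K : H b),
    is_iso (up _ _ _ _ _ _ _ _ pb K);
  mates_inverse : forall (a b c d : J) (f : hom a b) (g : hom a c)
      (p : hom b d) (h : hom c d) (pb : is_pullback f g p h) (M : H b),
    upper_mate up pb M \oc lower_mate lo pb M = idm _ /\
    lower_mate lo pb M \oc upper_mate up pb M = idm _ }.

(* A cross functor whose underlying pseudo-functors and adjunctions are H. *)
Record cross_functor (J : category) (H : four_functors J) := CrossFunctor {
  cf_lower : lower_exchange H;
  cf_upper : upper_exchange H;
  cf_exchange : is_cross_exchange cf_lower cf_upper }.

Record span (J : category) (x y : J) := Span {
  apex : J;
  lleg : hom apex x;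
  rleg : hom apex y }.

Definition span_equiv (J : category) (x y : J) (s t : span x y) : Prop :=
  exists k : hom (apex s) (apex t),
    [/\ is_iso k, lleg t \oc k = lleg s & rleg t \oc k = rleg s].

(* An equivalence class of spans, as the predicate of its members. *)
Record span_class (J : category) (x y : J) := SpanClass {
  in_class :> span x y -> Prop;
  in_classP : exists s, forall t, in_class t <-> span_equiv s t }.

(* [t] is a composite of [s] and [s'] : x <- apex s -> y <- apex s' -> z *)
Definition span_composite (J : category) (x y z : J)
    (s : span x y) (s' : span y z) (t : span x z) : Prop :=
  exists (q : hom (apex t) (apex s)) (q' : hom (apex t) (apex s')),
    [/\ is_pullback q q' (rleg s) (lleg s'),
        lleg s \oc q = lleg t & rleg s' \oc q' = rleg t].

Lemma is_iso_id (C : category) (x : C) : is_iso (idm x).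
Proof. by exists (idm x); rewrite comp1m. Qed.

Lemma is_iso_comp (C : category) (x y z : C) (f : hom x y) (g : hom y z) :
  is_iso f -> is_iso g -> is_iso (g \oc f).
Proof.
move=> [f' [f1 f2]] [g' [g1 g2]]; exists (f' \oc g'); split.
  by rewrite compA -(compA g) g1 compm1.
by rewrite compA -(compA f') f2 compm1.
Qed.

Lemma pullback_lift (C : category) (a b c d : C) (f : hom a b) (g : hom a c)
    (p : hom b d) (h : hom c d) (t : C) (u : hom t b) (v : hom t c) :
  is_pullback f g p h -> p \oc u = h \oc v ->
  exists w : hom t a, f \oc w = u /\ g \oc w = v.
Proof. by move=> [_ U] /U[w [? _]]; exists w. Qed.

Lemma pullback_ext (C : category) (a b c d : C) (f : hom a b) (g : hom a c)
    (p : hom b d) (h : hom c d) (t : C) (w w' : hom t a) :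
  is_pullback f g p h -> f \oc w = f \oc w' -> g \oc w = g \oc w' -> w = w'.
Proof.
move=> [e U] e1 e2; have /U[w0 [_ u]] : p \oc (f \oc w) = h \oc (g \oc w).
  by rewrite !compA e.
by rewrite -(u w)// (u w').
Qed.

Lemma pullback_build (C : category) (a b c d : C) (f : hom a b) (g : hom a c)
    (p : hom b d) (h : hom c d) :
  p \oc f = h \oc g ->
  (forall t (u : hom t b) (v : hom t c), p \oc u = h \oc v ->
    exists w : hom t a, f \oc w = u /\ g \oc w = v) ->
  (forall t (w w' : hom t a), f \oc w = f \oc w' -> g \oc w = g \oc w' ->
    w = w') ->
  is_pullback f g p h.
Proof.
move=> e ex un; split=> // t u v /ex[w [w1 w2]].
by exists w; split=> // w' [w1' w2']; apply: un; rewrite ?w1' ?w2'.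
Qed.

Lemma span_equiv_refl (J : category) (x y : J) (s : span x y) : span_equiv s s.
Proof. by exists (idm _); rewrite !compm1; split=> //; exact: is_iso_id. Qed.

Lemma span_equiv_sym (J : category) (x y : J) (s t : span x y) :
  span_equiv s t -> span_equiv t s.
Proof.
move=> [k [[k' [k1 k2]] e1 e2]]; exists k'.
by split; [exists k | rewrite -e1 -compA k2 compm1 | rewrite -e2 -compA k2 compm1].
Qed.

Lemma span_equiv_trans (J : category) (x y : J) (s t u : span x y) :
  span_equiv s t -> span_equiv t u -> span_equiv s u.
Proof.
move=> [k [ik e1 e2]] [k' [ik' e1' e2']]; exists (k' \oc k).
by split; [exact: is_iso_comp | rewrite compA e1' | rewrite compA e2'].
Qed.

Lemma span_class_eq (J : category) (x y : J) (C D : span_class x y) :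
  (forall t, C t <-> D t) -> C = D.
Proof.
case: C D => C Cp [D Dp] /= CD.
have E : C = D by apply/funext => t; apply/propext/CD.
by subst D; congr SpanClass; exact: Prop_irrelevance.
Qed.

Lemma in_class_equiv (J : category) (x y : J) (C : span_class x y) s t :
  C s -> C t -> span_equiv s t.
Proof.
have [u Cu] := in_classP C => /Cu us /Cu ut.
exact: span_equiv_trans (span_equiv_sym us) ut.
Qed.

Lemma in_class_resp (J : category) (x y : J) (C : span_class x y) s t :
  C s -> span_equiv s t -> C t.
Proof.
by have [u Cu] := in_classP C => /Cu us st; apply/Cu/(span_equiv_trans us).
Qed.

Lemma in_class_ex (J : category) (x y : J) (C : span_class x y) : exists s, C s.
Proof.
by have [u Cu] := in_classP C; exists u; apply/Cu; exact: span_equiv_refl.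
Qed.

Definition class_of (J : category) (x y : J) (s : span x y) : span_class x y :=
  SpanClass (ex_intro _ s (fun t => conj (fun h => h) (fun h => h))).

Lemma class_of_in (J : category) (x y : J) (s : span x y) : class_of s s.
Proof. exact: span_equiv_refl. Qed.

Lemma in_class_of (J : category) (x y : J) (C : span_class x y) s :
  C s -> class_of s = C.
Proof.
move=> Cs; apply: span_class_eq => t; split; first exact: in_class_resp.
exact: in_class_equiv.
Qed.

Lemma pullback_iso_legs (C : category) (a b c d b' c' : C)
    (f : hom a b) (g : hom a c) (p : hom b d) (h : hom c d)
    (k : hom b b') (k' : hom c c') (p' : hom b' d) (h' : hom c' d) :
  is_pullback f g p h -> is_iso k -> is_iso k' ->
  p' \oc k = p -> h' \oc k' = h -> is_pullback (k \oc f) (k' \oc g) p' h'.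
Proof.
move=> pb [l [l1 l2]] [l' [l1' l2']] ep eh; apply: pullback_build.
- by rewrite !compA ep eh; case: pb.
- move=> t u v e.
  have [|w [w1 w2]] := pullback_lift pb (u := l \oc u) (v := l' \oc v).
    by rewrite -ep -eh -!compA (compA _ l k) (compA _ l' k') l2 l2' !comp1m.
  by exists w; rewrite -!compA w1 w2 !compA l2 l2' !comp1m.
- move=> t w w'; rewrite -!compA => e1 e2; apply: (pullback_ext pb).
    by move: (congr1 (fun i => l \oc i) e1); rewrite !(compA _ k l) l1 !comp1m.
  by move: (congr1 (fun i => l' \oc i) e2); rewrite !(compA _ k' l') l1' !comp1m.
Qed.

Lemma composite_equiv (J : category) (x y z : J) (s s1 : span x y)
    (s' s1' : span y z) (t t1 : span x z) :
  span_equiv s s1 -> span_equiv s' s1' ->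
  span_composite s s' t -> span_composite s1 s1' t1 -> span_equiv t t1.
Proof.
move=> [k [ik e1 e2]] [k' [ik' e1' e2']] [q [q' [pb el er]]]
  [q1 [q1' [pb1 el1 er1]]].
have pb2 := pullback_iso_legs pb ik ik' e2 e1'.
have [|w [w1 w2]] := pullback_lift pb1 (u := k \oc q) (v := k' \oc q').
  by case: pb2.
have [|v [v1 v2]] := pullback_lift pb2 (u := q1) (v := q1'); first by case: pb1.
exists w; split.
- exists v; split.
    by apply: (pullback_ext pb2); rewrite compA ?v1 ?v2 ?w1 ?w2 compm1.
  by apply: (pullback_ext pb1); rewrite compA ?w1 ?w2 ?v1 ?v2 compm1.
- by rewrite -el1 -compA w1 compA e1.
- by rewrite -er1 -compA w2 compA e2'.
Qed.

Lemma composite_resp (J : category) (x y z : J) (s : span x y)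
    (s' : span y z) (t t1 : span x z) :
  span_composite s s' t -> span_equiv t t1 -> span_composite s s' t1.
Proof.
move=> [q [q' [pb el er]]] [k [[l [l1 l2]] e1 e2]].
exists (q \oc l), (q' \oc l); split.
- apply: pullback_build.
  + by rewrite !compA; case: pb => ->.
  + move=> w u v /(pullback_lift pb)[m [m1 m2]]; exists (k \oc m).
    by rewrite !compA -2!(compA _ l) l1 !compm1.
  + move=> w u v; rewrite -!compA => h1 h2.
    have := pullback_ext pb h1 h2 => /(congr1 (fun i => k \oc i)).
    by rewrite !compA l2 !comp1m.
- by rewrite compA el -e1 -compA l2 compm1.
- by rewrite compA er -e2 -compA l2 compm1.
Qed.

Lemma composite_assoc (J : category) (x y z w : J) (s1 : span x y)
    (s2 : span y z) (s3 : span z w) u v t :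
  span_composite s1 s2 u -> span_composite u s3 t -> span_composite s2 s3 v ->
  span_composite s1 v t.
Proof.
move=> [qu [qu' [pbu lu ru]]] [a [b [pbt lt rt]]] [c [d [pbv lv rv]]].
have [|e [e1 e2]] := pullback_lift pbv (u := qu' \oc a) (v := b).
  by rewrite compA ru; case: pbt.
exists (qu \oc a), e; split; last 2 first.
- by rewrite compA lu.
- by rewrite -rv -compA e2.
apply: pullback_build.
- by rewrite compA -lv -(compA e c) e1; case: pbu => ->; rewrite !compA.
- move=> T m n; rewrite -lv -compA => /(pullback_lift pbu)[w1 [w11 w12]].
  have [|w2 [w21 w22]] := pullback_lift pbt (u := w1) (v := d \oc n).
    by rewrite -ru -compA w12 !compA; case: pbv => ->.
  exists w2; rewrite -compA w21; split=> //; apply: (pullback_ext pbv).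
    by rewrite compA e1 -compA w21.
  by rewrite compA e2.
- move=> T m n; rewrite -!compA => h1 h2; apply: (pullback_ext pbt).
    apply: (pullback_ext pbu) => //.
    by rewrite (compA m) (compA n) -e1 -!compA h2.
  by rewrite -e2 -!compA h2.
Qed.

Definition span_flip (J : category) (x y : J) (s : span x y) : span y x :=
  Span (rleg s) (lleg s).

Lemma pullback_flip (C : category) (a b c d : C) (f : hom a b) (g : hom a c)
    (p : hom b d) (h : hom c d) :
  is_pullback f g p h -> is_pullback g f h p.
Proof.
move=> pb; apply: pullback_build; first by case: pb.
  by move=> t u v e; have [w [? ?]] := pullback_lift pb (esym e); exists w.
by move=> t u v h1 h2; exact: (pullback_ext pb).
Qed.

Lemma composite_flip (J : category) (x y z : J) (s : span x y)
    (s' : span y z) (t : span x z) : span_composite s s' t ->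
  span_composite (span_flip s') (span_flip s) (span_flip t).
Proof.
by move=> [q [q' [pb el er]]]; exists q', q; split=> //; exact: pullback_flip.
Qed.

Lemma span_flipK (J : category) (x y : J) (s : span x y) :
  span_flip (span_flip s) = s.
Proof. by case: s. Qed.

Lemma composite_assoc' (J : category) (x y z w : J) (s1 : span x y)
    (s2 : span y z) (s3 : span z w) u v t :
  span_composite s2 s3 v -> span_composite s1 v t -> span_composite s1 s2 u ->
  span_composite u s3 t.
Proof.
move=> /composite_flip h1 /composite_flip h2 /composite_flip h3.
by have := composite_flip (composite_assoc h1 h2 h3); rewrite !span_flipK.
Qed.

Lemma composite_ex (J : category) (hJ : has_pullbacks J) (x y z : J)
    (s : span x y) (s' : span y z) : exists t, span_composite s s' t.
Proof.
have [v [q [q' pb]]] := hJ _ _ _ (rleg s) (lleg s').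
by exists (Span (lleg s \oc q) (rleg s' \oc q')), q, q'.
Qed.

Lemma span_comp_class (J : category) (hJ : has_pullbacks J) (x y z : J)
    (D : span_class y z) (C : span_class x y) : exists t0, forall t,
  (exists s s', [/\ C s, D s' & span_composite s s' t]) <-> span_equiv t0 t.
Proof.
have [s Cs] := in_class_ex C; have [s' Ds'] := in_class_ex D.
have [t0 c0] := composite_ex hJ s s'; exists t0 => t; split.
  move=> [s1 [s1' [Cs1 Ds1' c]]].
  exact: (composite_equiv (in_class_equiv Cs Cs1) (in_class_equiv Ds' Ds1') c0).
by move=> /(composite_resp c0) c; exists s, s'.
Qed.

Definition span_comp (J : category) (hJ : has_pullbacks J) (x y z : J)
    (D : span_class y z) (C : span_class x y) : span_class x z :=
  SpanClass (span_comp_class hJ D C).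

Definition id_span (J : category) (x : J) : span x x := Span (idm x) (idm x).

Lemma composite_id_r (J : category) (x y : J) (s : span x y) :
  span_composite s (id_span y) s.
Proof.
exists (idm _), (rleg s); rewrite !compm1 comp1m; split=> //.
apply: pullback_build => /=; first by rewrite compm1 comp1m.
  by move=> t u v; rewrite comp1m => e; exists u; rewrite comp1m.
by move=> t w w'; rewrite !comp1m.
Qed.

Lemma composite_id_l (J : category) (x y : J) (s : span x y) :
  span_composite (id_span x) s s.
Proof.
by have := composite_flip (composite_id_r (span_flip s)); rewrite span_flipK.
Qed.

Lemma span_comp1m (J : category) (hJ : has_pullbacks J) (x y : J)
    (C : span_class x y) : span_comp hJ (class_of (id_span y)) C = C.
Proof.
apply: span_class_eq => t; split=> [[s [s' [Cs s'1 c]]]|Ct].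
  apply: in_class_resp (Cs) _.
  exact: composite_equiv (span_equiv_refl s) s'1 (composite_id_r s) c.
exists t, (id_span y); split=> //; first exact: class_of_in.
exact: composite_id_r.
Qed.

Lemma span_compm1 (J : category) (hJ : has_pullbacks J) (x y : J)
    (C : span_class x y) : span_comp hJ C (class_of (id_span x)) = C.
Proof.
apply: span_class_eq => t; split=> [[s [s' [s1 Cs' c]]]|Ct].
  apply: in_class_resp (Cs') _.
  exact: composite_equiv s1 (span_equiv_refl s') (composite_id_l s') c.
exists (id_span x), t; split=> //; first exact: class_of_in.
exact: composite_id_l.
Qed.

Lemma span_compA (J : category) (hJ : has_pullbacks J) (x y z w : J)
    (B : span_class x y) (C : span_class y z) (D : span_class z w) :
  span_comp hJ D (span_comp hJ C B) = span_comp hJ (span_comp hJ D C) B.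
Proof.
apply: span_class_eq => t; split.
- move=> [u [s3 [[s1 [s2 [Bs1 Cs2 cu]]] Ds3 ct]]].
  have [v cv] := composite_ex hJ s2 s3; exists s1, v; split=> //.
    by exists s2, s3.
  exact: composite_assoc cu ct cv.
- move=> [s1 [v [Bs1 [s2 [s3 [Cs2 Ds3 cv]]] ct]]].
  have [u cu] := composite_ex hJ s1 s2; exists u, s3; split=> //.
    by exists s1, s2.
  exact: composite_assoc' cv ct cu.
Qed.

Definition span_cat (J : category) (hJ : has_pullbacks J) : category :=
  @Category J (@span_class J) (fun x => class_of (id_span x))
    (@span_comp J hJ) (@span_comp1m J hJ) (@span_compm1 J hJ)
    (@span_compA J hJ).

Definition cov_span (J : category) (x y : J) (f : hom x y) : span x y :=
  Span (idm x) f.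

Definition contra_span (J : category) (x y : J) (f : hom x y) : span y x :=
  Span f (idm x).

Lemma cov_span_comp (J : category) (x y z : J) (f : hom x y) (g : hom y z) :
  span_composite (cov_span f) (cov_span g) (cov_span (g \oc f)).
Proof.
exists (idm x), f; rewrite /= compm1; split=> //; apply: pullback_build => /=.
- by rewrite compm1 comp1m.
- by move=> t u v; rewrite comp1m => e; exists u; rewrite comp1m.
- by move=> t w w'; rewrite !comp1m.
Qed.

Lemma class_of_comp (J : category) (hJ : has_pullbacks J) (x y z : J)
    (s : span x y) (s' : span y z) t :
  span_composite s s' t ->
  class_of t = span_comp hJ (class_of s') (class_of s).
Proof.
move=> c; apply: in_class_of; exists s, s'.
by split=> //; exact: class_of_in.
Qed.

Definition span_i (J : category) (hJ : has_pullbacks J) :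
    functor J (span_cat hJ) :=
  @Functor J (span_cat hJ) (fun x => x)
    (fun x y f => class_of (cov_span f)) (fun x => erefl)
    (fun x y z f g => class_of_comp hJ (cov_span_comp f g)).

Lemma contra_span_comp (J : category) (x y z : J) (f : hom x y) (g : hom y z) :
  span_composite (contra_span g) (contra_span f) (contra_span (g \oc f)).
Proof. exact: (composite_flip (cov_span_comp f g)). Qed.

Definition span_j (J : category) (hJ : has_pullbacks J) :
    functor (op J) (span_cat hJ) :=
  @Functor (op J) (span_cat hJ) (fun x => x)
    (fun x y f => class_of (@contra_span J y x f)) (fun x => erefl)
    (fun x y z f g => class_of_comp hJ (@contra_span_comp J z y x g f)).

(* [op_functor (span_j hJ)] starts from op (op J), which is J up to the proofs
   of the axioms only. *)
Definition span_j_op (J : category) (hJ : has_pullbacks J) :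
    functor J (op (span_cat hJ)) :=
  @Functor J (op (span_cat hJ)) (fun x => x)
    (fun x y f => class_of (contra_span f)) (fun x => erefl)
    (fun x y z f g => class_of_comp hJ (contra_span_comp f g)).

Definition is_mackey_star_shriek (J : category) (hJ : has_pullbacks J)
    (H : four_functors J) (O : span_cat hJ -> category)
    (P : @pseudofunctor (span_cat hJ) O) : Prop :=
  inhabited (pf_iso (pf_restrict (span_i hJ) P) (lower_shriek H)) /\
  inhabited (pf_iso (pf_restrict (span_j hJ) P) (upper_star H)).

Definition is_mackey_shriek_star (J : category) (hJ : has_pullbacks J)
    (H : four_functors J) (O : op (span_cat hJ) -> category)
    (P : @pseudofunctor (op (span_cat hJ)) O) : Prop :=
  inhabited (pf_iso (pf_restrict (op_functor (span_i hJ)) P)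
                    (upper_shriek H)) /\
  inhabited (pf_iso (pf_restrict (span_j_op hJ) P) (lower_star H)).

(* [P] is the pseudo-functor given by f_{r!} f_l^* on x <-f_l- z -f_r-> y, with
   composition by base change.  The functor attached to an equivalence class
   of spans is identified with f_{r!} f_l^* for every representative.  The
   compatibility of these identifications with isomorphisms of spans is the
   case of [ssr_comp] in which one of the two spans is an identity span. *)
Record star_shriek_realisation (J : category) (hJ : has_pullbacks J)
    (H : four_functors J) (lo : lower_exchange H)
    (P : @pseudofunctor (span_cat hJ) H) := StarShriekRealisation {
  ssr : forall (x y : J) (m : span_class x y) (s : span x y), m s ->
    forall K : H x,
    hom (@pmap (span_cat hJ) H P x y m K)
        ((rleg s) _![H] ((lleg s) ^*[H] K));
  ssr_nat : forall (x y : J) (m : span_class x y) (s : span x y) (ms : m s)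
      (K L : H x) (k : hom K L),
    ssr ms L \oc fmap (@pmap (span_cat hJ) H P x y m) k =
    fmap ((rleg s) _![H]) (fmap ((lleg s) ^*[H]) k) \oc ssr ms K;
  ssr_iso : forall (x y : J) (m : span_class x y) (s : span x y) (ms : m s)
      (K : H x), is_iso (ssr ms K);
  ssr_id : forall (x : J) (K : H x),
    ssr (class_of_in (id_span x)) K
      \oc @punit (span_cat hJ) H P x (@idm (span_cat hJ) x) erefl K =
    punit (lower_shriek H) erefl ((idm x) ^*[H] K)
      \oc cpunit (upper_star H) K;
  ssr_comp : forall (x y z : J) (m : span_class x y) (n : span_class y z)
      (mn : span_class x z) (e : span_comp hJ n m = mn)
      (s : span x y) (t : span y z) (c : span x z)
      (ms : m s) (nt : n t) (mnc : mn c)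
      (q : hom (apex c) (apex s)) (q' : hom (apex c) (apex t))
      (pb : is_pullback q q' (rleg s) (lleg t))
      (el : lleg s \oc q = lleg c) (er : rleg t \oc q' = rleg c) (K : H x),
    ssr mnc K \oc @pcomp (span_cat hJ) H P x y z m n mn e K =
    pcomp (lower_shriek H) er ((lleg c) ^*[H] K)
      \oc fmap ((rleg t) _![H]) (fmap (q' _![H]) (cpcomp (upper_star H) el K))
      \oc fmap ((rleg t) _![H]) (lower_mate lo pb ((lleg s) ^*[H] K))
      \oc fmap ((rleg t) _![H]) (fmap ((lleg t) ^*[H]) (ssr ms K))
      \oc ssr nt (@pmap (span_cat hJ) H P x y m K) }.

(* The same for the right adjoints f_{l*} f_r^!. *)
Record shriek_star_realisation (J : category) (hJ : has_pullbacks J)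
    (H : four_functors J) (lo : lower_exchange H)
    (P : @pseudofunctor (op (span_cat hJ)) H) := ShriekStarRealisation {
  srs : forall (x y : J) (m : span_class x y) (s : span x y), m s ->
    forall K : H y,
    hom ((lleg s) _*[H] ((rleg s) ^![H] K))
        (@pmap (op (span_cat hJ)) H P y x m K);
  srs_nat : forall (x y : J) (m : span_class x y) (s : span x y) (ms : m s)
      (K L : H y) (k : hom K L),
    srs ms L \oc fmap ((lleg s) _*[H]) (fmap ((rleg s) ^![H]) k) =
    fmap (@pmap (op (span_cat hJ)) H P y x m) k \oc srs ms K;
  srs_iso : forall (x y : J) (m : span_class x y) (s : span x y) (ms : m s)
      (K : H y), is_iso (srs ms K);
  srs_id : forall (x : J) (K : H x),
    srs (class_of_in (id_span x)) K
      \oc punit (lower_star H) erefl ((idm x) ^![H] K)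
      \oc cpunit (upper_shriek H) K =
    @punit (op (span_cat hJ)) H P x (@idm (span_cat hJ) x) erefl K;
  srs_comp : forall (x y z : J) (m : span_class x y) (n : span_class y z)
      (mn : span_class x z) (e : span_comp hJ n m = mn)
      (s : span x y) (t : span y z) (c : span x z)
      (ms : m s) (nt : n t) (mnc : mn c)
      (q : hom (apex c) (apex s)) (q' : hom (apex c) (apex t))
      (pb : is_pullback q q' (rleg s) (lleg t))
      (el : lleg s \oc q = lleg c) (er : rleg t \oc q' = rleg c) (K : H z),
    srs mnc K
      \oc pcomp (lower_star H) el ((rleg c) ^![H] K)
      \oc fmap ((lleg s) _*[H])
            (fmap (q _*[H]) (cpcomp (upper_shriek H) er K)) =
    @pcomp (op (span_cat hJ)) H P z y x n m mn e K
      \oc srs ms (@pmap (op (span_cat hJ)) H P z y n K)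
      \oc fmap ((lleg s) _*[H]) (fmap ((rleg s) ^![H]) (srs nt K))
      \oc fmap ((lleg s) _*[H]) (lower_comate lo pb ((rleg t) ^![H] K)) }.

(* A category over B, given by its objects over each object of B and its
   arrows over each arrow of B; as for pseudo-functors, composition is indexed
   by the commutative triangles of B. *)
Record disp_category (B : category) := DispCategory {
  dob :> B -> Type;
  dhom : forall x y : B, hom x y -> dob x -> dob y -> Type;
  did : forall (x : B) (a : dob x), dhom (idm x) a a;
  dcomp : forall (x y z : B) (f : hom x y) (g : hom y z) (h : hom x z),
    g \oc f = h -> forall (a : dob x) (b : dob y) (c : dob z),
    dhom g b c -> dhom f a b -> dhom h a c;
  dcomp1m : forall (x y : B) (f : hom x y) (e : idm y \oc f = f)
      (a : dob x) (b : dob y) (m : dhom f a b), dcomp e (did b) m = m;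
  dcompm1 : forall (x y : B) (f : hom x y) (e : f \oc idm x = f)
      (a : dob x) (b : dob y) (m : dhom f a b), dcomp e m (did a) = m;
  dcompA : forall (x y z w : B) (f : hom x y) (g : hom y z) (h : hom z w)
      gf hg hgf (e1 : g \oc f = gf) (e2 : h \oc gf = hgf)
      (e3 : h \oc g = hg) (e4 : hg \oc f = hgf)
      (a : dob x) (b : dob y) (c : dob z) (d : dob w)
      (m : dhom f a b) (n : dhom g b c) (k : dhom h c d),
    dcomp e2 k (dcomp e1 n m) = dcomp e4 (dcomp e3 k n) m }.

Record disp_iso (B : category) (T T' : disp_category B) := DispIso {
  di_ob : forall x : B, T x -> T' x;
  di_ob_bij : forall x : B, bijective (@di_ob x);
  di_hom : forall (x y : B) (f : hom x y) (a : T x) (b : T y),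
    dhom f a b -> dhom f (di_ob a) (di_ob b);
  di_hom_bij : forall (x y : B) (f : hom x y) (a : T x) (b : T y),
    bijective (@di_hom x y f a b);
  di_id : forall (x : B) (a : T x), di_hom (did a) = did (di_ob a);
  di_comp : forall (x y z : B) (f : hom x y) (g : hom y z) (h : hom x z)
      (e : g \oc f = h) (a : T x) (b : T y) (c : T z)
      (m : dhom f a b) (n : dhom g b c),
    di_hom (dcomp e n m) = dcomp e (di_hom n) (di_hom m) }.

Definition is_cartesian (B : category) (T : disp_category B) (x y : B)
    (f : hom x y) (a : T x) (b : T y) (m : dhom f a b) : Prop :=
  forall (w : B) (g : hom w x) (h : hom w y) (e : f \oc g = h) (c : T w)
    (k : dhom h c b), exists! l : dhom g c a, dcomp e m l = k.

Definition is_cocartesian (B : category) (T : disp_category B) (x y : B)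
    (f : hom x y) (a : T x) (b : T y) (m : dhom f a b) : Prop :=
  forall (w : B) (g : hom y w) (h : hom x w) (e : g \oc f = h) (c : T w)
    (k : dhom h a c), exists! l : dhom g b c, dcomp e l m = k.

Definition is_bifibration (B : category) (T : disp_category B) : Prop :=
  forall (x y : B) (f : hom x y),
    (forall b : T y, exists (a : T x) (m : dhom f a b), is_cartesian m) /\
    (forall a : T x, exists (b : T y) (m : dhom f a b), is_cocartesian m).

Definition fibre (B : category) (T : disp_category B) (x : B) : category :=
  @Category (T x) (fun a b => dhom (idm x) a b) (fun a => did a)
    (fun a b c n m => dcomp (comp1m (idm x)) n m)
    (fun a b m => dcomp1m (comp1m (idm x)) m)
    (fun a b m => dcompm1 (comp1m (idm x)) m)
    (fun a b c d m n k => dcompA (comp1m (idm x)) (comp1m (idm x))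
                            (comp1m (idm x)) (comp1m (idm x)) m n k).

(* The cobase change functors, i.e. the targets of cocartesian arrows, preserve
   terminal objects and fibre products. *)
Definition cobase_change_lex (B : category) (T : disp_category B) : Prop :=
  forall (x y : B) (f : hom x y),
  (forall (a : fibre T x) (b : fibre T y) (m : @dhom B T x y f a b),
     is_cocartesian m -> is_terminal a -> is_terminal b) /\
  (forall (a b c d : fibre T x)
     (u : hom a b) (v : hom a c) (p : hom b d) (q : hom c d)
     (a' b' c' d' : fibre T y)
     (u' : hom a' b') (v' : hom a' c') (p' : hom b' d') (q' : hom c' d')
     (ka : @dhom B T x y f a a') (kb : @dhom B T x y f b b')
     (kc : @dhom B T x y f c c') (kd : @dhom B T x y f d d'),
     is_cocartesian ka -> is_cocartesian kb ->
     is_cocartesian kc -> is_cocartesian kd ->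
     dcomp (comp1m f) u' ka = dcomp (compm1 f) kb u ->
     dcomp (comp1m f) v' ka = dcomp (compm1 f) kc v ->
     dcomp (comp1m f) p' kb = dcomp (compm1 f) kd p ->
     dcomp (comp1m f) q' kc = dcomp (compm1 f) kd q ->
     is_pullback u v p q -> is_pullback u' v' p' q').

(* The bifibration over op J attached to pseudo-functors f |-> f_* on J and
   f |-> f^* on op J with f^* -| f_*: an arrow F -> G over f : x -> y in op J
   (so f goes from y to x in J) is an arrow F -> f_* G or equivalently
   f^* F -> G. *)
Section Grothendieck_construction.
Context (J : category) (O : J -> category) (Hd : @pseudofunctor J O).

Let bhom (x y : op J) (f : hom x y) (F : O x) (G : O y) : Type :=
  hom F (@pmap J O Hd y x f G).

Let bid (x : op J) (F : O x) : bhom (idm x) F F := punit Hd erefl F.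

Let bcomp (x y z : op J) (f : hom x y) (g : hom y z) (h : hom x z)
    (e : g \oc f = h) (F : O x) (G : O y) (K : O z)
    (n : bhom g G K) (m : bhom f F G) : bhom h F K :=
  @pcomp J O Hd z y x g f h e K \oc fmap (@pmap J O Hd y x f) n \oc m.

Lemma bcomp1m (x y : op J) (f : hom x y) (e : idm y \oc f = f) (F : O x)
  (G : O y) (m : bhom f F G) : bcomp e (bid G) m = m.
Proof. by rewrite /bcomp /bid punit_r comp1m. Qed.

Lemma bcompm1 (x y : op J) (f : hom x y) (e : f \oc idm x = f) (F : O x)
  (G : O y) (m : bhom f F G) : bcomp e m (bid F) = m.
Proof.
rewrite /bcomp /bid -compA.
have := punit_nat Hd (erefl : idm x = idm (x : J)) m => <-.
by rewrite compA punit_l comp1m.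
Qed.

Lemma bcompA (x y z w : op J) (f : hom x y) (g : hom y z) (h : hom z w)
    gf hg hgf (e1 : g \oc f = gf) (e2 : h \oc gf = hgf)
    (e3 : h \oc g = hg) (e4 : hg \oc f = hgf)
    (F : O x) (G : O y) (K : O z) (L : O w)
    (m : bhom f F G) (n : bhom g G K) (k : bhom h K L) :
  bcomp e2 k (bcomp e1 n m) = bcomp e4 (bcomp e3 k n) m.
Proof.
rewrite /bcomp !fmapM !compA; congr (_ \oc _ \oc _).
rewrite (@pcomp_assoc J O Hd w z y x h g f hg gf hgf e3 e4 e1 e2 L) -!compA.
congr (_ \oc _); symmetry.
exact: (@pcomp_nat J O Hd z y x g f gf e1 _ _ k).
Qed.

Definition bifibration_of : disp_category (op J) :=
  DispCategory bcomp1m bcompm1 bcompA.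

End Grothendieck_construction.

(* The universe of the sets of sections of sheaves. *)
Definition small : Type := Type.

(* Small sites, by sieves. *)
Record site := Site {
  s_ob : small;
  s_hom : s_ob -> s_ob -> small;
  s_id : forall x, s_hom x x;
  s_comp : forall x y z, s_hom y z -> s_hom x y -> s_hom x z;
  s_comp1m : forall x y (f : s_hom x y), s_comp (s_id y) f = f;
  s_compm1 : forall x y (f : s_hom x y), s_comp f (s_id x) = f;
  s_compA : forall x y z w (f : s_hom x y) (g : s_hom y z) (h : s_hom z w),
    s_comp h (s_comp g f) = s_comp (s_comp h g) f;
  s_cov : forall x, (forall y, s_hom y x -> Prop) -> Prop;
  s_cov_sieve : forall x (C : forall y, s_hom y x -> Prop), s_cov C ->
    forall y z (f : s_hom y x) (g : s_hom z y), C y f -> C z (s_comp f g);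
  s_cov_max : forall x, s_cov (fun y (_ : s_hom y x) => True);
  s_cov_pullback : forall x (C : forall y, s_hom y x -> Prop) y
      (f : s_hom y x),
    s_cov C -> s_cov (fun z (g : s_hom z y) => C z (s_comp f g));
  s_cov_local : forall x (C D : forall y, s_hom y x -> Prop), s_cov C ->
    (forall y z (f : s_hom y x) (g : s_hom z y), D y f -> D z (s_comp f g)) ->
    (forall y (f : s_hom y x), C y f ->
       s_cov (fun z (g : s_hom z y) => D z (s_comp f g))) ->
    s_cov D }.

Record site_sheaf (S : site) := SiteSheaf {
  ss_ob : s_ob S -> small;
  ss_res : forall x y, s_hom x y -> ss_ob y -> ss_ob x;
  ss_res1 : forall x (t : ss_ob x), ss_res (s_id x) t = t;
  ss_resM : forall x y z (f : s_hom x y) (g : s_hom y z) (t : ss_ob z),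
    ss_res (s_comp g f) t = ss_res f (ss_res g t);
  ss_glue : forall x (C : forall y, s_hom y x -> Prop), s_cov C ->
    forall t : (forall y (f : s_hom y x), C y f -> ss_ob y),
    (forall y z (f : s_hom y x) (g : s_hom z y) (Cf : C y f)
       (Cfg : C z (s_comp f g)), ss_res g (t y f Cf) = t z (s_comp f g) Cfg) ->
    exists! u : ss_ob x, forall y (f : s_hom y x) (Cf : C y f),
      ss_res f u = t y f Cf }.

Record site_sheaf_hom (S : site) (F G : site_sheaf S) := SiteSheafHom {
  ssh_fun :> forall x, ss_ob F x -> ss_ob G x;
  ssh_nat : forall x y (f : s_hom x y) (t : ss_ob F y),
    ssh_fun (ss_res f t) = ss_res f (ssh_fun t) }.

Lemma site_sheaf_hom_eq (S : site) (F G : site_sheaf S)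
    (m n : site_sheaf_hom F G) : (forall x t, m x t = n x t) -> m = n.
Proof.
case: m n => m mn [n nn] /= e.
have E : m = n by apply: functional_extensionality_dep => x; exact/funext/e.
by subst n; congr SiteSheafHom; exact: Prop_irrelevance.
Qed.

Definition site_sheaf_idm (S : site) (F : site_sheaf S) : site_sheaf_hom F F :=
  @SiteSheafHom S F F (fun x t => t) (fun x y f t => erefl).

Lemma site_sheaf_comp_nat (S : site) (F G K : site_sheaf S)
    (n : site_sheaf_hom G K) (m : site_sheaf_hom F G)
    x y (f : s_hom x y) (t : ss_ob F y) :
  n x (m x (ss_res f t)) = ss_res f (n y (m y t)).
Proof. by rewrite !ssh_nat. Qed.

Definition site_sheaf_comp (S : site) (F G K : site_sheaf S)
    (n : site_sheaf_hom G K) (m : site_sheaf_hom F G) : site_sheaf_hom F K :=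
  @SiteSheafHom S F K (fun x t => n x (m x t))
    (site_sheaf_comp_nat n m).

Lemma site_sheaf_comp1m S (F G : site_sheaf S) (m : site_sheaf_hom F G) :
  site_sheaf_comp (site_sheaf_idm G) m = m.
Proof. exact: site_sheaf_hom_eq. Qed.

Lemma site_sheaf_compm1 S (F G : site_sheaf S) (m : site_sheaf_hom F G) :
  site_sheaf_comp m (site_sheaf_idm F) = m.
Proof. exact: site_sheaf_hom_eq. Qed.

Lemma site_sheaf_compA S (F G K L : site_sheaf S) (m : site_sheaf_hom F G)
    (n : site_sheaf_hom G K) (k : site_sheaf_hom K L) :
  site_sheaf_comp k (site_sheaf_comp n m) =
  site_sheaf_comp (site_sheaf_comp k n) m.
Proof. exact: site_sheaf_hom_eq. Qed.

Definition site_topos (S : site) : category :=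
  Category (@site_sheaf_comp1m S) (@site_sheaf_compm1 S) (@site_sheaf_compA S).

Definition is_topos (E : category) : Prop :=
  exists (S : site) (F : functor E (site_topos S)), is_equivalence F.

(* Categories over B that are B-topoi.  In a bifibration, base change is right
   adjoint to cobase change, so that the two form a morphism of topoi as soon
   as cobase change is left exact. *)
Definition is_topos_over (B : category) (T : disp_category B) : Prop :=
  [/\ forall x : B, is_topos (fibre T x),
      is_bifibration T & cobase_change_lex T].

(* Structure of commutative ring (possibly zero) on a set.  These records are
   used instead of the MathComp structures because they have to be put on
   given hom-sets, without any choice structure. *)
Record ring_str (R : Type) := RingStr {
  r_zero : R;
  r_one : R;
  r_opp : R -> R;
  r_add : R -> R -> R;
  r_mul : R -> R -> R;
  r_addA : associative r_add;
  r_addC : commutative r_add;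
  r_add0 : left_id r_zero r_add;
  r_addN : left_inverse r_zero r_opp r_add;
  r_mulA : associative r_mul;
  r_mulC : commutative r_mul;
  r_mul1 : left_id r_one r_mul;
  r_mulDl : left_distributive r_mul r_add }.

Record module_str (R : Type) (rs : ring_str R) (M : Type) := ModuleStr {
  m_zero : M;
  m_opp : M -> M;
  m_add : M -> M -> M;
  m_scale : R -> M -> M;
  m_addA : associative m_add;
  m_addC : commutative m_add;
  m_add0 : left_id m_zero m_add;
  m_addN : left_inverse m_zero m_opp m_add;
  m_scaleA : forall a b x,
    m_scale a (m_scale b x) = m_scale (r_mul rs a b) x;
  m_scale1 : left_id (r_one rs) m_scale;
  m_scaleDr : right_distributive m_scale m_add;
  m_scaleDl : forall x a b,
    m_scale (r_add rs a b) x = m_add (m_scale a x) (m_scale b x) }.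

Definition is_ring_hom (R R' : Type) (rs : ring_str R) (rs' : ring_str R')
    (k : R -> R') : Prop :=
  [/\ k (r_one rs) = r_one rs',
      {morph k : a b / r_add rs a b >-> r_add rs' a b} &
      {morph k : a b / r_mul rs a b >-> r_mul rs' a b}].

Definition is_semilinear (R R' : Type) (rs : ring_str R) (rs' : ring_str R')
    (k : R -> R') (M M' : Type) (ms : module_str rs M) (ms' : module_str rs' M')
    (m : M -> M') : Prop :=
  {morph m : x y / m_add ms x y >-> m_add ms' x y} /\
  forall a x, m (m_scale ms a x) = m_scale ms' (k a) (m x).

(* A ring object of a category T over B: an object ro x over each x and an
   arrow ro x -> ro y over each arrow of B, all being compatible with ring
   structures.  Such structures are given, as in the Yoneda description of ring
   objects, on the sets of arrows Z -> ro x over every g : w -> x, naturally in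
   Z; if T is a bifibration, arrows Z -> ro x over g are the same thing as
   arrows Z -> g_* (ro x) in the fibre over w. *)
Record ring_object (B : category) (T : disp_category B) := RingObject {
  ro : forall x : B, T x;
  ro_map : forall (x y : B) (f : hom x y), dhom f (ro x) (ro y);
  ro_map1 : forall x : B, ro_map (idm x) = did (ro x);
  ro_mapM : forall (x y z : B) (f : hom x y) (g : hom y z) (h : hom x z)
    (e : g \oc f = h), ro_map h = dcomp e (ro_map g) (ro_map f);
  ro_str : forall (w x : B) (g : hom w x) (Z : T w),
    ring_str (dhom g Z (ro x));
  ro_pre : forall (v w x : B) (k : hom v w) (g : hom w x) (h : hom v x)
    (e : g \oc k = h) (Y : T v) (Z : T w) (m : dhom k Y Z),
    is_ring_hom (ro_str g Z) (ro_str h Y) (fun r => dcomp e r m);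
  ro_post : forall (w x y : B) (g : hom w x) (f : hom x y) (h : hom w y)
    (e : f \oc g = h) (Z : T w),
    is_ring_hom (ro_str g Z) (ro_str h Z) (fun r => dcomp e (ro_map f) r) }.

(* Modules over ro x in the fibre over x, in the same description. *)
Record module_object (B : category) (T : disp_category B) (R : ring_object T)
    (x : B) := ModuleObject {
  mo :> T x;
  mo_str : forall (w : B) (g : hom w x) (Z : T w),
    module_str (ro_str R g Z) (dhom g Z mo);
  mo_pre : forall (v w : B) (k : hom v w) (g : hom w x) (h : hom v x)
    (e : g \oc k = h) (Y : T v) (Z : T w) (m : dhom k Y Z),
    is_semilinear (fun r => dcomp e r m) (mo_str g Z) (mo_str h Y)
      (fun s => dcomp e s m) }.

Definition is_module_hom (B : category) (T : disp_category B)
    (R : ring_object T) (x y : B) (f : hom x y)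
    (M : module_object R x) (N : module_object R y) (m : dhom f M N) : Prop :=
  forall (w : B) (g : hom w x) (h : hom w y) (e : f \oc g = h) (Z : T w),
    is_semilinear (fun r => dcomp e (ro_map R f) r) (mo_str M g Z)
      (mo_str N h Z) (fun s => dcomp e m s).

Record module_hom (B : category) (T : disp_category B) (R : ring_object T)
    (x y : B) (f : hom x y) (M : module_object R x) (N : module_object R y) :=
  ModuleHom {
  mh_hom : dhom f M N;
  mh_linear : is_module_hom mh_hom }.

Lemma module_hom_eq (B : category) (T : disp_category B) (R : ring_object T)
    (x y : B) (f : hom x y) (M : module_object R x) (N : module_object R y)
    (m n : module_hom f M N) : mh_hom m = mh_hom n -> m = n.
Proof.
case: m n => m mp [n np] /= e; subst n.
by congr ModuleHom; exact: Prop_irrelevance.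
Qed.

Lemma module_id_linear (B : category) (T : disp_category B)
    (R : ring_object T) (x : B) (M : module_object R x) :
  is_module_hom (did M).
Proof.
move=> w g h e Z; have E : g = h by rewrite -e comp1m.
case: h / E e => e.
by split=> [s t|r s]; rewrite ?ro_map1 !dcomp1m.
Qed.

Lemma module_comp_linear (B : category) (T : disp_category B)
    (R : ring_object T) (x y z : B) (f : hom x y) (g : hom y z) (h : hom x z)
    (e : g \oc f = h) (M : module_object R x) (N : module_object R y)
    (K : module_object R z) (n : module_hom g N K) (m : module_hom f M N) :
  is_module_hom (dcomp e (mh_hom n) (mh_hom m)).
Proof.
move=> w k l e' Z; have e2 : g \oc (f \oc k) = l by rewrite compA e.
have [m1 m2] := mh_linear m (erefl (f \oc k)) Z.
have [n1 n2] := mh_linear n e2 Z.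
split=> [s t|r s].
  by rewrite -!(dcompA (erefl (f \oc k)) e2 e e') m1 n1.
by rewrite (ro_mapM R e) -!(dcompA (erefl (f \oc k)) e2 e e') m2 n2.
Qed.

Section Modules.
Context (B : category) (T : disp_category B) (R : ring_object T).

Let mdid (x : B) (M : module_object R x) : module_hom (idm x) M M :=
  ModuleHom (module_id_linear M).

Let mdcomp (x y z : B) (f : hom x y) (g : hom y z) (h : hom x z)
    (e : g \oc f = h) (M : module_object R x) (N : module_object R y)
    (K : module_object R z) (n : module_hom g N K) (m : module_hom f M N) :
    module_hom h M K :=
  ModuleHom (module_comp_linear e n m).

Lemma mdcomp1m (x y : B) (f : hom x y) (e : idm y \oc f = f)
    (M : module_object R x) (N : module_object R y) (m : module_hom f M N) :
  mdcomp e (mdid N) m = m.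
Proof. by apply: module_hom_eq; exact: dcomp1m. Qed.

Lemma mdcompm1 (x y : B) (f : hom x y) (e : f \oc idm x = f)
    (M : module_object R x) (N : module_object R y) (m : module_hom f M N) :
  mdcomp e m (mdid M) = m.
Proof. by apply: module_hom_eq; exact: dcompm1. Qed.

Lemma mdcompA (x y z w : B) (f : hom x y) (g : hom y z) (h : hom z w)
    gf hg hgf (e1 : g \oc f = gf) (e2 : h \oc gf = hgf)
    (e3 : h \oc g = hg) (e4 : hg \oc f = hgf)
    (M : module_object R x) (N : module_object R y)
    (K : module_object R z) (L : module_object R w)
    (m : module_hom f M N) (n : module_hom g N K) (k : module_hom h K L) :
  mdcomp e2 k (mdcomp e1 n m) = mdcomp e4 (mdcomp e3 k n) m.
Proof. by apply: module_hom_eq; exact: dcompA. Qed.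

Definition modules_over : disp_category B :=
  DispCategory mdcomp1m mdcompm1 mdcompA.

End Modules.

(* The ringed op J-topos is (T, R). *)
Definition is_grothendieck_cross_functor (J : category) (H : four_functors J)
    (C : cross_functor H) (T : disp_category (op J)) (R : ring_object T) :
    Prop :=
  [/\ is_topos_over T,
      inhabited (disp_iso (bifibration_of (lower_star H)) (modules_over R)) &
      inhabited (pf_iso (lower_shriek H) (lower_star H))].

Record opens (X : topologicalType) := Opens {
  oset :> set X;
  oset_open : open oset }.

Lemma preopen_subproof (X Y : topologicalType) (f : continuousType X Y)
  (U : opens Y) : open (f @^-1` U).
Proof.
apply: open_comp; last exact: oset_open.
by move=> x _; exact: cts_fun.
Qed.

Definition preopen (X Y : topologicalType) (f : continuousType X Y)
  (U : opens Y) : opens X := Opens (preopen_subproof f U).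

Record sheaf (X : topologicalType) := Sheaf {
  sec :> opens X -> small;
  res : forall U V : opens X, V `<=` U -> sec U -> sec V;
  res1 : forall (U : opens X) (h : U `<=` U) (s : sec U), res h s = s;
  resM : forall (U V W : opens X) (h : V `<=` U) (k : W `<=` V) (l : W `<=` U)
    (s : sec U), res k (res h s) = res l s;
  glue : forall (U : opens X) (D : opens X -> Prop),
    (forall V : opens X, D V -> V `<=` U) -> (forall x, oset U x -> exists V, D V /\ oset V x) ->
    forall t : (forall V, D V -> sec V),
    (forall (V V' W : opens X) (DV : D V) (DV' : D V') (h : W `<=` V) (h' : W `<=` V'),
       res h (t V DV) = res h' (t V' DV')) ->
    exists! s : sec U, forall V (DV : D V) (h : V `<=` U), res h s = t V DV }.

Lemma res_irr X (F : sheaf X) (U V : opens X) (h h' : V `<=` U) (s : F U) :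
  res h s = res h' s.
Proof. by congr (res _ s); exact: Prop_irrelevance. Qed.

Lemma res_bij X (F : sheaf X) (U V : opens X) (h : V `<=` U) :
  U `<=` V -> bijective (@res X F U V h).
Proof.
move=> k; exists (res k) => s.
  by rewrite (resM h k (fun _ => id)) res1.
by rewrite (resM k h (fun _ => id)) res1.
Qed.

Lemma sheaf_ext X (F : sheaf X) (U : opens X) (s t : F U) :
  (forall x, oset U x -> exists (V : opens X) (h : V `<=` U),
     oset V x /\ res h s = res h t) -> s = t.
Proof.
move=> st.
pose D (V : opens X) := exists h : V `<=` U, res h s = res h t.
have DU (V : opens X) : D V -> V `<=` U by case.
have [||u [_ uu]] := @glue X F U D DU _ (fun V DV => res (DU V DV) s) _.
- by move=> x /st[V [h [Vx e]]]; exists V; split=> //; exists h.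
- move=> V V' W DV DV' h h'.
  by rewrite !(resM _ _ (fun x Wx => DU V DV x (h x Wx))).
transitivity u; [apply/esym|]; apply: uu => V DV k; first exact: res_irr.
by have [h e] := DV; rewrite (res_irr k h) -e; exact: res_irr.
Qed.

Lemma sheaf_glue X (F : sheaf X) (U : opens X) (I : Type) (W : I -> opens X)
    (WU : forall i, W i `<=` U) (t : forall i, F (W i)) :
  (forall x, oset U x -> exists i, oset (W i) x) ->
  (forall i j (V : opens X) (h : V `<=` W i) (k : V `<=` W j),
     res h (t i) = res k (t j)) ->
  exists s : F U, forall i, res (WU i) s = t i.
Proof.
move=> cov agr.
pose D (V : opens X) := exists i, V `<=` W i.
have DU (V : opens X) : D V -> V `<=` U by move=> [i Vi] x /Vi /WU.
pose w (V : opens X) (DV : D V) := projT1 (cid DV).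
have wP (V : opens X) (DV : D V) : V `<=` W (w V DV) by exact: projT2 (cid DV).
have [||s [sP _]] := @glue X F U D DU _ (fun V DV => res (wP V DV) (t _)) _.
- by move=> x /cov[i Wx]; exists (W i); split=> //; exists i.
- move=> V V' Z DV DV' h h'.
  rewrite (resM _ _ (fun x Zx => wP V DV x (h x Zx))).
  by rewrite (resM _ _ (fun x Zx => wP V' DV' x (h' x Zx))); exact: agr.
exists s => i; have Di : D (W i) by exists i.
by rewrite (sP _ Di) (agr _ i _ _ (fun _ => id)) res1.
Qed.

(* Maps of sheaves of sets along f, i.e. morphisms Z -> f_* M. *)
Record sheaf_map (X Y : topologicalType) (f : continuousType X Y)
    (Z : sheaf Y) (M : sheaf X) := SheafMap {
  sm_fun :> forall U : opens Y, Z U -> M (preopen f U);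
  sm_nat : forall (U V : opens Y) (h : V `<=` U)
    (k : preopen f V `<=` preopen f U) (s : Z U),
    sm_fun (res h s) = res k (sm_fun s) }.

Lemma sheaf_map_eq (X Y : topologicalType) (f : continuousType X Y)
    (Z : sheaf Y) (M : sheaf X) (m n : sheaf_map f Z M) :
  (forall U s, m U s = n U s) -> m = n.
Proof.
case: m n => m mn [n nn] /= e.
have E : m = n by apply: functional_extensionality_dep => U; exact/funext/e.
by subst n; congr SheafMap; exact: Prop_irrelevance.
Qed.

Lemma preopen_id (X : topologicalType) (f : continuousType X X) (U : opens X) :
  f =1 id -> preopen f U `<=` U.
Proof. by move=> e x /=; rewrite e. Qed.

Lemma preopen_comp (X Y Z : topologicalType) (f : continuousType X Y)
    (g : continuousType Y Z) (h : continuousType X Z) (U : opens Z) :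
  h =1 g \o f -> preopen h U `<=` preopen f (preopen g U).
Proof. by move=> e x /=; rewrite e. Qed.

Lemma preopenS (X Y : topologicalType) (f : continuousType X Y)
    (U V : opens Y) : V `<=` U -> preopen f V `<=` preopen f U.
Proof. by move=> h x; exact: h. Qed.

Lemma sheaf_map_id_nat (X : topologicalType) (f : continuousType X X)
    (e : f =1 id) (F : sheaf X) (U V : opens X) (h : V `<=` U)
    (k : preopen f V `<=` preopen f U) (s : F U) :
  res (preopen_id e) (res h s) = res k (res (preopen_id e) s).
Proof.
have l : preopen f V `<=` U by move=> x /(preopen_id e); exact: h.
by rewrite !(resM _ _ l).
Qed.

Definition sheaf_map_id (X : topologicalType) (f : continuousType X X)
    (e : f =1 id) (F : sheaf X) : sheaf_map f F F :=
  SheafMap (sheaf_map_id_nat e (F := F)).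

Lemma sheaf_map_comp_nat (X Y Z : topologicalType) (f : continuousType X Y)
    (g : continuousType Y Z) (h : continuousType X Z) (e : h =1 g \o f)
    (F : sheaf Z) (G : sheaf Y) (K : sheaf X)
    (n : sheaf_map f G K) (m : sheaf_map g F G)
    (U V : opens Z) (i : V `<=` U) (k : preopen h V `<=` preopen h U)
    (s : F U) :
  res (preopen_comp e) (n _ (m _ (res i s))) =
  res k (res (preopen_comp e) (n _ (m _ s))).
Proof.
rewrite (sm_nat m i (preopenS i)).
rewrite (sm_nat n (preopenS i) (preopenS (f := f) (preopenS i))).
have l : preopen h V `<=` preopen f (preopen g U).
  by move=> x /(preopen_comp e); exact: i.
by rewrite !(resM _ _ l).
Qed.

Definition sheaf_map_comp (X Y Z : topologicalType) (f : continuousType X Y)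
    (g : continuousType Y Z) (h : continuousType X Z) (e : h =1 g \o f)
    (F : sheaf Z) (G : sheaf Y) (K : sheaf X)
    (n : sheaf_map f G K) (m : sheaf_map g F G) : sheaf_map h F K :=
  SheafMap (sheaf_map_comp_nat e n m).

Definition field_ring (A : fieldType) : ring_str A :=
  RingStr (@addrA A) (@addrC A) (@add0r A) (@addNr A) (@mulrA A) (@mulrC A)
    (@mul1r A) (@mulrDl A).

Record mod_sheaf (A : fieldType) (X : topologicalType) := ModSheaf {
  msh :> sheaf X;
  msh_str : forall U : opens X, module_str (field_ring A) (msh U);
  msh_res : forall (U V : opens X) (h : V `<=` U),
    is_semilinear id (msh_str U) (msh_str V) (@res X msh U V h) }.

Record mod_sheaf_hom (A : fieldType) (X : topologicalType)
    (F G : mod_sheaf A X) := ModSheafHom {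
  msm_fun :> forall U : opens X, F U -> G U;
  msm_nat : forall (U V : opens X) (h : V `<=` U) (s : F U),
    msm_fun (res h s) = res h (msm_fun s);
  msm_linear : forall U : opens X,
    is_semilinear id (msh_str F U) (msh_str G U) (@msm_fun U) }.

Lemma mod_sheaf_hom_eq (A : fieldType) (X : topologicalType)
    (F G : mod_sheaf A X) (m n : mod_sheaf_hom F G) :
  (forall U s, m U s = n U s) -> m = n.
Proof.
case: m n => m mn ml [n nn nl] /= e.
have E : m = n by apply: functional_extensionality_dep => U; exact/funext/e.
by subst n; congr ModSheafHom; exact: Prop_irrelevance.
Qed.

Section Mod_sheaf_category.
Context (A : fieldType) (X : topologicalType).
Implicit Types F G K L : mod_sheaf A X.

Lemma mod_sheaf_id_linear F (U : opens X) :
  is_semilinear id (msh_str F U) (msh_str F U) (fun s => s).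
Proof. by []. Qed.

Definition mod_sheaf_idm F : mod_sheaf_hom F F :=
  @ModSheafHom A X F F (fun U s => s) (fun U V h s => erefl)
    (mod_sheaf_id_linear F).

Lemma mod_sheaf_comp_nat F G K (n : mod_sheaf_hom G K) (m : mod_sheaf_hom F G)
    (U V : opens X) (h : V `<=` U) (s : F U) :
  n _ (m _ (res h s)) = res h (n _ (m _ s)).
Proof. by rewrite !msm_nat. Qed.

Lemma mod_sheaf_comp_linear F G K (n : mod_sheaf_hom G K)
    (m : mod_sheaf_hom F G) (U : opens X) :
  is_semilinear id (msh_str F U) (msh_str K U) (fun s => n U (m U s)).
Proof.
have [m1 m2] := msm_linear m U; have [n1 n2] := msm_linear n U.
by split=> [s t|a s]; rewrite ?m1 ?m2 ?n1 ?n2.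
Qed.

Definition mod_sheaf_comp F G K (n : mod_sheaf_hom G K)
    (m : mod_sheaf_hom F G) : mod_sheaf_hom F K :=
  ModSheafHom (mod_sheaf_comp_nat n m) (mod_sheaf_comp_linear n m).

Lemma mod_sheaf_comp1m F G (m : mod_sheaf_hom F G) :
  mod_sheaf_comp (mod_sheaf_idm G) m = m.
Proof. exact: mod_sheaf_hom_eq. Qed.

Lemma mod_sheaf_compm1 F G (m : mod_sheaf_hom F G) :
  mod_sheaf_comp m (mod_sheaf_idm F) = m.
Proof. exact: mod_sheaf_hom_eq. Qed.

Lemma mod_sheaf_compA F G K L (m : mod_sheaf_hom F G) (n : mod_sheaf_hom G K)
    (k : mod_sheaf_hom K L) :
  mod_sheaf_comp k (mod_sheaf_comp n m) = mod_sheaf_comp (mod_sheaf_comp k n) m.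
Proof. exact: mod_sheaf_hom_eq. Qed.

Definition ShA : category :=
  Category mod_sheaf_comp1m mod_sheaf_compm1 mod_sheaf_compA.

Lemma ShA_iso (F G : ShA) (m : mod_sheaf_hom F G) :
  (forall U : opens X, bijective (fun s => m U s)) -> is_iso (m : hom F G).
Proof.
move=> bij.
have {}bij (U : opens X) : {n : G U -> F U |
    cancel (fun s => m U s) n /\ cancel n (fun s => m U s)}.
  by apply: cid; have [n n1 n2] := bij U; exists n.
pose n U := sval (bij U).
have mK U s : n U (m U s) = s by have [+ _] := svalP (bij U); exact.
have nK U t : m U (n U t) = t by have [_ +] := svalP (bij U); exact.
have minj U s t : m U s = m U t -> s = t.
  by move=> e; rewrite -(mK U s) e mK.
have nnat (U V : opens X) (h : V `<=` U) (s : G U) :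
    n V (res h s) = res h (n U s).
  by apply: (minj V); rewrite msm_nat !nK.
have nlin (U : opens X) : is_semilinear id (msh_str G U) (msh_str F U) (n U).
  have [m1 m2] := msm_linear m U.
  by split=> [s t|a s]; apply: (minj U); rewrite ?m1 ?m2 !nK.
exists (ModSheafHom nnat nlin).
by split; apply: mod_sheaf_hom_eq => U s /=.
Qed.

End Mod_sheaf_category.

Section Module_str_lemmas.
Context (R : Type) (rs : ring_str R) (M : Type) (ms : module_str rs M).

Lemma m_addIr x y z : m_add ms x z = m_add ms y z -> x = y.
Proof.
move=> /(congr1 (fun t => m_add ms t (m_opp ms z))).
by rewrite -!m_addA !(m_addC _ z) !m_addN !(m_addC _ _ (m_zero ms)) !m_add0.
Qed.

Lemma m_scale0 a : m_scale ms a (m_zero ms) = m_zero ms.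
Proof.
by apply: (@m_addIr _ _ (m_scale ms a (m_zero ms))); rewrite -m_scaleDr !m_add0.
Qed.

Lemma m_opp0 : m_opp ms (m_zero ms) = m_zero ms.
Proof. by rewrite -[RHS](m_addN ms (m_zero ms)) m_addC m_add0. Qed.

End Module_str_lemmas.

Section Semilinear_lemmas.
Context (R R' : Type) (rs : ring_str R) (rs' : ring_str R') (k : R -> R')
  (M M' : Type) (ms : module_str rs M) (ms' : module_str rs' M')
  (m : M -> M') (ml : is_semilinear k ms ms' m).

Lemma semilinear0 : m (m_zero ms) = m_zero ms'.
Proof.
have [m1 _] := ml; apply: (@m_addIr _ _ _ ms' _ _ (m (m_zero ms))).
by rewrite -m1 !m_add0.
Qed.

Lemma semilinearN x : m (m_opp ms x) = m_opp ms' (m x).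
Proof.
have [m1 _] := ml; apply: (@m_addIr _ _ _ ms' _ _ (m x)).
by rewrite -m1 !m_addN semilinear0.
Qed.

End Semilinear_lemmas.

Section Direct_image.
Context (A : fieldType) (X Y : topologicalType) (f : continuousType X Y).

Lemma direct_image_glue (F : sheaf X) (U : opens Y) (D : opens Y -> Prop) :
  (forall V : opens Y, D V -> V `<=` U) ->
  (forall x, oset U x -> exists V, D V /\ oset V x) ->
  forall t : (forall V, D V -> F (preopen f V)),
  (forall (V V' W : opens Y) (DV : D V) (DV' : D V') (h : W `<=` V)
      (h' : W `<=` V'),
    res (preopenS (f := f) h) (t V DV) = res (preopenS h') (t V' DV')) ->
  exists! s : F (preopen f U), forall V (DV : D V) (h : V `<=` U),
    res (preopenS (f := f) h) s = t V DV.
Proof.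
move=> DU cov t agr.
pose W (i : {V | D V}) := preopen f (sval i).
have WU i : W i `<=` preopen f U by apply: preopenS; exact: DU (svalP i).
have [||s sP] := @sheaf_glue X F (preopen f U) _ W WU
    (fun i => t (sval i) (proj2_sig i)).
- move=> x /= /cov[V [DV Vx]].
  by exists (exist _ V DV).
- move=> [V DV] [V' DV'] O h k /=.
  have oI : open (V `&` V') by apply: openI; exact: oset_open.
  have E := agr V V' (Opens oI) DV DV' (@subIsetl _ _ _) (@subIsetr _ _ _).
  have l : O `<=` preopen f (Opens oI).
    by move=> x Ox; split; [exact: (h x Ox)|exact: (k x Ox)].
  have := congr1 (fun z : F (preopen f (Opens oI)) => res l z) E.
  by rewrite !(resM _ _ h) !(resM _ _ k).
exists s; split=> [V DV h|s' s'P].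
  by rewrite -(sP (exist _ V DV)); exact: res_irr.
apply: sheaf_ext => x /cov[V [DV Vx]].
exists (preopen f V), (preopenS (DU V DV)); split=> //.
by rewrite s'P -(sP (exist _ V DV)); exact: res_irr.
Qed.

Definition direct_image_sheaf (F : sheaf X) : sheaf Y :=
  @Sheaf Y (fun U => F (preopen f U)) (fun U V h => res (preopenS h))
    (fun U h s => res1 (preopenS h) s)
    (fun U V W h k l s => resM (preopenS h) (preopenS k) (preopenS l) s)
    (@direct_image_glue F).

Definition direct_image_ob (F : ShA A X) : ShA A Y :=
  @ModSheaf A Y (direct_image_sheaf F) (fun U => msh_str F (preopen f U))
    (fun U V h => msh_res F (preopenS h)).

Definition direct_image_hom (F G : ShA A X) (m : hom F G) :
    hom (direct_image_ob F) (direct_image_ob G) :=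
  @ModSheafHom A Y (direct_image_ob F) (direct_image_ob G)
    (fun U s => msm_fun m (s : F (preopen f U)))
    (fun U V h s => msm_nat m (preopenS h) s)
    (fun U => msm_linear m (preopen f U)).

Lemma direct_image1 (F : ShA A X) :
  direct_image_hom (idm F) = idm (direct_image_ob F).
Proof. exact: mod_sheaf_hom_eq. Qed.

Lemma direct_imageM (F G K : ShA A X) (m : hom F G) (n : hom G K) :
  direct_image_hom (n \oc m) = direct_image_hom n \oc direct_image_hom m.
Proof. exact: mod_sheaf_hom_eq. Qed.

Definition direct_image : functor (ShA A X) (ShA A Y) :=
  @Functor (ShA A X) (ShA A Y) direct_image_ob direct_image_hom
    direct_image1 direct_imageM.

End Direct_image.

Definition supp (A : fieldType) (X : topologicalType) (F : mod_sheaf A X)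
    (U : opens X) (s : F U) : set X :=
  [set x | oset U x /\ forall (V : opens X) (h : V `<=` U), oset V x ->
     res h s <> m_zero (msh_str F V)].

Definition closed_embedding (X Y : topologicalType)
    (f : continuousType X Y) : Prop :=
  [/\ injective f, closed (range f) &
      forall U : set X, open U -> exists2 V : set Y, open V & U = f @^-1` V].

(* Sections over f^-1 U whose support is proper over U; since Y is locally
   compact Hausdorff, proper means that compact sets have compact preimages. *)
Definition proper_support (A : fieldType) (X Y : topologicalType)
    (f : continuousType X Y) (F : mod_sheaf A X) (U : opens Y)
    (s : F (preopen f U)) : Prop :=
  forall K : set Y, compact K -> K `<=` U -> compact (supp s `&` f @^-1` K).

Section Support_lemmas.
Context (A : fieldType) (X : topologicalType) (F : mod_sheaf A X).
Implicit Types U V : opens X.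

Lemma supp_open U (s : F U) : exists2 O : set X, open O & supp s = U `\` O.
Proof.
pose O := [set x | exists (V : opens X) (h : V `<=` U),
  oset V x /\ res h s = m_zero (msh_str F V)].
exists O.
  rewrite openE => x [V [h [Vx e]]].
  have : nbhs x V by apply: open_nbhs_nbhs; split=> //; exact: oset_open.
  by apply: filterS => y Vy; exists V, h.
apply/seteqP; split=> x.
  by move=> [Ux sx]; split=> // -[V [h [Vx e]]]; exact: sx Vx e.
by move=> [Ux Ox]; split=> // V h Vx e; apply: Ox; exists V, h.
Qed.

Lemma compact_supp U (s : F U) (C : set X) :
  compact C -> C `<=` U -> compact (C `&` supp s).
Proof.
move=> cC CU; have [O oO ->] := supp_open s.
rewrite setDE setIA (setIidl CU); apply: compact_closedI => //.
exact: open_closedC.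
Qed.

Lemma supp_res U V (h : V `<=` U) (s : F U) : supp (res h s) = V `&` supp s.
Proof.
apply/seteqP; split=> x.
  move=> [Vx sx]; do 2?split=> //; first exact: (h x Vx).
  move=> W k Wx e.
  have oI : open (V `&` W) by apply: openI; exact: oset_open.
  apply: (sx (Opens oI) (@subIsetl _ _ _)) => //.
  have l : Opens oI `<=` U by move=> y [Vy _]; exact: (h y Vy).
  rewrite (resM _ _ l) -(resM k (@subIsetr _ _ _ : Opens oI `<=` W) l) e.
  exact: semilinear0 (msh_res F _).
move=> [Vx [Ux sx]]; split=> // W k Wx.
by rewrite (resM _ _ (fun y Wy => h y (k y Wy))); exact: sx.
Qed.

Lemma supp0 U : supp (m_zero (msh_str F U)) = set0.
Proof.
apply/seteqP; split=> // x [Ux /(_ U (fun _ => id) Ux)]; apply.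
exact: semilinear0 (msh_res F _).
Qed.

Lemma supp_opp U (s : F U) : supp (m_opp (msh_str F U) s) `<=` supp s.
Proof.
move=> x [Ux sx]; split=> // V h Vx e; apply: (sx V h Vx).
by rewrite (semilinearN (msh_res F h)) e m_opp0.
Qed.

Lemma supp_scale U a (s : F U) : supp (m_scale (msh_str F U) a s) `<=` supp s.
Proof.
move=> x [Ux sx]; split=> // V h Vx e; apply: (sx V h Vx).
by have [_ ->] := msh_res F h; rewrite e m_scale0.
Qed.

Lemma supp_add U (s t : F U) :
  supp (m_add (msh_str F U) s t) `<=` supp s `|` supp t.
Proof.
move=> x [Ux sx]; apply: contrapT => /not_orP[ns nt].
have [V [h [Vx e]]] : exists (V : opens X) (h : V `<=` U),
    oset V x /\ res h s = m_zero (msh_str F V).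
  by apply: contrapT => H; apply: ns; split=> // V h Vx e; apply: H; exists V, h.
have [W [k [Wx e']]] : exists (V : opens X) (h : V `<=` U),
    oset V x /\ res h t = m_zero (msh_str F V).
  by apply: contrapT => H; apply: nt; split=> // V' h' Vx' e'; apply: H; exists V', h'.
have oI : open (V `&` W) by apply: openI; exact: oset_open.
have l : Opens oI `<=` U by move=> y [Vy _]; exact: (h y Vy).
apply: (sx (Opens oI) l) => //.
have [-> _] := msh_res F l.
rewrite -(resM h (@subIsetl _ _ _ : Opens oI `<=` V) l) e.
rewrite -(resM k (@subIsetr _ _ _ : Opens oI `<=` W) l) e'.
by rewrite !(semilinear0 (msh_res F _)) m_add0.
Qed.

Lemma supp_hom (G : mod_sheaf A X) (m : mod_sheaf_hom F G) U (s : F U) :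
  supp (m U s) `<=` supp s.
Proof.
move=> x [Ux sx]; split=> // V h Vx e; apply: (sx V h Vx).
by rewrite -msm_nat e; exact: semilinear0 (msm_linear m V).
Qed.

End Support_lemmas.

Lemma closed_embedding_compact (X Y : topologicalType) (f : continuousType X Y)
  (K : set Y) : closed_embedding f -> compact K -> compact (f @^-1` K).
Proof.
move=> [finj fcl fop] cK F PF FK.
have [y [Ky cy]] : K `&` cluster (f @ F) !=set0 by apply: cK.
have [x _ fx] : range f y.
  apply: fcl => N Ny; have [z []] : (range f `&` N) !=set0.
    apply: cy => //; apply: (@filterS _ F _ setT); last exact: filterT.
    by move=> x _; exists x.
  by exists z.
exists x; rewrite /= fx; split=> // P N FP Nx.
have := Nx; rewrite nbhsE => -[O [oO Ox] ON].
have [V oV EV] := fop O oO; subst O.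
have Vy : nbhs y V by apply: open_nbhs_nbhs; split=> //; rewrite -fx.
have [z [[w Pw wz] Vz]] : ((f @` P) `&` V) !=set0.
  apply: cy => //; apply: (@filterS _ F _ P) => // w Pw.
  by exists w.
by exists w; split=> //; apply: ON; rewrite /= wz.
Qed.

Lemma closed_embedding_proper (A : fieldType) (X Y : topologicalType)
    (f : continuousType X Y) (F : mod_sheaf A X) (U : opens Y)
    (s : F (preopen f U)) : closed_embedding f -> proper_support s.
Proof.
move=> ef K cK KU; rewrite setIC; apply: compact_supp.
  exact: closed_embedding_compact.
by move=> x; exact: KU.
Qed.

Section Proper_direct_image.
Context (A : fieldType) (X Y : topologicalType) (f : continuousType X Y)
  (hY : hausdorff_space Y) (lcY : locally_compact [set: Y]).
Implicit Types (U V : opens Y).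

Lemma proper_sub (F : mod_sheaf A X) U (t : F (preopen f U)) (C : set X)
    (K : set Y) : K `<=` U -> compact C -> C `<=` f @^-1` K ->
  supp t `&` f @^-1` K `<=` C -> compact (supp t `&` f @^-1` K).
Proof.
move=> KU cC CK tC.
have -> : supp t `&` f @^-1` K = C `&` supp t.
  apply/seteqP; split=> x; first by move=> tx; split; [exact: tC|case: tx].
  by move=> [Cx tx]; split=> //; exact: CK.
by apply: compact_supp => // x /CK; exact: KU.
Qed.

Lemma proper_support0 (F : mod_sheaf A X) U :
  proper_support (m_zero (msh_str F (preopen f U))).
Proof. by move=> K cK KU; rewrite supp0 set0I; exact: compact0. Qed.

Lemma proper_supportN (F : mod_sheaf A X) U (s : F (preopen f U)) :
  proper_support s -> proper_support (m_opp (msh_str F (preopen f U)) s).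
Proof.
move=> ps K cK KU; apply: (proper_sub KU (ps K cK KU)); first by move=> x [].
by move=> x [/supp_opp].
Qed.

Lemma proper_supportD (F : mod_sheaf A X) U (s t : F (preopen f U)) :
  proper_support s -> proper_support t ->
  proper_support (m_add (msh_str F (preopen f U)) s t).
Proof.
move=> ps pt K cK KU.
apply: (proper_sub KU (compactU (ps K cK KU) (pt K cK KU))).
  by move=> x [[]|[]].
by move=> x [/supp_add[]]; [left|right].
Qed.

Lemma proper_supportZ (F : mod_sheaf A X) U a (s : F (preopen f U)) :
  proper_support s -> proper_support (m_scale (msh_str F (preopen f U)) a s).
Proof.
move=> ps K cK KU; apply: (proper_sub KU (ps K cK KU)); first by move=> x [].
by move=> x [/supp_scale].
Qed.

Lemma proper_support_hom (F G : mod_sheaf A X) (m : mod_sheaf_hom F G) U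
    (s : F (preopen f U)) :
  proper_support s -> proper_support (m (preopen f U) s).
Proof.
move=> ps K cK KU; apply: (proper_sub KU (ps K cK KU)); first by move=> x [].
by move=> x [/supp_hom].
Qed.

Lemma proper_support_res (F : mod_sheaf A X) U V (h : V `<=` U)
    (s : F (preopen f U)) :
  proper_support s -> proper_support (res (preopenS h) s).
Proof.
move=> ps K cK KV; have KU := subset_trans KV h.
apply: (proper_sub KV (ps K cK KU)); first by move=> x [].
by move=> x [+ fx]; rewrite supp_res => -[].
Qed.

Lemma proper_support_local (F : mod_sheaf A X) U (s : F (preopen f U)) :
  (forall y, oset U y -> exists V (h : V `<=` U),
     oset V y /\ proper_support (res (preopenS h) s)) ->
  proper_support s.
Proof.
move=> loc K cK KU; rewrite compact_ultra => G UG GsK.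
have PG : ProperFilter G by exact: ultra_proper.
have [y [Ky cy]] : K `&` cluster (f @ G) !=set0.
  by apply: cK; apply: (@filterS _ G _ (supp s `&` f @^-1` K)) => // x [].
have [V [h [Vy ps]]] := loc y (KU y Ky).
have [C] := lcY (I : [set: Y] y); rewrite withinET => Cy [cC clC].
have [N Ny NV] : filter_from (nbhs y) closure V.
  apply: (compact_regular hY cC Cy).
  by apply: open_nbhs_nbhs; split=> //; exact: oset_open.
have GN : G (f @^-1` closure N).
  have [//|GnN] := in_ultra_setVsetC (f @^-1` closure N) UG.
  have [z [nz Nz]] : (~` closure N `&` N) !=set0 by apply: cy.
  by case: nz; exact: subset_closure.
have cK' : compact (K `&` closure N).
  by apply: compact_closedI => //; exact: closed_closure.
have K'V : K `&` closure N `<=` V by move=> z [_ /NV].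
have := ps _ cK' K'V; rewrite compact_ultra => /(_ G UG).
have E : supp (res (preopenS h) s) `&` f @^-1` (K `&` closure N) =
         supp s `&` f @^-1` (K `&` closure N).
  rewrite supp_res; apply/seteqP; split=> x; first by move=> [[_ sx] fx].
  by move=> [sx fx]; do 2?split=> //; exact: (K'V _ fx).
rewrite E => -[|p [[sp [Kp _]] Gp]].
  apply: (@filterS _ G _ (supp s `&` f @^-1` K `&` f @^-1` closure N)).
    by move=> x [[sx Kx] Nx].
  exact: filterI.
by exists p.
Qed.

Definition shriek_sec (F : mod_sheaf A X) U : small :=
  {s : F (preopen f U) | proper_support s}.

Lemma shriek_sec_eq (F : mod_sheaf A X) U (s t : shriek_sec F U) :
  sval s = sval t -> s = t.
Proof.
case: s t => s ps [t pt] /= e; subst t; congr exist; exact: Prop_irrelevance.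
Qed.

Definition shriek_res (F : mod_sheaf A X) U V (h : V `<=` U)
    (s : shriek_sec F U) : shriek_sec F V :=
  exist _ (res (preopenS h) (sval s)) (@proper_support_res F U V h _ (proj2_sig s)).

Lemma shriek_res1 (F : mod_sheaf A X) U (h : U `<=` U) (s : shriek_sec F U) :
  shriek_res h s = s.
Proof. by apply: shriek_sec_eq; exact: res1. Qed.

Lemma shriek_resM (F : mod_sheaf A X) U V (W : opens Y) (h : V `<=` U)
    (k : W `<=` V) (l : W `<=` U) (s : shriek_sec F U) :
  shriek_res k (shriek_res h s) = shriek_res l s.
Proof. by apply: shriek_sec_eq; exact: resM. Qed.

Lemma shriek_glue (F : mod_sheaf A X) U (D : opens Y -> Prop) :
  (forall V, D V -> V `<=` U) ->
  (forall x, oset U x -> exists V, D V /\ oset V x) ->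
  forall t : (forall V, D V -> shriek_sec F V),
  (forall (V V' W : opens Y) (DV : D V) (DV' : D V') (h : W `<=` V)
      (h' : W `<=` V'),
    shriek_res h (t V DV) = shriek_res h' (t V' DV')) ->
  exists! s : shriek_sec F U, forall V (DV : D V) (h : V `<=` U),
    shriek_res h s = t V DV.
Proof.
move=> DU cov t agr.
have [|s [sP sU]] := @direct_image_glue _ _ f F U D DU cov
  (fun V DV => sval (t V DV)).
  move=> V V' W DV DV' h h'.
  by have := congr1 (fun z : shriek_sec F W => sval z) (agr V V' W DV DV' h h').
have ps : proper_support s.
  apply: proper_support_local => y /cov[V [DV Vy]].
  exists V, (DU V DV); split=> //; rewrite (sP V DV); exact: (proj2_sig (t V DV)).
exists (exist _ s ps); split=> [V DV h|[s' ps'] s'P].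
  by apply: shriek_sec_eq; exact: sP.
apply: shriek_sec_eq => /=; apply: sU => V DV h.
by rewrite -(s'P V DV h).
Qed.

Definition shriek_sheaf (F : mod_sheaf A X) : sheaf Y :=
  @Sheaf Y (shriek_sec F) (@shriek_res F) (@shriek_res1 F) (@shriek_resM F)
    (@shriek_glue F).

Section Shriek_str.
Context (F : mod_sheaf A X) (U : opens Y).
Let ms := msh_str F (preopen f U).

Let z : shriek_sec F U := exist _ (m_zero ms) (@proper_support0 F U).
Let o (s : shriek_sec F U) : shriek_sec F U :=
  exist _ (m_opp ms (sval s)) (@proper_supportN F U _ (proj2_sig s)).
Let d (s t : shriek_sec F U) : shriek_sec F U :=
  exist _ (m_add ms (sval s) (sval t))
    (@proper_supportD F U _ _ (proj2_sig s) (proj2_sig t)).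
Let l (a : A) (s : shriek_sec F U) : shriek_sec F U :=
  exist _ (m_scale ms a (sval s)) (@proper_supportZ F U a _ (proj2_sig s)).

Lemma shriek_addA : associative d.
Proof. by move=> x y w; apply: shriek_sec_eq; exact: m_addA. Qed.
Lemma shriek_addC : commutative d.
Proof. by move=> x y; apply: shriek_sec_eq; exact: m_addC. Qed.
Lemma shriek_add0 : left_id z d.
Proof. by move=> x; apply: shriek_sec_eq; exact: m_add0. Qed.
Lemma shriek_addN : left_inverse z o d.
Proof. by move=> x; apply: shriek_sec_eq; exact: m_addN. Qed.
Lemma shriek_scaleA a b x : l a (l b x) = l (r_mul (field_ring A) a b) x.
Proof. by apply: shriek_sec_eq; exact: m_scaleA. Qed.
Lemma shriek_scale1 : left_id (r_one (field_ring A)) l.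
Proof. by move=> x; apply: shriek_sec_eq; exact: m_scale1. Qed.
Lemma shriek_scaleDr : right_distributive l d.
Proof. by move=> a x y; apply: shriek_sec_eq; exact: m_scaleDr. Qed.
Lemma shriek_scaleDl x a b :
  l (r_add (field_ring A) a b) x = d (l a x) (l b x).
Proof. by apply: shriek_sec_eq; exact: m_scaleDl. Qed.

Definition shriek_str : module_str (field_ring A) (shriek_sec F U) :=
  ModuleStr shriek_addA shriek_addC shriek_add0 shriek_addN shriek_scaleA
    shriek_scale1 shriek_scaleDr shriek_scaleDl.

End Shriek_str.

Lemma shriek_res_linear (F : mod_sheaf A X) U V (h : V `<=` U) :
  is_semilinear id (shriek_str F U) (shriek_str F V) (@shriek_res F U V h).
Proof.
have [r1 r2] := msh_res F (preopenS (f := f) h).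
by split=> [s t|a s]; apply: shriek_sec_eq; [exact: r1|exact: r2].
Qed.

Definition shriek_ob (F : ShA A X) : ShA A Y :=
  @ModSheaf A Y (shriek_sheaf F) (shriek_str F) (@shriek_res_linear F).

Section Shriek_hom.
Context (F G : ShA A X) (m : mod_sheaf_hom F G).

Let k U (s : shriek_ob F U) : shriek_ob G U :=
  exist _ (m (preopen f U) (sval s)) (@proper_support_hom F G m U _ (proj2_sig s)).

Lemma shriek_hom_nat U V (h : V `<=` U) (s : shriek_ob F U) :
  k (res h s) = res h (k s).
Proof. by apply: shriek_sec_eq; exact: msm_nat. Qed.

Lemma shriek_hom_linear U :
  is_semilinear id (msh_str (shriek_ob F) U) (msh_str (shriek_ob G) U) (@k U).
Proof.
have [m1 m2] := msm_linear m (preopen f U).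
by split=> [s t|a s]; apply: shriek_sec_eq; [exact: m1|exact: m2].
Qed.

Definition shriek_hom : hom (shriek_ob F) (shriek_ob G) :=
  ModSheafHom shriek_hom_nat shriek_hom_linear.

End Shriek_hom.

Lemma shriek1 (F : ShA A X) : shriek_hom (idm F) = idm (shriek_ob F).
Proof. by apply: mod_sheaf_hom_eq => U s; exact: shriek_sec_eq. Qed.

Lemma shriekM (F G K : ShA A X) (m : hom F G) (n : hom G K) :
  shriek_hom (n \oc m) = shriek_hom n \oc shriek_hom m.
Proof. by apply: mod_sheaf_hom_eq => U s; exact: shriek_sec_eq. Qed.

Definition proper_direct_image : functor (ShA A X) (ShA A Y) :=
  @Functor (ShA A X) (ShA A Y) shriek_ob (@shriek_hom) shriek1 shriekM.

End Proper_direct_image.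

(* Paracompactness of an open subset W of a Hausdorff space *)
Definition paracompact (X : topologicalType) (W : set X) : Prop :=
  forall C : set (set X), (forall V, C V -> open V /\ V `<=` W) ->
    W `<=` \bigcup_(V in C) V ->
  exists D : set (set X),
    [/\ forall V, D V -> open V /\ exists2 V', C V' & V `<=` V',
        W `<=` \bigcup_(V in D) V &
        forall x, W x -> exists N : set X, [/\ open N, N x &
          finite_set [set V | D V /\ V `&` N !=set0]]].

(* Every point has a completely paracompact neighbourhood, i.e. one all of
   whose open subsets are paracompact. *)
Definition locally_completely_paracompact (X : topologicalType) : Prop :=
  forall x : X, exists W : set X, [/\ open W, W x &
    forall U : set X, open U -> U `<=` W -> paracompact U].

Section Cohomology.
Context (A : fieldType) (X : topologicalType).
Implicit Types F G I K : mod_sheaf A X.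

Definition is_mono_sheaf F G (m : mod_sheaf_hom F G) : Prop :=
  forall U : opens X, injective (fun s => m U s).

Definition is_exact F G K (m : mod_sheaf_hom F G) (n : mod_sheaf_hom G K) :
    Prop :=
  forall (U : opens X) (s : G U), n U s = m_zero (msh_str K U) <->
    forall x, oset U x -> exists (V : opens X) (h : V `<=` U) (t : F V),
      oset V x /\ m V t = res h s.

Definition is_injective_sheaf I : Prop :=
  forall F G (m : mod_sheaf_hom F G) (k : mod_sheaf_hom F I),
    is_mono_sheaf m -> exists l : mod_sheaf_hom G I, mod_sheaf_comp l m = k.

Definition is_injective_resolution F (I : nat -> mod_sheaf A X)
    (e : mod_sheaf_hom F (I 0%N))
    (d : forall i, mod_sheaf_hom (I i) (I i.+1)) : Prop :=
  [/\ forall i, is_injective_sheaf (I i), is_mono_sheaf e,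
      is_exact e (d 0%N) & forall i, is_exact (d i) (d i.+1)].

Definition whole : opens X := Opens openT.

(* H^i_c(X, F) = 0 for all i > n and all sheaves of A-modules F, the cohomology
   with compact supports being computed by injective resolutions *)
Definition cohomological_dimension_le (n : nat) : Prop :=
  forall F (I : nat -> mod_sheaf A X) (e : mod_sheaf_hom F (I 0%N))
    (d : forall i, mod_sheaf_hom (I i) (I i.+1)),
  is_injective_resolution e d ->
  forall i, (n <= i)%N -> forall s : I i.+1 whole,
    compact (supp s) -> d i.+1 whole s = m_zero (msh_str (I i.+2) whole) ->
    exists2 t : I i whole, compact (supp t) & d i whole t = s.

Definition finite_cohomological_dimension : Prop :=
  exists n, cohomological_dimension_le n.

End Cohomology.

(* Locally compact and paracompact spaces are Hausdorff by convention. *)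
Record space (A : fieldType) := Space {
  space_top :> topologicalType;
  space_hausdorff : hausdorff_space space_top;
  space_lc : locally_compact [set: space_top];
  space_lcp : locally_completely_paracompact space_top;
  space_cd : finite_cohomological_dimension A space_top }.

Section Top.
Context (A : fieldType).

Definition cts_id (X : topologicalType) : continuousType X X := idfun.

Definition cts_comp (X Y Z : topologicalType) (g : continuousType Y Z)
  (f : continuousType X Y) : continuousType X Z := g \o f.

Lemma cts_comp1m (X Y : topologicalType) (f : continuousType X Y) :
  cts_comp (cts_id Y) f = f.
Proof. by apply/continuousEP. Qed.

Lemma cts_compm1 (X Y : topologicalType) (f : continuousType X Y) :
  cts_comp f (cts_id X) = f.
Proof. by apply/continuousEP. Qed.

Lemma cts_compA (X Y Z W : topologicalType) (f : continuousType X Y)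
    (g : continuousType Y Z) (h : continuousType Z W) :
  cts_comp h (cts_comp g f) = cts_comp (cts_comp h g) f.
Proof. by apply/continuousEP. Qed.

Definition Top : category :=
  @Category (space A) (fun X Y => continuousType X Y) (fun X => cts_id X)
    (fun X Y Z g f => cts_comp g f)
    (fun X Y f => cts_comp1m f) (fun X Y f => cts_compm1 f)
    (fun X Y Z W f g h => cts_compA f g h).

End Top.

Section Diagram.
Context (A : fieldType) (J : category) (X : functor J (Top A)).

Definition transition (x y : J) (f : hom x y) : continuousType (X x) (X y) :=
  fmap X f.

Lemma transition1 (x : J) (u : hom x x) : u = idm x -> transition u =1 id.
Proof. by move=> -> t; rewrite /transition fmap1. Qed.

Lemma transitionM (x y z : J) (f : hom x y) (g : hom y z) (h : hom x z) :
  g \oc f = h -> transition h =1 transition g \o transition f.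
Proof. by move=> <- t; rewrite /transition fmapM. Qed.

Definition ShX (x : J) : category := ShA A (X x).

Section Comparisons.
Context (x y z : J) (f : hom x y) (g : hom y z) (h : hom x z)
  (e : g \oc f = h) (u : hom x x) (eu : u = idm x).

Lemma preopen_transition1 (U : opens (X x)) :
  preopen (transition u) U `<=` U.
Proof. exact: preopen_id (transition1 eu). Qed.

Lemma preopen_transition1' (U : opens (X x)) :
  U `<=` preopen (transition u) U.
Proof. by move=> t /=; rewrite (transition1 eu). Qed.

Lemma preopen_transitionM (U : opens (X z)) :
  preopen (transition h) U `<=` preopen (transition f) (preopen (transition g) U).
Proof. exact: preopen_comp (transitionM e). Qed.

Lemma preopen_transitionM' (U : opens (X z)) :
  preopen (transition f) (preopen (transition g) U) `<=` preopen (transition h) U.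
Proof. by move=> t /=; rewrite (transitionM e). Qed.

End Comparisons.

(* f |-> f_*; the comparison isomorphisms are the restriction maps between
   sections over equal open sets. *)
Section Star.

Let map (x y : J) (f : hom x y) : functor (ShX x) (ShX y) :=
  direct_image A (transition f).

Lemma star_unit_nat (x : J) (u : hom x x) (e : u = idm x) (F : ShX x)
    (U V : opens (X x)) (h : V `<=` U) (s : F U) :
  res (preopen_transition1 e (U := V)) (res h s) =
  res (preopenS (f := transition u) h) (res (preopen_transition1 e (U := U)) s).
Proof.
have l : preopen (transition u) V `<=` U.
  by move=> t /(preopen_transition1 e); exact: h.
by rewrite !(resM _ _ l).
Qed.

Definition star_unit (x : J) (u : hom x x) (e : u = idm x) (F : ShX x) :
    hom F (map u F) :=
  @ModSheafHom A (X x) F (map u F)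
    (fun U s => res (preopen_transition1 e (U := U)) s)
    (fun U V h s => star_unit_nat e h s)
    (fun U => msh_res F (preopen_transition1 e (U := U))).

Lemma star_comp_nat (x y z : J) (f : hom x y) (g : hom y z) (h : hom x z)
    (e : g \oc f = h) (F : ShX x) (U V : opens (X z)) (i : V `<=` U)
    (s : F (preopen (transition f) (preopen (transition g) U))) :
  res (preopen_transitionM e (U := V))
    (res (preopenS (preopenS (f := transition g) i)) s) =
  res (preopenS (f := transition h) i) (res (preopen_transitionM e (U := U)) s).
Proof.
have l : preopen (transition h) V `<=`
         preopen (transition f) (preopen (transition g) U).
  by move=> t /(preopen_transitionM e); exact: i.
by rewrite !(resM _ _ l).
Qed.

Definition star_comp (x y z : J) (f : hom x y) (g : hom y z) (h : hom x z)
    (e : g \oc f = h) (F : ShX x) : hom (map g (map f F)) (map h F) :=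
  @ModSheafHom A (X z) (map g (map f F)) (map h F)
    (fun U s => res (preopen_transitionM e (U := U))
       (s : F (preopen (transition f) (preopen (transition g) U))))
    (fun U V i s => star_comp_nat e i s)
    (fun U => msh_res F (preopen_transitionM e (U := U))).

Lemma star_punit_nat (x : J) (u : hom x x) (e : u = idm x) (F G : ShX x)
    (k : hom F G) :
  star_unit e G \oc k = fmap (map u) k \oc star_unit e F.
Proof. by apply: mod_sheaf_hom_eq => U s /=; rewrite msm_nat. Qed.

Lemma star_punit_iso (x : J) (u : hom x x) (e : u = idm x) (F : ShX x) :
  is_iso (star_unit e F).
Proof.
apply: ShA_iso => U.
exact: (@res_bij _ F _ _ (preopen_transition1 e (U := U))
  (preopen_transition1' e (U := U))).
Qed.

Lemma star_pcomp_nat (x y z : J) (f : hom x y) (g : hom y z) (h : hom x z)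
    (e : g \oc f = h) (F G : ShX x) (k : hom F G) :
  star_comp e G \oc fmap (map g) (fmap (map f) k) =
  fmap (map h) k \oc star_comp e F.
Proof. by apply: mod_sheaf_hom_eq => U s /=; rewrite msm_nat. Qed.

Lemma star_pcomp_iso (x y z : J) (f : hom x y) (g : hom y z) (h : hom x z)
    (e : g \oc f = h) (F : ShX x) : is_iso (star_comp e F).
Proof.
apply: ShA_iso => U.
exact: (@res_bij _ F _ _ (preopen_transitionM e (U := U))
  (preopen_transitionM' e (U := U))).
Qed.

Lemma star_punit_l (x y : J) (f : hom x y) (u : hom y y) (eu : u = idm y)
    (e : u \oc f = f) (F : ShX x) :
  star_comp e F \oc star_unit eu (map f F) = idm (map f F).
Proof.
apply: mod_sheaf_hom_eq => U s /=.
by rewrite (resM _ _ (fun _ => id)) res1.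
Qed.

Lemma star_punit_r (x y : J) (f : hom x y) (u : hom x x) (eu : u = idm x)
    (e : f \oc u = f) (F : ShX x) :
  star_comp e F \oc fmap (map f) (star_unit eu F) = idm (map f F).
Proof.
apply: mod_sheaf_hom_eq => U s /=.
by rewrite (resM _ _ (fun _ => id)) res1.
Qed.

Lemma star_pcomp_assoc (x y z w : J) (f : hom x y) (g : hom y z) (h : hom z w)
    gf hg hgf (e1 : g \oc f = gf) (e2 : h \oc gf = hgf)
    (e3 : h \oc g = hg) (e4 : hg \oc f = hgf) (F : ShX x) :
  star_comp e2 F \oc fmap (map h) (star_comp e1 F) =
  star_comp e4 F \oc star_comp e3 (map f F).
Proof.
apply: mod_sheaf_hom_eq => U s /=.
have l : preopen (transition hgf) U `<=` preopen (transition f)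
    (preopen (transition g) (preopen (transition h) U)).
  by move=> t /(preopen_transitionM e2) /(preopen_transitionM e1).
by rewrite !(resM _ _ l).
Qed.

Definition H_lower_star : @pseudofunctor J ShX :=
  Pseudofunctor star_punit_nat star_punit_iso star_pcomp_nat star_pcomp_iso
    star_punit_l star_punit_r star_pcomp_assoc.

End Star.

Section Shriek.
Context (hX : forall (x y : J) (f : hom x y), closed_embedding (transition f)).

Let map (x y : J) (f : hom x y) : functor (ShX x) (ShX y) :=
  proper_direct_image A (transition f) (@space_hausdorff A (X y))
    (@space_lc A (X y)).

Let proper (x y : J) (f : hom x y) (F : ShX x) (U : opens (X y))
    (s : F (preopen (transition f) U)) : map f F U :=
  exist _ s (@closed_embedding_proper _ _ _ _ F U s (hX f)).

Lemma shriek_unit_subproof (x : J) (u : hom x x) (e : u = idm x) (F : ShX x) :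
  let m (U : opens (X x)) (s : F U) : map u F U :=
    proper (res (preopen_transition1 e (U := U)) s) in
  (forall (U V : opens (X x)) (h : V `<=` U) (s : F U),
     m V (res h s) = res h (m U s)) /\
  (forall U : opens (X x),
     is_semilinear id (msh_str F U) (msh_str (map u F) U) (m U)).
Proof.
split=> [U V h s|U]; first by apply: shriek_sec_eq; exact: star_unit_nat.
have [m1 m2] := msh_res F (preopen_transition1 e (U := U)).
by split=> [s t|a s]; apply: shriek_sec_eq; [exact: m1|exact: m2].
Qed.

Definition shriek_unit (x : J) (u : hom x x) (e : u = idm x) (F : ShX x) :
    hom F (map u F) :=
  ModSheafHom (proj1 (shriek_unit_subproof e F))
    (proj2 (shriek_unit_subproof e F)).

Lemma shriek_comp_subproof (x y z : J) (f : hom x y) (g : hom y z)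
    (h : hom x z) (e : g \oc f = h) (F : ShX x) :
  let m (U : opens (X z)) (s : map g (map f F) U) : map h F U :=
    proper (res (preopen_transitionM e (U := U)) (sval (sval s))) in
  (forall (U V : opens (X z)) (i : V `<=` U) (s : map g (map f F) U),
     m V (res i s) = res i (m U s)) /\
  (forall U : opens (X z),
     is_semilinear id (msh_str (map g (map f F)) U) (msh_str (map h F) U)
       (m U)).
Proof.
split=> [U V i s|U]; first by apply: shriek_sec_eq; exact: star_comp_nat.
have [m1 m2] := msh_res F (preopen_transitionM e (U := U)).
by split=> [s t|a s]; apply: shriek_sec_eq; [exact: m1|exact: m2].
Qed.

Definition shriek_comp (x y z : J) (f : hom x y) (g : hom y z) (h : hom x z)
    (e : g \oc f = h) (F : ShX x) : hom (map g (map f F)) (map h F) :=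
  ModSheafHom (proj1 (shriek_comp_subproof e F))
    (proj2 (shriek_comp_subproof e F)).

Lemma shriek_punit_nat (x : J) (u : hom x x) (e : u = idm x) (F G : ShX x)
    (k : hom F G) :
  shriek_unit e G \oc k = fmap (map u) k \oc shriek_unit e F.
Proof.
by apply: mod_sheaf_hom_eq => U s; apply: shriek_sec_eq => /=; rewrite msm_nat.
Qed.

Lemma shriek_punit_iso (x : J) (u : hom x x) (e : u = idm x) (F : ShX x) :
  is_iso (shriek_unit e F).
Proof.
apply: ShA_iso => U.
have [r r1 r2] := @res_bij _ F _ _ (preopen_transition1 e (U := U))
  (preopen_transition1' e (U := U)).
exists (fun s => r (sval s)) => s /=; first exact: r1.
by apply: shriek_sec_eq; exact: r2.
Qed.

Lemma shriek_pcomp_nat (x y z : J) (f : hom x y) (g : hom y z) (h : hom x z)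
    (e : g \oc f = h) (F G : ShX x) (k : hom F G) :
  shriek_comp e G \oc fmap (map g) (fmap (map f) k) =
  fmap (map h) k \oc shriek_comp e F.
Proof.
by apply: mod_sheaf_hom_eq => U s; apply: shriek_sec_eq => /=; rewrite msm_nat.
Qed.

Lemma shriek_pcomp_iso (x y z : J) (f : hom x y) (g : hom y z) (h : hom x z)
    (e : g \oc f = h) (F : ShX x) : is_iso (shriek_comp e F).
Proof.
apply: ShA_iso => U.
have [r r1 r2] := @res_bij _ F _ _ (preopen_transitionM e (U := U))
  (preopen_transitionM' e (U := U)).
exists (fun s => proper (F := map f F) (proper (r (sval s)))) => s /=.
  by do 2!apply: shriek_sec_eq => /=; exact: r1.
by apply: shriek_sec_eq; exact: r2.
Qed.

Lemma shriek_punit_l (x y : J) (f : hom x y) (u : hom y y) (eu : u = idm y)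
    (e : u \oc f = f) (F : ShX x) :
  shriek_comp e F \oc shriek_unit eu (map f F) = idm (map f F).
Proof.
apply: mod_sheaf_hom_eq => U s; apply: shriek_sec_eq => /=.
by rewrite (resM _ _ (fun _ => id)) res1.
Qed.

Lemma shriek_punit_r (x y : J) (f : hom x y) (u : hom x x) (eu : u = idm x)
    (e : f \oc u = f) (F : ShX x) :
  shriek_comp e F \oc fmap (map f) (shriek_unit eu F) = idm (map f F).
Proof.
apply: mod_sheaf_hom_eq => U s; apply: shriek_sec_eq => /=.
by rewrite (resM _ _ (fun _ => id)) res1.
Qed.

Lemma shriek_pcomp_assoc (x y z w : J) (f : hom x y) (g : hom y z)
    (h : hom z w) gf hg hgf (e1 : g \oc f = gf) (e2 : h \oc gf = hgf)
    (e3 : h \oc g = hg) (e4 : hg \oc f = hgf) (F : ShX x) :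
  shriek_comp e2 F \oc fmap (map h) (shriek_comp e1 F) =
  shriek_comp e4 F \oc shriek_comp e3 (map f F).
Proof.
apply: mod_sheaf_hom_eq => U s; apply: shriek_sec_eq => /=.
have l : preopen (transition hgf) U `<=` preopen (transition f)
    (preopen (transition g) (preopen (transition h) U)).
  by move=> t /(preopen_transitionM e2) /(preopen_transitionM e1).
by rewrite !(resM _ _ l).
Qed.

Definition H_lower_shriek : @pseudofunctor J ShX :=
  Pseudofunctor shriek_punit_nat shriek_punit_iso shriek_pcomp_nat
    shriek_pcomp_iso shriek_punit_l shriek_punit_r shriek_pcomp_assoc.

End Shriek.

(* The canonical exchange morphism p_! f_* -> h_* g_!, i.e. the restriction
   to sections with proper support of p_* f_* = (p f)_* = (h g)_* = h_* g_* *)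
Section Exchange.
Context (hX : forall (x y : J) (f : hom x y), closed_embedding (transition f)).
Context (a b c d : J) (f : hom a b) (g : hom a c) (p : hom b d) (h : hom c d)
  (pb : is_pullback f g p h).

Lemma preopen_square (U : opens (X d)) :
  preopen (transition g) (preopen (transition h) U) `<=`
  preopen (transition f) (preopen (transition p) U).
Proof.
have [e _] := pb; move=> t /(preopen_transitionM' (erefl (h \oc g))).
by rewrite -e => /(preopen_transitionM (erefl (p \oc f))).
Qed.

Let source (F : ShX a) : ShX d :=
  pmap (H_lower_shriek hX) p (pmap H_lower_star f F).

Let target (F : ShX a) : ShX d :=
  pmap H_lower_star h (pmap (H_lower_shriek hX) g F).

Let exchange_fun (F : ShX a) (U : opens (X d)) (s : source F U) : target F U :=
  exist _ (res (preopen_square (U := U)) (sval s))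
    (@closed_embedding_proper _ _ _ _ F (preopen (transition h) U) _ (hX g)).

Lemma exchange_nat (F : ShX a) (U V : opens (X d)) (i : V `<=` U)
    (s : source F U) :
  exchange_fun (res i s) = res i (exchange_fun s).
Proof.
apply: shriek_sec_eq => /=.
have l : preopen (transition g) (preopen (transition h) V) `<=`
         preopen (transition f) (preopen (transition p) U).
  by move=> t /preopen_square; exact: i.
by rewrite !(resM _ _ l).
Qed.

Lemma exchange_linear (F : ShX a) (U : opens (X d)) :
  is_semilinear id (msh_str (source F) U) (msh_str (target F) U)
    (@exchange_fun F U).
Proof.
have [m1 m2] := msh_res F (preopen_square (U := U)).
by split=> [s t|k s]; apply: shriek_sec_eq; [exact: m1|exact: m2].
Qed.

Definition canonical_exchange (F : ShX a) : hom (source F) (target F) :=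
  ModSheafHom (@exchange_nat F) (@exchange_linear F).

End Exchange.

Section Sh_top.

Let shom (x y : op J) (f : hom x y) (Z : sheaf (X x)) (M : sheaf (X y)) :=
  sheaf_map (@transition y x f) Z M.

Let sid (x : op J) (Z : sheaf (X x)) : shom (idm x) Z Z :=
  sheaf_map_id (@transition1 x (idm x) erefl) Z.

Let scomp (x y z : op J) (f : hom x y) (g : hom y z) (h : hom x z)
    (e : g \oc f = h) (Z : sheaf (X x)) (M : sheaf (X y)) (N : sheaf (X z))
    (n : shom g M N) (m : shom f Z M) : shom h Z N :=
  sheaf_map_comp (@transitionM z y x g f h e) n m.

Lemma Sh_top_comp1m (x y : op J) (f : hom x y) (e : idm y \oc f = f)
    (Z : sheaf (X x)) (M : sheaf (X y)) (m : shom f Z M) :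
  scomp e (sid M) m = m.
Proof.
by apply: sheaf_map_eq => U s /=; rewrite (resM _ _ (fun _ => id)) res1.
Qed.

Lemma Sh_top_compm1 (x y : op J) (f : hom x y) (e : f \oc idm x = f)
    (Z : sheaf (X x)) (M : sheaf (X y)) (m : shom f Z M) :
  scomp e m (sid Z) = m.
Proof.
apply: sheaf_map_eq => U s /=.
rewrite (sm_nat m _ (preopenS (preopen_id (@transition1 x (idm x) erefl)))).
by rewrite (resM _ _ (fun _ => id)) res1.
Qed.

Lemma Sh_top_compA (x y z w : op J) (f : hom x y) (g : hom y z) (h : hom z w)
    gf hg hgf (e1 : g \oc f = gf) (e2 : h \oc gf = hgf)
    (e3 : h \oc g = hg) (e4 : hg \oc f = hgf)
    (Z : sheaf (X x)) (M : sheaf (X y)) (N : sheaf (X z)) (K : sheaf (X w))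
    (m : shom f Z M) (n : shom g M N) (k : shom h N K) :
  scomp e2 k (scomp e1 n m) = scomp e4 (scomp e3 k n) m.
Proof.
apply: sheaf_map_eq => U s /=.
rewrite (sm_nat k _ (preopenS (preopen_comp (@transitionM z y x g f gf e1)))).
set v := k _ _.
have l : preopen (@transition w x hgf) U `<=`
    preopen (@transition w z h) (preopen (@transition z y g)
      (preopen (@transition y x f) U)).
  move=> t; have := @transitionM w y x hg f hgf e4 t => /= E.
  have := @transitionM w z y h g hg e3 t => /= E'.
  by rewrite E E'.
by rewrite !(resM _ _ l).
Qed.

Definition Sh_top : disp_category (op J) :=
  DispCategory Sh_top_comp1m Sh_top_compm1 Sh_top_compA.

End Sh_top.

End Diagram.

Section Constant_sheaf.
Context (A : fieldType) (X : topologicalType).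
Implicit Types U V W : opens X.

Definition locally_constant U (s : forall x : X, oset U x -> A) : Prop :=
  forall x (Ux : oset U x), exists V, oset V x /\
    forall y (Uy : oset U y), oset V y -> s y Uy = s x Ux.

Definition const_sec U : small :=
  {s : forall x : X, oset U x -> A | locally_constant s}.

Definition const_val U (s : const_sec U) : forall x : X, oset U x -> A :=
  sval s.

Lemma const_sec_eq U (s t : const_sec U) :
  (forall x Ux, const_val s (x := x) Ux = const_val t Ux) -> s = t.
Proof.
case: s t => s ps [t pt] /= e.
have E : s = t by apply: functional_extensionality_dep => x; exact/funext/e.
by subst t; congr exist; exact: Prop_irrelevance.
Qed.

Lemma const_val_irr U (s : const_sec U) x y (Ux : oset U x) (Uy : oset U y) :
  x = y -> const_val s Ux = const_val s Uy.
Proof. by move=> e; subst y; congr const_val; exact: Prop_irrelevance. Qed.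

Lemma const_res_subproof U V (h : V `<=` U) (s : const_sec U) :
  @locally_constant V (fun x Vx => const_val s (h x Vx)).
Proof.
move=> x Vx; have [W [Wx sW]] := proj2_sig s x (h x Vx).
by exists W; split=> // y Vy Wy; exact: sW.
Qed.

Definition const_res U V (h : V `<=` U) (s : const_sec U) : const_sec V :=
  exist _ _ (const_res_subproof h s).

Lemma const_res1 U (h : U `<=` U) (s : const_sec U) : const_res h s = s.
Proof. by apply: const_sec_eq => x Ux; exact: (const_val_irr s). Qed.

Lemma const_resM U V W (h : V `<=` U) (k : W `<=` V) (l : W `<=` U)
    (s : const_sec U) : const_res k (const_res h s) = const_res l s.
Proof. by apply: const_sec_eq => x Wx; exact: (const_val_irr s). Qed.

Lemma const_glue U (D : opens X -> Prop) :
  (forall V, D V -> V `<=` U) -> (forall x, oset U x -> exists V, D V /\ oset V x) ->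
  forall t : (forall V, D V -> const_sec V),
  (forall (V V' W : opens X) (DV : D V) (DV' : D V') (h : W `<=` V)
      (h' : W `<=` V'),
     const_res h (t V DV) = const_res h' (t V' DV')) ->
  exists! s : const_sec U, forall V (DV : D V) (h : V `<=` U),
    const_res h s = t V DV.
Proof.
move=> DU cov t agr.
have agr' V V' (DV : D V) (DV' : D V') x (Vx : oset V x) (V'x : oset V' x) :
    const_val (t V DV) Vx = const_val (t V' DV') V'x.
  have oI : open (V `&` V') by apply: openI; exact: oset_open.
  have Ix : oset (Opens oI) x by [].
  have := agr V V' (Opens oI) DV DV' (@subIsetl _ _ _) (@subIsetr _ _ _).
  move=> /(congr1 (fun z : const_sec (Opens oI) => const_val z Ix)) /= E.
  by rewrite -(const_val_irr _ (subIsetl Ix) Vx erefl) E;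
    exact: const_val_irr.
pose w x (Ux : oset U x) := cid (cov x Ux).
pose s x (Ux : oset U x) : A :=
  const_val (t _ (proj1 (projT2 (w x Ux)))) (proj2 (projT2 (w x Ux))).
have sE x (Ux : oset U x) V (DV : D V) (Vx : oset V x) :
  s x Ux = const_val (t V DV) Vx by exact: agr'.
have ls : locally_constant s.
  move=> x Ux; have [V [DV Vx]] := cov x Ux.
  have [W [Wx sW]] := proj2_sig (t V DV) x Vx.
  have oI : open (V `&` W) by apply: openI; exact: oset_open.
  exists (Opens oI); split=> // y Uy [Vy Wy].
  by rewrite (sE _ _ _ DV Vy) (sE _ _ _ DV Vx); exact: sW.
exists (exist _ s ls); split=> [V DV h|s' s'P].
  by apply: const_sec_eq => x Vx; exact: sE.
apply: const_sec_eq => x Ux; have [V [DV Vx]] := cov x Ux.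
rewrite [LHS](sE _ _ _ DV Vx) -(s'P V DV (DU V DV)).
exact: (const_val_irr s').
Qed.

Definition const_sheaf : sheaf X :=
  @Sheaf X const_sec const_res const_res1 const_resM const_glue.

Section Operations.
Context (U : opens X).

Lemma const_cst_subproof (a : A) :
  @locally_constant U (fun x Ux => a).
Proof. by move=> x Ux; exists U. Qed.

Definition const_cst (a : A) : const_sec U := exist _ _ (const_cst_subproof a).

Lemma const_map_subproof (k : A -> A) (s : const_sec U) :
  @locally_constant U (fun x Ux => k (const_val s Ux)).
Proof.
move=> x Ux; have [V [Vx sV]] := proj2_sig s x Ux.
by exists V; split=> // y Uy Vy; congr k; exact: sV.
Qed.

Definition const_map (k : A -> A) (s : const_sec U) : const_sec U :=
  exist _ _ (const_map_subproof k s).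

Lemma const_map2_subproof (k : A -> A -> A) (s t : const_sec U) :
  @locally_constant U (fun x Ux => k (const_val s Ux) (const_val t Ux)).
Proof.
move=> x Ux; have [V [Vx sV]] := proj2_sig s x Ux.
have [W [Wx tW]] := proj2_sig t x Ux.
have oI : open (V `&` W) by apply: openI; exact: oset_open.
exists (Opens oI); split=> // y Uy [Vy Wy].
by congr k; [exact: sV|exact: tW].
Qed.

Definition const_map2 (k : A -> A -> A) (s t : const_sec U) : const_sec U :=
  exist _ _ (const_map2_subproof k s t).

End Operations.
End Constant_sheaf.

Section Maps_to_constant.
Context (A : fieldType) (X Y : topologicalType) (f : continuousType X Y)
  (Z : sheaf Y).

Let R := sheaf_map f Z (const_sheaf A X).

Lemma cmap_eq (m n : R) :
  (forall U s x (Ux : oset (preopen f U) x),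
     const_val (m U s) Ux = const_val (n U s) Ux) -> m = n.
Proof. by move=> e; apply: sheaf_map_eq => U s; exact: const_sec_eq. Qed.

Lemma cmap_nat (m : R) (U V : opens Y) (h : V `<=` U)
    (k : preopen f V `<=` preopen f U) (s : Z U) x
    (Vx : oset (preopen f V) x) :
  const_val (m V (res h s)) Vx = const_val (m U s) (k x Vx).
Proof.
by move: (congr1 (fun z : const_sec A (preopen f V) => const_val z Vx)
  (sm_nat m h k s)).
Qed.

Lemma cmap_cst_nat (a : A) (U V : opens Y) (h : V `<=` U)
    (k : preopen f V `<=` preopen f U) (s : Z U) :
  const_cst (preopen f V) a = const_res k (const_cst (preopen f U) a).
Proof. exact: const_sec_eq. Qed.

Definition cmap_cst (a : A) : R :=
  @SheafMap X Y f Z (const_sheaf A X) (fun U s => const_cst (preopen f U) a)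
    (fun U V h k s => cmap_cst_nat a h k s).

Lemma cmap_map_nat (i : A -> A) (m : R) (U V : opens Y) (h : V `<=` U)
    (k : preopen f V `<=` preopen f U) (s : Z U) :
  const_map i (m V (res h s)) = const_res k (const_map i (m U s)).
Proof. by apply: const_sec_eq => x Vx /=; congr i; exact: cmap_nat. Qed.

Definition cmap_map (i : A -> A) (m : R) : R :=
  @SheafMap X Y f Z (const_sheaf A X) (fun U s => const_map i (m U s))
    (cmap_map_nat i m).

Lemma cmap_map2_nat (i : A -> A -> A) (m n : R) (U V : opens Y) (h : V `<=` U)
    (k : preopen f V `<=` preopen f U) (s : Z U) :
  const_map2 i (m V (res h s)) (n V (res h s)) =
  const_res k (const_map2 i (m U s) (n U s)).
Proof. by apply: const_sec_eq => x Vx /=; congr i; exact: cmap_nat. Qed.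

Definition cmap_map2 (i : A -> A -> A) (m n : R) : R :=
  @SheafMap X Y f Z (const_sheaf A X)
    (fun U s => const_map2 i (m U s) (n U s)) (cmap_map2_nat i m n).

Lemma cmap_addA : associative (cmap_map2 (@GRing.add A)).
Proof. by move=> m n p; apply: cmap_eq => U s x Ux; exact: addrA. Qed.
Lemma cmap_addC : commutative (cmap_map2 (@GRing.add A)).
Proof. by move=> m n; apply: cmap_eq => U s x Ux; exact: addrC. Qed.
Lemma cmap_add0 : left_id (cmap_cst 0%R) (cmap_map2 (@GRing.add A)).
Proof. by move=> m; apply: cmap_eq => U s x Ux; exact: add0r. Qed.
Lemma cmap_addN : left_inverse (cmap_cst 0%R) (cmap_map (@GRing.opp A)) (cmap_map2 (@GRing.add A)).
Proof. by move=> m; apply: cmap_eq => U s x Ux; exact: addNr. Qed.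
Lemma cmap_mulA : associative (cmap_map2 (@GRing.mul A)).
Proof. by move=> m n p; apply: cmap_eq => U s x Ux; exact: mulrA. Qed.
Lemma cmap_mulC : commutative (cmap_map2 (@GRing.mul A)).
Proof. by move=> m n; apply: cmap_eq => U s x Ux; exact: mulrC. Qed.
Lemma cmap_mul1 : left_id (cmap_cst 1%R) (cmap_map2 (@GRing.mul A)).
Proof. by move=> m; apply: cmap_eq => U s x Ux; exact: mul1r. Qed.
Lemma cmap_mulDl : left_distributive (cmap_map2 (@GRing.mul A)) (cmap_map2 (@GRing.add A)).
Proof. by move=> m n p; apply: cmap_eq => U s x Ux; exact: mulrDl. Qed.

Definition cmap_ring : ring_str R :=
  RingStr cmap_addA cmap_addC cmap_add0 cmap_addN cmap_mulA cmap_mulC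
    cmap_mul1 cmap_mulDl.

End Maps_to_constant.

Section Constant_pullback.
Context (A : fieldType) (X Y : topologicalType) (f : continuousType X Y).

Lemma const_pull_subproof (U : opens Y) (s : const_sec A U) :
  @locally_constant A X (preopen f U) (fun x Ux => const_val s (x := f x) Ux).
Proof.
move=> x Ux; have [V [Vx sV]] := proj2_sig s (f x) Ux.
by exists (preopen f V); split=> // y Uy Vy; exact: sV.
Qed.

Definition const_pull_sec (U : opens Y) (s : const_sec A U) :
  const_sec A (preopen f U) := exist _ _ (const_pull_subproof s).

Lemma const_pull_nat (U V : opens Y) (h : V `<=` U)
    (k : preopen f V `<=` preopen f U) (s : const_sec A U) :
  const_pull_sec (const_res h s) = const_res k (const_pull_sec s).
Proof. by apply: const_sec_eq => x Vx; exact: (const_val_irr s). Qed.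

Definition const_pull : sheaf_map f (const_sheaf A Y) (const_sheaf A X) :=
  @SheafMap X Y f (const_sheaf A Y) (const_sheaf A X) const_pull_sec
    const_pull_nat.

End Constant_pullback.

Section Constant_ring_object.
Context (A : fieldType) (J : category) (X : functor J (Top A)).

Let cmap (x y : op J) (f : hom x y) :
    @dhom _ (Sh_top X) x y f (const_sheaf A (X x)) (const_sheaf A (X y)) :=
  const_pull A (@transition A J X y x f).

Lemma cring_map1 (x : op J) :
  cmap (idm x) = @did _ (Sh_top X) x (const_sheaf A (X x)).
Proof.
apply: cmap_eq => U s t Ut; apply: (const_val_irr s).
exact: (@transition1 A J X x (idm x) erefl).
Qed.

Lemma cring_mapM (x y z : op J) (f : hom x y) (g : hom y z) (h : hom x z)
    (e : g \oc f = h) : cmap h = dcomp e (cmap g) (cmap f).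
Proof.
apply: cmap_eq => U s t Ut; apply: (const_val_irr s).
exact: (@transitionM A J X z y x g f h e).
Qed.

Let cstr (w x : op J) (g : hom w x) (Z : Sh_top X w) :
    ring_str (@dhom _ (Sh_top X) w x g Z (const_sheaf A (X x))) :=
  cmap_ring A (@transition A J X x w g) Z.

Lemma cring_pre (v w x : op J) (k : hom v w) (g : hom w x) (h : hom v x)
    (e : g \oc k = h) (Y : Sh_top X v) (Z : Sh_top X w) (m : dhom k Y Z) :
  is_ring_hom (cstr g Z) (cstr h Y) (fun r => dcomp e r m).
Proof. by split=> [|r s|r s]; exact: cmap_eq. Qed.

Lemma cring_post (w x y : op J) (g : hom w x) (f : hom x y) (h : hom w y)
    (e : f \oc g = h) (Z : Sh_top X w) :
  is_ring_hom (cstr g Z) (cstr h Z) (fun r => dcomp e (cmap f) r).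
Proof. by split=> [|r s|r s]; exact: cmap_eq. Qed.

Definition constant_ring : ring_object (Sh_top X) :=
  @RingObject (op J) (Sh_top X) (fun x => const_sheaf A (X x)) cmap
    cring_map1 cring_mapM cstr cring_pre cring_post.

End Constant_ring_object.

(* The assumptions on J and on D = op J; that D has pushouts means that J has
   fibre products. *)
Record is_index_category (J : category) : Prop := {
  index_pullbacks : has_pullbacks J;
  index_connected : forall x y : J,
    exists (z : J) (f : hom x z) (g : hom y z), True;
  index_parallel : forall (x y : J) (u v : hom x y),
    exists (w : J) (t : hom y w) (s : hom w w),
      is_iso s /\ s \oc t \oc u = t \oc v }.

(* Main.v *)
(* Idea.  A morphism of span(J) from x to y induces a relation between the
   points of X_y and those of X_x: the graph of a continuous map to X_x defined
   on a closed subset of X_y.  For closed embeddings, f_{l*} f_r^! K depends on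
   this relation R only: its sections over U are those of K over
   {b | R b a implies a in U} that vanish where nothing is related to b.
   Hence all structure isomorphisms of H_{!*} are restriction maps, and so are
   the adjunctions f_! -| f^! and the exchange morphisms f_* g^! -> p^! h_*; the
   latter are invertible because pullback squares are pullbacks on points.
   Everything involving f^* follows by passing to left adjoints: h^* p_! ->
   g_! f^* and its inverse are mates of these, and H^{*!} is obtained from
   H_{!*} by conjugation.  The functor f^* itself is built from families of
   germs; a map Z -> f_* M exhibits M as the inverse image of Z as soon as it is
   injective and surjective on germs, which also gives left exactness.  Modules
   over the constant ring object are compared with sheaves of A-modules by
   evaluating them on representable sheaves. *)

From mathcomp Require Import all_boot ssralg.
From mathcomp Require Import boolp classical_sets functions.
From mathcomp Require Import topology.
Require Import Defs.

Set Implicit Arguments.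
Unset Strict Implicit.
Unset Printing Implicit Defensive.

Local Open Scope classical_set_scope.
Local Open Scope cat_scope.

(** * Adjunctions and mates *)

(** In the theorem only f_* and f_! are concrete, while f^* and f^! are arbitrary adjoints
    compatible with identities and composition. Nothing may therefore rest on a formula for f^*,
    whereas f^! can be exchanged for an explicit model, since two right adjoints are canonically
    isomorphic. This separates a formal half, which starts from an exchange p_! f_* -> h_* g_! whose
    transpose f_* g^! -> p^! h_* is invertible, from computations with sections. A morphism of
    span(J) is an equivalence class, so a functor defined from a span would require a choice of
    representatives and the coherence of all isomorphisms between choices. The relation on points is
    common to all members of a class: H_{!*} is therefore defined on classes directly, and its
    coherence laws compare restriction maps between the same open sets. Representatives are chosen
    only to name left adjoints, which are determined up to canonical isomorphism anyway. *)

Section Arrows.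
Context (C : category).
Implicit Types x y z w v t : C.

(** Composites are kept nested to the right. This lemma and its variants apply an equation to the
    arrows on the left of a longer composite of that form. *)
Lemma compl x y z t (f : hom x y) (g : hom y z) (k : hom x z) (u : hom t x) :
  g \oc f = k -> g \oc (f \oc u) = k \oc u.
Proof. by move=> <-; rewrite compA. Qed.

Lemma compl3 x y z w t (f : hom x y) (g : hom y z) (h : hom z w)
    (k : hom x w) (u : hom t x) :
  h \oc (g \oc f) = k -> h \oc (g \oc (f \oc u)) = k \oc u.
Proof. by move=> <-; rewrite !compA. Qed.

Lemma compl4 x y z w v t (f : hom x y) (g : hom y z) (h : hom z w)
    (i : hom w v) (k : hom x v) (u : hom t x) :
  i \oc (h \oc (g \oc f)) = k ->
  i \oc (h \oc (g \oc (f \oc u))) = k \oc u.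
Proof. by move=> <-; rewrite !compA. Qed.

Lemma compl2 x y y' z t (f : hom x y) (g : hom y z) (f' : hom x y')
    (g' : hom y' z) (u : hom t x) :
  g \oc f = g' \oc f' -> g \oc (f \oc u) = g' \oc (f' \oc u).
Proof. by move=> e; rewrite (compl _ e) compA. Qed.

Lemma iso_mono x y z (f : hom y z) (u v : hom x y) :
  is_iso f -> f \oc u = f \oc v -> u = v.
Proof.
move=> [g [gf _]] /(congr1 (fun k => g \oc k)).
by rewrite !compA gf !comp1m.
Qed.

Lemma iso_epi x y z (f : hom x y) (u v : hom y z) :
  is_iso f -> u \oc f = v \oc f -> u = v.
Proof.
move=> [g [_ fg]] /(congr1 (fun k => k \oc g)).
by rewrite -!compA fg !compm1.
Qed.

Definition iso_inv x y (f : hom x y) (i : is_iso f) : hom y x := sval (cid i).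

Lemma iso_invl x y (f : hom x y) (i : is_iso f) : iso_inv i \oc f = idm x.
Proof. exact: (proj1 (svalP (cid i))). Qed.

Lemma iso_invr x y (f : hom x y) (i : is_iso f) : f \oc iso_inv i = idm y.
Proof. exact: (proj2 (svalP (cid i))). Qed.

Lemma iso_inv_iso x y (f : hom x y) (i : is_iso f) : is_iso (iso_inv i).
Proof. by exists f; rewrite iso_invl iso_invr. Qed.

Lemma is_iso_compl x y z (f : hom x y) (g : hom y z) :
  is_iso g -> is_iso (g \oc f) -> is_iso f.
Proof.
move=> ig [k [k1 k2]]; exists (k \oc g); rewrite -compA; split=> //.
by apply: (iso_mono ig); rewrite compm1 !compA k2 comp1m.
Qed.

Lemma is_iso_compr x y z (f : hom x y) (g : hom y z) :
  is_iso f -> is_iso (g \oc f) -> is_iso g.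
Proof.
move=> jf [k [k1 k2]]; exists (f \oc k); rewrite compA; split=> //.
by apply: (iso_epi jf); rewrite comp1m -!compA k1 compm1.
Qed.

End Arrows.

Section Functors.
Context (C D E : category).

Lemma is_iso_fmap (F : functor C D) x y (f : hom x y) :
  is_iso f -> is_iso (fmap F f).
Proof. by move=> [g [e1 e2]]; exists (fmap F g);
  rewrite -!fmapM e1 e2 !fmap1. Qed.

Lemma fmap_sq (F : functor C D) x y y' z (f : hom x y) (g : hom y z)
    (f' : hom x y') (g' : hom y' z) : g \oc f = g' \oc f' ->
  fmap F g \oc fmap F f = fmap F g' \oc fmap F f'.
Proof. by rewrite -!fmapM => ->. Qed.

Lemma fmap_tri (F : functor C D) x y z (f : hom x y) (g : hom y z)
    (k : hom x z) : g \oc f = k -> fmap F g \oc fmap F f = fmap F k.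
Proof. by rewrite -!fmapM => ->. Qed.

Definition fid : functor C C :=
  @Functor C C (fun x => x) (fun x y f => f) (fun x => erefl)
    (fun x y z f g => erefl).

Lemma fcomp1 (G : functor D E) (F : functor C D) x :
  fmap G (fmap F (idm x)) = idm (G (F x)).
Proof. by rewrite !fmap1. Qed.

Lemma fcompM (G : functor D E) (F : functor C D) x y z
    (f : hom x y) (g : hom y z) :
  fmap G (fmap F (g \oc f)) = fmap G (fmap F g) \oc fmap G (fmap F f).
Proof. by rewrite !fmapM. Qed.

Definition fcomp (G : functor D E) (F : functor C D) : functor C E :=
  @Functor C E (fun x => G (F x)) (fun x y f => fmap G (fmap F f))
    (fcomp1 G F) (@fcompM G F).

Definition natural (F G : functor C D) (a : forall x, hom (F x) (G x)) :=
  forall x y (k : hom x y), a y \oc fmap F k = fmap G k \oc a x.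

Lemma natural_inv (F G : functor C D) (a : forall x, hom (F x) (G x))
    (i : forall x, is_iso (a x)) :
  natural a -> natural (fun x => iso_inv (i x)).
Proof.
move=> na x y k; apply: (iso_mono (i y)).
rewrite compA iso_invr comp1m compA na -compA iso_invr; exact/esym/compm1.
Qed.

Lemma natural_id (F : functor C D) : natural (fun x => idm (F x)).
Proof. by move=> x y k; rewrite comp1m compm1. Qed.

End Functors.

Lemma natural_comp (C D : category) (F G K : functor C D)
    (a : forall x, hom (F x) (G x)) (b : forall x, hom (G x) (K x)) :
  natural a -> natural b -> natural (fun x => b x \oc a x).
Proof. by move=> na nb x y k; rewrite -compA na compA nb compA. Qed.

Lemma natural_pre (C D E : category) (G G' : functor D E) (F : functor C D)
    (a : forall x, hom (G x) (G' x)) :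
  natural a -> @natural _ _ (fcomp G F) (fcomp G' F) (fun x => a (F x)).
Proof. by move=> na x y k; exact: na. Qed.

Lemma natural_post (C D E : category) (F F' : functor C D) (G : functor D E)
    (a : forall x, hom (F x) (F' x)) :
  natural a ->
  @natural _ _ (fcomp G F) (fcomp G F') (fun x => fmap G (a x)).
Proof. by move=> na x y k /=; rewrite -!fmapM na. Qed.

Section Adjunction.
Context (C D : category) (L : functor C D) (R : functor D C)
  (A : adjunction L R).

(** An arrow out of [L x] is recovered from its transpose by applying [L] and the counit. *)
Lemma adj_inj x y (u v : hom (L x) y) :
  fmap R u \oc aunit A x = fmap R v \oc aunit A x -> u = v.
Proof.
move=> e.
have K (w : hom (L x) y) : w = acounit A y \oc fmap L (fmap R w \oc aunit A x).
  by rewrite fmapM compA acounit_nat -compA atriangleL compm1.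
by rewrite (K u) e -K.
Qed.

Lemma adj_inj_r x y (u v : hom x (R y)) :
  acounit A y \oc fmap L u = acounit A y \oc fmap L v -> u = v.
Proof.
move=> e.
have K (w : hom x (R y)) : w = fmap R (acounit A y \oc fmap L w) \oc aunit A x.
  by rewrite fmapM -compA -aunit_nat compA atriangleR comp1m.
by rewrite (K u) e -K.
Qed.

Lemma adj_transpose_l x y (u : hom x (R y)) :
  fmap R (acounit A y \oc fmap L u) \oc aunit A x = u.
Proof. by rewrite fmapM -compA -aunit_nat compA atriangleR comp1m. Qed.

Lemma adj_transpose_r x y (u : hom (L x) y) :
  acounit A y \oc fmap L (fmap R u \oc aunit A x) = u.
Proof. by rewrite fmapM compA acounit_nat -compA atriangleL compm1. Qed.

End Adjunction.

Definition adj_id (C : category) : adjunction (fid C) (fid C).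
Proof.
by apply: (@Adjunction C C (fid C) (fid C) (fun x => idm x) (fun x => idm x))
  => *; rewrite /= !(comp1m, compm1).
Defined.

Section Adjunction_comp.
Context (C D E : category) (L : functor C D) (R : functor D C)
  (S : functor D E) (T : functor E D) (A : adjunction L R) (B : adjunction S T).

Let u (x : C) : hom x (fcomp R T (fcomp S L x)) :=
  fmap R (aunit B (L x)) \oc aunit A x.
Let c (y : E) : hom (fcomp S L (fcomp R T y)) y :=
  acounit B y \oc fmap S (acounit A (T y)).

Lemma adj_comp_subproof :
  [/\ forall x x' (f : hom x x'),
        u x' \oc f = fmap (fcomp R T) (fmap (fcomp S L) f) \oc u x,
      forall y y' (f : hom y y'),
        c y' \oc fmap (fcomp S L) (fmap (fcomp R T) f) = f \oc c y,
      forall x, c (fcomp S L x) \oc fmap (fcomp S L) (u x) = idm (fcomp S L x) &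
      forall y, fmap (fcomp R T) (c y) \oc u (fcomp R T y) = idm (fcomp R T y)].
Proof.
rewrite /u /c; split=> [x x' f|y y' f|x|y] /=.
- by rewrite -compA aunit_nat compA -fmapM aunit_nat fmapM -compA.
- by rewrite -compA -fmapM acounit_nat fmapM compA acounit_nat -compA.
- rewrite -compA -fmapM (fmapM L) compA acounit_nat.
  by rewrite -compA atriangleL compm1 atriangleL.
- rewrite compA -fmapM (fmapM T) -compA -aunit_nat compA.
  by rewrite atriangleR comp1m atriangleR.
Qed.

Definition adj_comp : adjunction (fcomp S L) (fcomp R T) :=
  let: And4 un cn tl tr := adj_comp_subproof in
  @Adjunction C E (fcomp S L) (fcomp R T) u c un cn tl tr.

Lemma aunit_comp x :
  aunit adj_comp x = fmap R (aunit B (L x)) \oc aunit A x.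
Proof. by rewrite /adj_comp; case: adj_comp_subproof. Qed.

Lemma acounit_comp y :
  acounit adj_comp y = acounit B y \oc fmap S (acounit A (T y)).
Proof. by rewrite /adj_comp; case: adj_comp_subproof. Qed.

End Adjunction_comp.

Section Adjunction_iso_r.
Context (C D : category) (L : functor C D) (R R' : functor D C)
  (A : adjunction L R) (b : forall y, hom (R y) (R' y))
  (nb : natural b) (ib : forall y, is_iso (b y)).

Let u x : hom x (R' (L x)) := b (L x) \oc aunit A x.
Let c y : hom (L (R' y)) y := acounit A y \oc fmap L (iso_inv (ib y)).

Lemma adj_iso_r_subproof :
  [/\ forall x x' (f : hom x x'), u x' \oc f = fmap R' (fmap L f) \oc u x,
      forall y y' (f : hom y y'), c y' \oc fmap L (fmap R' f) = f \oc c y,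
      forall x, c (L x) \oc fmap L (u x) = idm (L x) &
      forall y, fmap R' (c y) \oc u (R' y) = idm (R' y)].
Proof.
rewrite /u /c; split=> [x x' f|y y' f|x|y].
- by rewrite -compA aunit_nat compA nb -compA.
- by rewrite -compA -fmapM (natural_inv ib nb) fmapM compA acounit_nat -compA.
- by rewrite -compA -fmapM compA iso_invl comp1m atriangleL.
- rewrite compA -nb fmapM -!compA -aunit_nat (compA _ _ (fmap R _)) atriangleR.
  by rewrite comp1m iso_invr.
Qed.

(** Needed because the functor attached to a class of spans is only isomorphic to the f_{l*} f_r^!
    of a representative, and it is the latter whose left adjoint is known. *)
Definition adj_iso_r : adjunction L R' :=
  let: And4 un cn tl tr := adj_iso_r_subproof in
  @Adjunction C D L R' u c un cn tl tr.

End Adjunction_iso_r.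

(* For isomorphisms [a] and [b] this says that [a] and the inverse of [b] are
   conjugate, i.e. correspond to each other under the two adjunctions. *)
Definition mates (C D : category) (L L' : functor C D) (R R' : functor D C)
    (A : adjunction L R) (A' : adjunction L' R')
    (a : forall x, hom (L x) (L' x)) (b : forall y, hom (R y) (R' y)) :=
  forall x, aunit A' x = fmap R' (a x) \oc b (L x) \oc aunit A x.

Section Mates.
Context (C D : category) (L L' : functor C D) (R R' : functor D C)
  (A : adjunction L R) (A' : adjunction L' R').
Implicit Types (a : forall x, hom (L x) (L' x))
  (b : forall y, hom (R y) (R' y)).

(** Naturality moves the invertible [b] to the left, where it cancels; what remains is that [a] and
    [a'] have the same transpose under [A]. Coherence laws between left adjoints are proved in this
    way, by comparing only the right adjoint sides. *)
Lemma mates_uniq_l a a' b : natural b -> (forall y, is_iso (b y)) ->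
  mates A A' a b -> mates A A' a' b -> forall x, a x = a' x.
Proof.
move=> nb ib m m' x; apply: (adj_inj (A := A)); apply: (iso_mono (ib _)).
by rewrite !compA !nb -m -m'.
Qed.

(** By naturality at the counit and a triangle identity, [b] is determined by its values on the
    image of [L] composed with the unit, and these are fixed by the mate relation because [a] is
    invertible. *)
Lemma mates_uniq_r a b b' : natural b -> natural b' ->
  (forall x, is_iso (a x)) ->
  mates A A' a b -> mates A A' a b' -> forall y, b y = b' y.
Proof.
move=> nb nb' ia m m' y.
have K c : natural c ->
    c y = fmap R' (acounit A y) \oc (c (L (R y)) \oc aunit A (R y)).
  by move=> nc; rewrite compA -nc -compA atriangleR compm1.
rewrite (K b)// (K b')//; congr (_ \oc _).
apply: (iso_mono (is_iso_fmap R' (ia (R y)))).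
by rewrite !compA -m -m'.
Qed.

(** The relation in terms of counits, which is the form needed when transposing arrows into right
    adjoints. *)
Lemma mates_counit a b : natural b -> (forall y, is_iso (b y)) ->
  mates A A' a b ->
  forall y, acounit A' y \oc fmap L' (b y) \oc a (R y) = acounit A y.
Proof.
move=> nb ib m y; apply: (adj_inj (A := A)); apply: (iso_mono (ib _)).
rewrite atriangleR compm1 compA nb fmapM -!compA (compA _ (b _)) -m.
by rewrite fmapM -compA -aunit_nat compA atriangleR comp1m.
Qed.

(** The units are natural and [b] is natural and invertible, so naturality of [a] can be checked on
    transposes and need not be assumed. *)
Lemma mates_natural a b : natural b -> (forall y, is_iso (b y)) ->
  mates A A' a b -> natural a.
Proof.
move=> nb ib m x y k; apply: (adj_inj (A := A)); apply: (iso_mono (ib _)).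
rewrite !compA !nb !(fmapM R') -!compA (compA _ (b _) (fmap R' (a x))) -m.
rewrite -aunit_nat m -!compA aunit_nat (compA _ _ (b _)) nb.
by rewrite -!compA.
Qed.

(** The witness is the transpose under [A] of the unit of [A'] followed by the inverse of [b]. It is
    delivered as data because these arrows become structure constraints. *)
Lemma mates_ex b : natural b -> (forall y, is_iso (b y)) ->
  {a : forall x, hom (L x) (L' x) | mates A A' a b}.
Proof.
move=> nb ib.
exists (fun x => acounit A (L' x) \oc fmap L
  (iso_inv (ib (L' x)) \oc aunit A' x)).
by move=> x; rewrite -nb -compA adj_transpose_l compA iso_invr comp1m.
Qed.

End Mates.

Section Mates_operations.
Context (C D : category) (L L' L'' : functor C D) (R R' R'' : functor D C)
  (A : adjunction L R) (A' : adjunction L' R') (A'' : adjunction L'' R'').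

Lemma mates_comp (a : forall x, hom (L x) (L' x))
    (a' : forall x, hom (L' x) (L'' x)) (b : forall y, hom (R y) (R' y))
    (b' : forall y, hom (R' y) (R'' y)) :
  natural b' -> mates A A' a b -> mates A' A'' a' b' ->
  mates A A'' (fun x => a' x \oc a x) (fun y => b' y \oc b y).
Proof.
move=> nb' m m' x; rewrite m' m fmapM -!compA.
by rewrite (compA _ _ (b' _)) nb' -!compA.
Qed.

Lemma mates_id (a : forall x, hom (L x) (L x)) (b : forall y, hom (R y) (R y)) :
  (forall x, a x = idm _) -> (forall y, b y = idm _) -> mates A A a b.
Proof. by move=> ae be x; rewrite ae be fmap1 !comp1m. Qed.

End Mates_operations.

Section Mates_inverse.
Context (C D : category) (L L' : functor C D) (R R' : functor D C)
  (A : adjunction L R) (A' : adjunction L' R').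
Implicit Types (a : forall x, hom (L x) (L' x))
  (b : forall y, hom (R y) (R' y)).

(** The inverse is the arrow conjugate to the inverse of [b]: both composites have identities as
    right adjoint sides and are identities by uniqueness. *)
Lemma mates_iso a b : natural b -> (forall y, is_iso (b y)) ->
  mates A A' a b -> forall x, is_iso (a x).
Proof.
move=> nb ib m x; have nb' := natural_inv ib nb.
have ib' y := iso_inv_iso (ib y).
have [a' m'] := mates_ex A' A nb' ib'.
exists (a' x); split.
- apply: (mates_uniq_l (natural_id R) (fun y => is_iso_id (R y))
    (A := A) (A' := A) (a := fun x => a' x \oc a x) (a' := fun x => idm (L x))).
  + have := mates_comp nb' m m'; congr (mates _ _ _ _).
    by apply: functional_extensionality_dep => y; rewrite iso_invl.
  + exact: mates_id.
- apply: (mates_uniq_l (natural_id R') (fun y => is_iso_id (R' y))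
    (A := A') (A' := A') (a := fun x => a x \oc a' x)
    (a' := fun x => idm (L' x))).
  + have := mates_comp nb m' m; congr (mates _ _ _ _).
    by apply: functional_extensionality_dep => y; rewrite iso_invr.
  + exact: mates_id.
Qed.

End Mates_inverse.

Section Mates_whisker.
Context (C D E : category).

(** Composition of adjunctions reverses the order of right adjoints: applying a functor to [a]
    corresponds to evaluating [b] on the image of its right adjoint, and conversely in
    [mates_pre]. *)
Lemma mates_post (L L' : functor C D) (R R' : functor D C)
    (S : functor D E) (T : functor E D)
    (A : adjunction L R) (A' : adjunction L' R') (B : adjunction S T)
    (a : forall x, hom (L x) (L' x)) (b : forall y, hom (R y) (R' y)) :
  natural b -> mates A A' a b ->
  mates (adj_comp A B) (adj_comp A' B) (fun x => fmap S (a x))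
    (fun y => b (T y)).
Proof.
move=> nb m x; rewrite !aunit_comp /= m -!compA (compA _ _ (b _)) nb.
by rewrite !compA -!fmapM aunit_nat.
Qed.

Lemma mates_pre (L : functor C D) (R : functor D C)
    (S S' : functor D E) (T T' : functor E D)
    (A : adjunction L R) (B : adjunction S T) (B' : adjunction S' T')
    (a : forall x, hom (S x) (S' x)) (b : forall y, hom (T y) (T' y)) :
  mates B B' a b ->
  mates (adj_comp A B) (adj_comp A B') (fun x => a (L x))
    (fun y => fmap R (b y)).
Proof. by move=> m x; rewrite !aunit_comp /= m !fmapM !compA. Qed.

End Mates_whisker.

Lemma adj_comp_unit_r (C D : category) (L : functor C D) (R : functor D C)
    (A : adjunction L R) x : aunit (adj_comp A (adj_id D)) x = aunit A x.
Proof. by rewrite aunit_comp /= fmap1 comp1m. Qed.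

Lemma punit_natural (C : category) (O : C -> category) (P : pseudofunctor O)
    (x : C) (u : hom x x) (e : u = idm x) :
  @natural _ _ (fid (O x)) (pmap P u) (punit P e).
Proof. by move=> F G k; exact: punit_nat. Qed.

Lemma pcomp_natural (C : category) (O : C -> category) (P : pseudofunctor O)
    (x y z : C) (f : hom x y) (g : hom y z) (h : hom x z) (e : g \oc f = h) :
  @natural _ _ (fcomp (pmap P g) (pmap P f)) (pmap P h) (pcomp P e).
Proof. by move=> F G k; exact: pcomp_nat. Qed.

Section Left_adjoints.
Context (J : category) (O : J -> category) (Hd : @pseudofunctor J O)
  (L : forall x y : J, hom x y -> functor (O y) (O x)).
Context (A : forall (x y : J) (f : hom x y), adjunction (L f) (pmap Hd f)).

(** The functors [L f] come without any relation between them. Their constraints are defined as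
    mates of the constraints of [Hd], and each law follows from the corresponding law of [Hd] by
    uniqueness of mates. *)
Let mu (x : J) (u : hom x x) (e : u = idm x) :=
  mates_ex (adj_id (O x)) (A u) (punit_natural Hd e) (punit_iso Hd e).

Let lunit (x : J) (u : hom x x) (e : u = idm x) F : hom F (L u F) :=
  sval (mu e) F.

Let lunitP (x : J) (u : hom x x) (e : u = idm x) :
  mates (adj_id (O x)) (A u) (lunit e) (punit Hd e) := svalP (mu e).

Let mc (x y z : J) (f : hom x y) (g : hom y z) (h : hom x z)
    (e : g \oc f = h) :=
  mates_ex (adj_comp (A g) (A f)) (A h) (pcomp_natural Hd e) (pcomp_iso Hd e).

Let lcomp (x y z : J) (f : hom x y) (g : hom y z) (h : hom x z)
    (e : g \oc f = h) (K : O z) : hom (L f (L g K)) (L h K) :=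
  sval (mc e) K.

Let lcompP (x y z : J) (f : hom x y) (g : hom y z) (h : hom x z)
    (e : g \oc f = h) :
  mates (adj_comp (A g) (A f)) (A h) (lcomp e) (pcomp Hd e) := svalP (mc e).

(** Evaluating at [L f K] on the left adjoint side means applying [pmap Hd f] on the right adjoint
    side, so the law involved is [punit_r]; passing to [op J] exchanges the two unit laws. *)
Lemma left_adjoint_pf_unit_r x y (f : hom x y) u (eu : u = idm x)
    (e : f \oc u = f) (K : O y) :
  lcomp e K \oc lunit eu (L f K) = idm (L f K).
Proof.
have m := mates_pre (A f) (lunitP eu).
have {}m := mates_comp (pcomp_natural Hd e) m (lcompP e).
have m' : mates (adj_comp (A f) (adj_id (O x))) (A f)
    (fun K => idm (L f K))
    (fun F => pcomp Hd e F \oc fmap (pmap Hd f) (punit Hd eu F)).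
  by move=> F; rewrite adj_comp_unit_r punit_r fmap1 !comp1m.
refine (mates_uniq_l _ _ m m' K).
- by move=> F G k; rewrite /= !punit_r comp1m compm1.
- by move=> F; rewrite punit_r; exact: is_iso_id.
Qed.

Lemma left_adjoint_pf_unit_l x y (f : hom x y) u (eu : u = idm y)
    (e : u \oc f = f) (K : O y) :
  lcomp e K \oc fmap (L f) (lunit eu K) = idm (L f K).
Proof.
have m := mates_post (A f) (punit_natural Hd eu) (lunitP eu).
have {}m := mates_comp (pcomp_natural Hd e) m (lcompP e).
have m' : mates (adj_comp (adj_id (O y)) (A f)) (A f)
    (fun K => idm (L f K))
    (fun F => pcomp Hd e F \oc punit Hd eu (pmap Hd f F)).
  by move=> F; rewrite aunit_comp /= punit_l fmap1 !comp1m compm1.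
refine (mates_uniq_l _ _ m m' K).
- by move=> F G k; rewrite /= !punit_l comp1m compm1.
- by move=> F; rewrite punit_l; exact: is_iso_id.
Qed.

Lemma left_adjoint_pf_assoc x y z w (f : hom x y) (g : hom y z) (h : hom z w)
    gf hg hgf (e1 : g \oc f = gf) (e2 : h \oc gf = hgf)
    (e3 : h \oc g = hg) (e4 : hg \oc f = hgf) (K : O w) :
  lcomp e2 K \oc lcomp e1 (L h K) = lcomp e4 K \oc fmap (L f) (lcomp e3 K).
Proof.
have m := mates_comp (pcomp_natural Hd e2) (mates_pre (A h) (lcompP e1))
  (lcompP e2).
have m' := mates_comp (pcomp_natural Hd e4)
  (mates_post (A f) (pcomp_natural Hd e3) (lcompP e3)) (lcompP e4).
have E (F : O x) : pcomp Hd e2 F \oc fmap (pmap Hd h) (pcomp Hd e1 F) =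
    pcomp Hd e4 F \oc pcomp Hd e3 (pmap Hd f F) by exact: pcomp_assoc.
have {}m' : mates (adj_comp (A h) (adj_comp (A g) (A f))) (A hgf)
    (fun K => lcomp e4 K \oc fmap (L f) (lcomp e3 K))
    (fun F => pcomp Hd e2 F \oc fmap (pmap Hd h) (pcomp Hd e1 F)).
  by move=> F; rewrite m' /= E !aunit_comp /= !fmapM -!compA.
refine (mates_uniq_l _ _ m m' K).
- apply: natural_comp; last exact: pcomp_natural.
  exact: (natural_post (pmap Hd h) (pcomp_natural Hd e1)).
- move=> F; apply: is_iso_comp; last exact: pcomp_iso.
  exact: (is_iso_fmap (pmap Hd h) (pcomp_iso Hd e1 F)).
Qed.

Definition left_adjoint_pf : @pseudofunctor (op J) O.
Proof.
refine (@Pseudofunctor (op J) O (fun x y f => @L y x f)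
  (fun x u e F => @lunit x u e F)
  (fun x y z f g h e F => @lcomp z y x g f h e F) _ _ _ _ _ _ _).
- move=> x u e F G k.
  exact: (mates_natural (punit_natural Hd e) (punit_iso Hd e) (lunitP e)).
- by move=> x u e F; exact: (mates_iso (punit_natural Hd e) (punit_iso Hd e)
    (lunitP e)).
- move=> x y z f g h e F G k.
  exact: (mates_natural (pcomp_natural Hd e) (pcomp_iso Hd e) (lcompP e)).
- move=> x y z f g h e F.
  exact: (mates_iso (pcomp_natural Hd e) (pcomp_iso Hd e) (lcompP e)).
- move=> x y f u eu e F; exact: left_adjoint_pf_unit_r.
- move=> x y f u eu e F; exact: left_adjoint_pf_unit_l.
- move=> x y z w f g h gf hg hgf e1 e2 e3 e4 F.
  exact: (esym (left_adjoint_pf_assoc e3 e4 e1 e2 F)).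
Defined.

(** The compatibilities demanded of the units are the mate equations that define the constraints. *)
Lemma left_adjoint_star : star_adjunction Hd left_adjoint_pf.
Proof.
exists A.
- move=> x F; have := lunitP (erefl : idm x = idm x) F.
  by rewrite /= compm1 -punit_nat => ->.
- move=> x y z f g h e K; have := lcompP e K.
  by rewrite aunit_comp /= compA => ->.
Qed.

End Left_adjoints.

(** * Exchange morphisms *)

Section Four_functors.
Context (J : category) (H : four_functors J).

Definition sadj (x y : J) (f : hom x y) := star_adj (adj_star H) f.
Definition tadj (x y : J) (f : hom x y) := shriek_adj (adj_shriek H) f.

Section Arrow_composite.
Context (x y z : J) (f : hom x y) (g : hom y z) (h : hom x z)
  (e : g \oc f = h).

Lemma cpcomp_nat (P : @pseudofunctor (op J) H) (F G : H z) (k : hom F G) :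
  cpcomp P e G \oc fmap (cpmap P f) (fmap (cpmap P g) k) =
  fmap (cpmap P h) k \oc cpcomp P e F.
Proof. exact: (@pcomp_nat (op J) H P z y x g f h e). Qed.

Lemma cpcomp_iso (P : @pseudofunctor (op J) H) (K : H z) :
  is_iso (cpcomp P e K).
Proof. exact: (@pcomp_iso (op J) H P z y x g f h e). Qed.

Lemma cpcomp_natural (P : @pseudofunctor (op J) H) :
  @natural _ _ (fcomp (cpmap P f) (cpmap P g)) (cpmap P h) (cpcomp P e).
Proof. by move=> F G k; exact: cpcomp_nat. Qed.

Lemma shriek_mates_comp :
  mates (adj_comp (tadj f) (tadj g)) (tadj h) (pcomp (lower_shriek H) e)
    (cpcomp (upper_shriek H) e).
Proof.
move=> F; rewrite aunit_comp /= (shriek_adj_comp (adj_shriek H) e).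
by rewrite -!compA.
Qed.

Lemma star_mates_comp :
  mates (adj_comp (sadj g) (sadj f)) (sadj h) (cpcomp (upper_star H) e)
    (pcomp (lower_star H) e).
Proof.
move=> F; rewrite aunit_comp /= (star_adj_comp (adj_star H) e).
by rewrite -!compA.
Qed.

Lemma shriek_counit_comp (K : H z) :
  acounit (tadj h) K \oc (fmap h _![H] (cpcomp (upper_shriek H) e K)
    \oc pcomp (lower_shriek H) e (f ^![H] (g ^![H] K))) =
  acounit (tadj g) K \oc fmap g _![H] (acounit (tadj f) (g ^![H] K)).
Proof.
have := mates_counit (cpcomp_natural _) (cpcomp_iso _) shriek_mates_comp K.
by rewrite acounit_comp -compA.
Qed.

End Arrow_composite.

Section Identity_arrow.
Context (x : J).

Lemma cpunit_nat (P : @pseudofunctor (op J) H) (F G : H x) (k : hom F G) :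
  cpunit P G \oc k = fmap (cpmap P (idm x)) k \oc cpunit P F.
Proof. exact: (@punit_nat (op J) H P x (idm x) erefl). Qed.

Lemma cpunit_iso (P : @pseudofunctor (op J) H) (F : H x) : is_iso (cpunit P F).
Proof. exact: (@punit_iso (op J) H P x (idm x) erefl). Qed.

Lemma cpunit_natural (P : @pseudofunctor (op J) H) :
  @natural _ _ (fid (H x)) (cpmap P (idm x)) (cpunit P (x := x)).
Proof. by move=> F G k; exact: cpunit_nat. Qed.

Lemma sadj_id (F : H x) : aunit (sadj (idm x)) F =
  punit (lower_star H) erefl ((idm x) ^*[H] F) \oc cpunit (upper_star H) F.
Proof. exact: star_adj_id. Qed.

Lemma tadj_id (F : H x) : aunit (tadj (idm x)) F =
  fmap (idm x) ^![H] (punit (lower_shriek H) erefl F)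
    \oc cpunit (upper_shriek H) F.
Proof. by rewrite -cpunit_nat; exact: shriek_adj_id. Qed.

Lemma shriek_mates_id :
  mates (adj_id (H x)) (tadj (idm x)) (punit (lower_shriek H) erefl)
    (cpunit (upper_shriek H) (x := x)).
Proof. by move=> F; rewrite /= compm1 tadj_id. Qed.

Lemma star_mates_id :
  mates (adj_id (H x)) (sadj (idm x)) (cpunit (upper_star H) (x := x))
    (punit (lower_star H) erefl).
Proof. by move=> F; rewrite /= compm1 -punit_nat sadj_id. Qed.

Lemma shriek_counit_id (K : H x) :
  acounit (tadj (idm x)) K \oc fmap (idm x) _![H] (cpunit (upper_shriek H) K)
    \oc punit (lower_shriek H) erefl K = idm K.
Proof.
exact: (mates_counit (cpunit_natural _) (cpunit_iso _) shriek_mates_id K).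
Qed.

End Identity_arrow.

(** All that the formal half asks of a lower exchange. Squares with identity sides are given by
    equations and not only by invertibility, since the restriction of the Mackey functors to J needs
    the exact values. The last field concerns right adjoints only; it is what will give the
    invertibility of base change for f^*. *)
Record is_lower_coherent (lo : lower_exchange H) : Prop := {
  lc_nat : forall (a b c d : J) (f : hom a b) (g : hom a c) (p : hom b d)
      (h : hom c d) (pb : is_pullback f g p h) (F G : H a) (k : hom F G),
    lo _ _ _ _ _ _ _ _ pb G \oc fmap (p _![H]) (fmap (f _*[H]) k) =
    fmap (h _*[H]) (fmap (g _![H]) k) \oc lo _ _ _ _ _ _ _ _ pb F;
  lc_horizontal : forall (a b b' c d d' : J)
      (f : hom a b) (f' : hom b b') (g : hom a c) (p : hom b d) (q : hom b' d')
      (h : hom c d) (h' : hom d d') (ff : hom a b') (hh : hom c d')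
      (ef : f' \oc f = ff) (eh : h' \oc h = hh)
      (pb1 : is_pullback f g p h) (pb2 : is_pullback f' p q h')
      (pb : is_pullback ff g q hh) (F : H a),
    lo _ _ _ _ _ _ _ _ pb F \oc fmap (q _![H]) (pcomp (lower_star H) ef F) =
    pcomp (lower_star H) eh (g _![H] F)
      \oc fmap (h' _*[H]) (lo _ _ _ _ _ _ _ _ pb1 F)
      \oc lo _ _ _ _ _ _ _ _ pb2 (f _*[H] F);
  lc_vertical : forall (a b c d c' d' : J)
      (f : hom a b) (g : hom a c) (p : hom b d) (h : hom c d)
      (g' : hom c c') (p' : hom d d') (k : hom c' d')
      (gg : hom a c') (pp : hom b d')
      (eg : g' \oc g = gg) (ep : p' \oc p = pp)
      (pb1 : is_pullback f g p h) (pb2 : is_pullback h g' p' k)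
      (pb : is_pullback f gg pp k) (F : H a),
    lo _ _ _ _ _ _ _ _ pb F \oc pcomp (lower_shriek H) ep (f _*[H] F) =
    fmap (k _*[H]) (pcomp (lower_shriek H) eg F)
      \oc lo _ _ _ _ _ _ _ _ pb2 (g _![H] F)
      \oc fmap (p' _![H]) (lo _ _ _ _ _ _ _ _ pb1 F);
  lc_id_horizontal : forall (a c : J) (g : hom a c)
      (pb : is_pullback (idm a) g g (idm c)) (F : H a),
    lo _ _ _ _ _ _ _ _ pb F \oc fmap (g _![H]) (punit (lower_star H) erefl F) =
    punit (lower_star H) erefl (g _![H] F);
  lc_id_vertical : forall (a b : J) (f : hom a b)
      (pb : is_pullback f (idm a) (idm b) f) (F : H a),
    lo _ _ _ _ _ _ _ _ pb F \oc punit (lower_shriek H) erefl (f _*[H] F) =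
    fmap (f _*[H]) (punit (lower_shriek H) erefl F);
  lc_comate_iso : forall (a b c d : J) (f : hom a b) (g : hom a c)
      (p : hom b d) (h : hom c d) (pb : is_pullback f g p h) (M : H c),
    is_iso (lower_comate lo pb M) }.

Context (lo : lower_exchange H) (lc : is_lower_coherent lo).

Section Square.
Context (a b c d : J) (f : hom a b) (g : hom a c) (p : hom b d) (h : hom c d)
  (pb : is_pullback f g p h).

Definition mate (M : H b) : hom (h ^*[H] (p _![H] M)) (g _![H] (f ^*[H] M)) :=
  locked (lower_mate lo pb M).

Definition comate (M : H c) : hom (f _*[H] (g ^![H] M)) (p ^![H] (h _*[H] M)) :=
  locked (lower_comate lo pb M).

(** Describes [mate] by its transpose under h^* and h_*; identities about [mate] are reduced by it
    to identities about [lo]. *)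
Lemma mateP (M : H b) :
  fmap h _*[H] (mate M) \oc aunit (sadj h) (p _![H] M) =
  lo pb (f ^*[H] M) \oc fmap p _![H] (aunit (sadj f) M).
Proof. by rewrite /mate -lock /lower_mate -compA -fmapM adj_transpose_l. Qed.

Lemma comateE (M : H c) : comate M =
  fmap p ^![H] (fmap h _*[H] (acounit (tadj g) M) \oc lo pb (g ^![H] M))
    \oc aunit (tadj p) (f _*[H] (g ^![H] M)).
Proof. by rewrite /comate -lock /lower_comate -fmapM. Qed.

Lemma mate_nat (M N : H b) (k : hom M N) :
  mate N \oc fmap h ^*[H] (fmap p _![H] k) =
  fmap g _![H] (fmap f ^*[H] k) \oc mate M.
Proof.
apply: (adj_inj (A := sadj h)).
rewrite !(fmapM h _*[H]) -!compA mateP -aunit_nat (compl _ (mateP _)).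
by rewrite -compA -fmapM aunit_nat fmapM (compl2 _ (lc_nat lc pb _)).
Qed.

Lemma comate_nat (M N : H c) (k : hom M N) :
  comate N \oc fmap f _*[H] (fmap g ^![H] k) =
  fmap p ^![H] (fmap h _*[H] k) \oc comate M.
Proof.
rewrite !comateE -compA aunit_nat compA -fmapM compA -fmapM; congr (_ \oc _).
congr (fmap _ _); rewrite -compA (lc_nat lc pb) !compA -!fmapM.
by rewrite acounit_nat.
Qed.

Lemma comate_natural : @natural _ _ (fcomp f _*[H] g ^![H])
  (fcomp p ^![H] h _*[H]) comate.
Proof. by move=> M N k; exact: comate_nat. Qed.

Lemma comate_unit (M : H a) :
  comate (g _![H] M) \oc fmap f _*[H] (aunit (tadj g) M) =
  fmap p ^![H] (lo pb M) \oc aunit (tadj p) (f _*[H] M).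
Proof.
rewrite comateE -compA aunit_nat compA -fmapM; congr (fmap _ _ \oc _).
by rewrite -compA (lc_nat lc pb) compA -fmapM atriangleL fmap1 comp1m.
Qed.

Lemma comate_iso (M : H c) : is_iso (comate M).
Proof. by rewrite /comate -lock; exact: lc_comate_iso. Qed.

(** Both [mate] and [comate] are transposes of the same exchange morphism, hence they correspond
    under the composite adjunctions of h^* p_! with p^! h_* and of g_! f^* with f_* g^!. The inverse
    of [comate] occurs because [mates] compares right adjoints in the direction of the left ones.
    Invertibility of base change follows without any description of f^*. *)
Lemma mates_mate :
  mates (adj_comp (tadj p) (sadj h)) (adj_comp (sadj f) (tadj g))
    mate
    (fun K => iso_inv (comate_iso K)).
Proof.
move=> M; rewrite !aunit_comp /=.
apply: (iso_mono (comate_iso _)); rewrite !compA.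
rewrite comate_nat -!compA (compl _ (iso_invr _)) comp1m.
rewrite (compl _ (comate_unit _)) -compA aunit_nat.
by rewrite [RHS]compA -fmapM mateP fmapM -compA.
Qed.

Lemma mate_iso (M : H b) : is_iso (mate M).
Proof.
apply: (mates_iso _ _ mates_mate); first exact: natural_inv comate_natural.
by move=> y; exact: iso_inv_iso.
Qed.

Definition imate (M : H b) : hom (g _![H] (f ^*[H] M)) (h ^*[H] (p _![H] M)) :=
  locked (iso_inv (mate_iso M)).

Lemma imatel (M : H b) : imate M \oc mate M = idm _.
Proof. by rewrite /imate -lock iso_invl. Qed.

Lemma imater (M : H b) : mate M \oc imate M = idm _.
Proof. by rewrite /imate -lock iso_invr. Qed.

Lemma imate_nat (M N : H b) (k : hom M N) :
  imate N \oc fmap g _![H] (fmap f ^*[H] k) =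
  fmap h ^*[H] (fmap p _![H] k) \oc imate M.
Proof.
apply: (iso_mono (mate_iso N)); rewrite (compl _ (imater _)) comp1m compA.
by rewrite mate_nat -compA imater compm1.
Qed.

(** The transpose of the inverse base change g_! f^* -> h^* p_!, so that the two mates of a cross
    functor are mutually inverse by construction. *)
Definition upper_of_lower (K : H d) :
    hom (f ^*[H] (p ^![H] K)) (g ^![H] (h ^*[H] K)) :=
  locked (fmap g ^![H] (fmap h ^*[H] (acounit (tadj p) K) \oc imate (p ^![H] K))
    \oc aunit (tadj g) (f ^*[H] (p ^![H] K))).

Lemma upper_of_lowerP (K : H d) :
  acounit (tadj g) (h ^*[H] K) \oc fmap g _![H] (upper_of_lower K) =
  fmap h ^*[H] (acounit (tadj p) K) \oc imate (p ^![H] K).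
Proof. rewrite /upper_of_lower -lock; exact: adj_transpose_r. Qed.

Lemma upper_of_lower_nat (K L : H d) (k : hom K L) :
  upper_of_lower L \oc fmap (f ^*[H]) (fmap (p ^![H]) k) =
  fmap (g ^![H]) (fmap (h ^*[H]) k) \oc upper_of_lower K.
Proof.
apply: (adj_inj_r (A := tadj g)); rewrite !fmapM (compl _ (upper_of_lowerP _)).
rewrite -compA imate_nat (compl2 _ (acounit_nat _ _)) upper_of_lowerP.
by rewrite !compA -!fmapM acounit_nat.
Qed.

End Square.

Definition upper_exchange_of : upper_exchange H :=
  fun a b c d f g p h pb K => upper_of_lower pb K.

Lemma upper_mateE (a b c d : J) (f : hom a b) (g : hom a c)
    (p : hom b d) (h : hom c d) (pb : is_pullback f g p h) (M : H b) :
  upper_mate upper_exchange_of pb M = imate pb M.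
Proof.
rewrite /upper_mate upper_of_lowerP -compA imate_nat compA -fmapM.
by rewrite atriangleL fmap1 comp1m.
Qed.

Section Horizontal.
Context (a b b' c d d' : J)
  (f : hom a b) (f' : hom b b') (g : hom a c) (p : hom b d) (q : hom b' d')
  (h : hom c d) (h' : hom d d') (ff : hom a b') (hh : hom c d')
  (ef : f' \oc f = ff) (eh : h' \oc h = hh)
  (pb1 : is_pullback f g p h) (pb2 : is_pullback f' p q h')
  (pb : is_pullback ff g q hh).

Lemma mate_horizontal (M : H b') :
  mate pb M \oc cpcomp (upper_star H) eh (q _![H] M) =
  fmap g _![H] (cpcomp (upper_star H) ef M)
    \oc mate pb1 (f' ^*[H] M) \oc fmap h ^*[H] (mate pb2 M).
Proof.
(* Transposing along h'^* and h^* and then identifying h'_* h_* with hh_* turns both sides into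
   arrows from q_! M. *)
apply: (adj_inj (A := adj_comp (sadj h') (sadj h))).
apply: (iso_mono (pcomp_iso (lower_star H) eh _)).
rewrite !aunit_comp /= !fmapM -!compA.
(* The common value is the transpose of the outer base change under hh^* and hh_*. *)
transitivity (lo pb (ff ^*[H] M) \oc fmap q _![H] (aunit (sadj ff) M)).
  rewrite -mateP {2}/sadj (star_adj_comp (adj_star H) eh) -!compA.
  by rewrite !(compl2 _ (pcomp_nat _ eh _)).
rewrite {1}/sadj (star_adj_comp (adj_star H) ef) !fmapM -!compA.
rewrite (compl2 _ (fmap_sq h' _*[H] (esym (aunit_nat (sadj h) _)))) mateP.
rewrite (compl2 _ (fmap_sq h' _*[H] (mateP _ _))).
rewrite !(compl2 _ (pcomp_nat _ eh _)) (compl2 _ (esym (lc_nat lc pb2 _))).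
rewrite (compl2 _ (lc_nat lc pb _)); congr (_ \oc _); rewrite !compA.
by rewrite -(lc_horizontal lc ef eh pb1 pb2 pb).
Qed.

Lemma imate_horizontal (M : H b') :
  imate pb M \oc fmap g _![H] (cpcomp (upper_star H) ef M) =
  cpcomp (upper_star H) eh (q _![H] M) \oc fmap h ^*[H] (imate pb2 M)
    \oc imate pb1 (f' ^*[H] M).
Proof.
apply: (iso_mono (mate_iso pb M)); rewrite compA imater comp1m !compA.
rewrite mate_horizontal -!compA (compA _ _ (fmap _ (mate pb2 M))) -fmapM.
by rewrite imater fmap1 comp1m imater compm1.
Qed.

Lemma upper_of_lower_horizontal (K : H d') :
  upper_of_lower pb K \oc cpcomp (upper_star H) ef (q ^![H] K) =
  fmap (g ^![H]) (cpcomp (upper_star H) eh K)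
    \oc upper_of_lower pb1 (h' ^*[H] K)
    \oc fmap (f ^*[H]) (upper_of_lower pb2 K).
Proof.
apply: (adj_inj_r (A := tadj g)); rewrite !fmapM -!compA.
rewrite (compl _ (upper_of_lowerP _ _)) -compA imate_horizontal.
rewrite (compl2 _ (acounit_nat _ _)) (compl _ (upper_of_lowerP _ _)) -!compA.
rewrite imate_nat (compl2 _ (fmap_sq h ^*[H] (upper_of_lowerP pb2 _))).
by rewrite -(compl2 _ (cpcomp_nat eh (upper_star H) _)).
Qed.

End Horizontal.

Section Vertical.
Context (a b c d c' d' : J)
  (f : hom a b) (g : hom a c) (p : hom b d) (h : hom c d)
  (g' : hom c c') (p' : hom d d') (k : hom c' d')
  (gg : hom a c') (pp : hom b d')
  (eg : g' \oc g = gg) (ep : p' \oc p = pp)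
  (pb1 : is_pullback f g p h) (pb2 : is_pullback h g' p' k)
  (pb : is_pullback f gg pp k).

Lemma mate_vertical (M : H b) :
  mate pb M \oc fmap k ^*[H] (pcomp (lower_shriek H) ep M) =
  pcomp (lower_shriek H) eg (f ^*[H] M)
    \oc fmap g' _![H] (mate pb1 M) \oc mate pb2 (p _![H] M).
Proof.
apply: (adj_inj (A := sadj k)); rewrite !fmapM -!compA -aunit_nat.
rewrite (compl _ (mateP _ _)) -compA -(pcomp_nat _ ep) mateP.
rewrite -(compl2 _ (lc_nat lc pb2 _)) (fmap_sq p' _![H] (mateP _ _)) !compA.
by rewrite (lc_vertical lc eg ep pb1 pb2 pb).
Qed.

Lemma imate_vertical (M : H b) :
  imate pb M \oc pcomp (lower_shriek H) eg (f ^*[H] M) =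
  fmap k ^*[H] (pcomp (lower_shriek H) ep M)
    \oc imate pb2 (p _![H] M) \oc fmap g' _![H] (imate pb1 M).
Proof.
apply: (iso_mono (mate_iso pb M)); rewrite compA imater comp1m !compA.
rewrite mate_vertical -!compA (compl _ (imater _ _)) comp1m -fmapM imater.
by rewrite fmap1 compm1.
Qed.

Lemma upper_of_lower_vertical (K : H d') :
  upper_of_lower pb K
    \oc fmap (f ^*[H]) (cpcomp (upper_shriek H) ep K) =
  cpcomp (upper_shriek H) eg (k ^*[H] K)
    \oc fmap (g ^![H]) (upper_of_lower pb2 K)
    \oc upper_of_lower pb1 (p' ^![H] K).
Proof.
apply: (adj_inj_r (A := tadj gg)).
(* Precomposing with the isomorphism g'_! g_! -> gg_! allows the counit of the composite to be
   expressed by the counits of [g'] and [g]. *)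
apply: (iso_epi (pcomp_iso (lower_shriek H) eg _)).
rewrite !fmapM -!compA (compl _ (upper_of_lowerP _ _)) -!compA.
rewrite (compl2 _ (imate_nat pb _)) imate_vertical -!(pcomp_nat _ eg) -!compA.
have E := congr1 (fun u => fmap k ^*[H] u) (shriek_counit_comp ep K).
rewrite /= !fmapM in E; rewrite (compl3 _ E) -!compA.
rewrite -(compl2 _ (pcomp_nat _ eg _)) (compl3 _ (shriek_counit_comp eg _)).
rewrite -!compA (compl2 _ (fmap_sq g' _![H] (acounit_nat (tadj g) _))).
rewrite (compl2 _ (upper_of_lowerP pb2 _)).
rewrite (fmap_sq g' _![H] (upper_of_lowerP pb1 _)).
by rewrite (compl2 _ (imate_nat pb2 _)).
Qed.

End Vertical.

Section Identity_squares.

Lemma mate_id_horizontal (a c : J) (g : hom a c)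
    (pb : is_pullback (idm a) g g (idm c)) (M : H a) :
  mate pb M \oc cpunit (upper_star H) (g _![H] M) =
  fmap g _![H] (cpunit (upper_star H) M).
Proof.
apply: (iso_mono (punit_iso (lower_star H) erefl _)).
rewrite compA punit_nat -compA -sadj_id (mateP pb).
rewrite sadj_id fmapM compA.
by rewrite (lc_id_horizontal lc).
Qed.

Lemma mate_id_vertical (a b : J) (f : hom a b)
    (pb : is_pullback f (idm a) (idm b) f) (M : H b) :
  mate pb M \oc fmap f ^*[H] (punit (lower_shriek H) erefl M) =
  punit (lower_shriek H) erefl (f ^*[H] M).
Proof.
apply: (adj_inj (A := sadj f)); rewrite fmapM -compA -aunit_nat.
rewrite (compl _ (mateP pb _)) -compA -(punit_nat (lower_shriek H)) compA.
by rewrite (lc_id_vertical lc).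
Qed.

Lemma imate_id_horizontal (a c : J) (g : hom a c)
    (pb : is_pullback (idm a) g g (idm c)) (M : H a) :
  imate pb M \oc fmap g _![H] (cpunit (upper_star H) M) =
  cpunit (upper_star H) (g _![H] M).
Proof. by rewrite -(mate_id_horizontal pb) compA imatel comp1m. Qed.

Lemma imate_id_vertical (a b : J) (f : hom a b)
    (pb : is_pullback f (idm a) (idm b) f) (M : H b) :
  imate pb M \oc punit (lower_shriek H) erefl (f ^*[H] M) =
  fmap f ^*[H] (punit (lower_shriek H) erefl M).
Proof. by rewrite -(mate_id_vertical pb) compA imatel comp1m. Qed.

Lemma comate_id_horizontal (a c : J) (g : hom a c)
    (pb : is_pullback (idm a) g g (idm c)) (M : H c) :
  comate pb M \oc punit (lower_star H) erefl (g ^![H] M) =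
  fmap g ^![H] (punit (lower_star H) erefl M).
Proof.
rewrite comateE -compA aunit_nat compA -fmapM -[_ \oc lo _ _ \oc _]compA.
rewrite (lc_id_horizontal lc) -punit_nat fmapM -compA atriangleR.
by rewrite compm1.
Qed.

Lemma comate_id_vertical (a b : J) (f : hom a b)
    (pb : is_pullback f (idm a) (idm b) f) (M : H a) :
  comate pb M \oc fmap f _*[H] (cpunit (upper_shriek H) M) =
  cpunit (upper_shriek H) (f _*[H] M).
Proof.
rewrite comateE -compA aunit_nat compA -fmapM -compA (lc_nat lc pb) compA.
rewrite -fmapM tadj_id compA -fmapM -compA (lc_id_vertical lc) -fmapM -compA.
by rewrite [X in fmap f _*[H] X]compA shriek_counit_id !fmap1 comp1m.
Qed.

End Identity_squares.

Lemma cross_exchange_of_lower : is_cross_exchange lo upper_exchange_of.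
Proof.
split.
- exact: (lc_nat lc).
- by move=> *; exact: upper_of_lower_nat.
- exact: (lc_horizontal lc).
- by move=> *; exact: upper_of_lower_horizontal.
- exact: (lc_vertical lc).
- by move=> *; exact: upper_of_lower_vertical.
- move=> a c g pb F.
  apply: is_iso_compr (is_iso_fmap _ (punit_iso (lower_star H) erefl F)) _.
  by rewrite (lc_id_horizontal lc); exact: punit_iso.
- move=> a b f pb F.
  apply: is_iso_compr (punit_iso (lower_shriek H) erefl _) _.
  by rewrite (lc_id_vertical lc); exact: (is_iso_fmap _ (punit_iso _ _ _)).
- move=> a c g pb K.
  apply: is_iso_compr (cpunit_iso (upper_star H) (g ^![H] K)) _.
  (* After precomposition with an invertible unit constraint the exchange becomes another one, as
     the counits of g_! and g^! show; hence it is invertible itself. *)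
  suff -> : upper_exchange_of pb K \oc cpunit (upper_star H) (g ^![H] K) =
      fmap g ^![H] (cpunit (upper_star H) K).
    exact: (is_iso_fmap _ (cpunit_iso _ _)).
  apply: (adj_inj_r (A := tadj g)); rewrite fmapM compA upper_of_lowerP.
  by rewrite -compA imate_id_horizontal -cpunit_nat acounit_nat.
- move=> a b f pb K.
  apply: is_iso_compr (is_iso_fmap f ^*[H] (cpunit_iso (upper_shriek H) K)) _.
  suff -> : upper_exchange_of pb K \oc
      fmap f ^*[H] (cpunit (upper_shriek H) K) =
      cpunit (upper_shriek H) (f ^*[H] K) by exact: cpunit_iso.
  apply: (adj_inj_r (A := tadj (idm a))).
  apply: (iso_epi (punit_iso (lower_shriek H) erefl _)).
  rewrite shriek_counit_id fmapM compA upper_of_lowerP -!compA.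
  rewrite (compl2 _ (imate_nat pb _)) imate_id_vertical -!fmapM.
  by rewrite compA shriek_counit_id fmap1.
- move=> a b c d f g p h pb M; rewrite upper_mateE.
  have -> : lower_mate lo pb M = mate pb M by rewrite /mate -lock.
  by rewrite imatel imater.
Qed.

End Four_functors.

(** * Mackey functors *)

Section Identity_iso.
Context (C : category) (O : C -> category) (P Q : pseudofunctor O)
  (t : forall (x y : C) (f : hom x y) (F : O x),
     hom (pmap P f F) (pmap Q f F)).
Context
  (t_nat : forall (x y : C) (f : hom x y),
    @natural _ _ (pmap P f) (pmap Q f) (t f))
  (t_iso : forall (x y : C) (f : hom x y) (F : O x), is_iso (t f F))
  (t_punit : forall (x : C) (F : O x),
     t (idm x) F \oc punit P erefl F = punit Q erefl F)
  (t_pcomp : forall (x y z : C) (f : hom x y) (g : hom y z) h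
     (e : g \oc f = h) (F : O x),
     t h F \oc pcomp P e F =
     pcomp Q e F \oc fmap (pmap Q g) (t f F) \oc t g (pmap P f F)).

Lemma fid_cat_iso (D : category) : is_cat_iso (fid D).
Proof. by split=> [x y|]; exists (fun k => k). Qed.

Definition identity_pf_iso : pf_iso P Q.
Proof.
apply: (@PfIso C O O P Q (fun x => fid (O x)) (fun x => fid_cat_iso (O x)) t).
- by move=> x y f F G k; exact: t_nat.
- exact: t_iso.
- by move=> x u e F; subst u; exact: t_punit.
- exact: t_pcomp.
Defined.

End Identity_iso.

(** Left adjoints of a pseudo-functor on [op C] are indexed by the double opposite, which has the
    same objects, arrows and composition as [C] and differs from it in the proofs of the laws
    only. *)
Definition pf_unop (C : category) (O : C -> category)
    (P : @pseudofunctor (op (op C)) O) : @pseudofunctor C O :=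
  @Pseudofunctor C O (@pmap _ _ P) (@punit _ _ P) (@pcomp _ _ P)
    (@punit_nat _ _ P) (@punit_iso _ _ P) (@pcomp_nat _ _ P)
    (@pcomp_iso _ _ P) (@punit_l _ _ P) (@punit_r _ _ P) (@pcomp_assoc _ _ P).

Section Realisations.
Context (J : category) (hJ : has_pullbacks J) (H : four_functors J)
  (lo : lower_exchange H) (lc : is_lower_coherent lo).

Section Left_adjoint_realisation.
Context (P0 : @pseudofunctor (op (span_cat hJ)) H)
  (S : shriek_star_realisation lo P0).

Lemma srs_natural (x y : J) (m : span_class x y) (s : span x y) (ms : m s) :
  @natural _ _ (fcomp (lleg s) _*[H] (rleg s) ^![H])
    (@pmap (op (span_cat hJ)) H P0 y x m) (srs S ms).
Proof. by move=> K L k; exact: srs_nat. Qed.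

Definition representative (x y : J) (m : span_class x y) : span x y :=
  sval (cid (in_class_ex m)).

Lemma representative_in (x y : J) (m : span_class x y) : m (representative m).
Proof. exact: svalP (cid (in_class_ex m)). Qed.

Definition span_adj (x y : J) (s : span x y) :
    adjunction (fcomp (rleg s) _![H] (lleg s) ^*[H])
      (fcomp (lleg s) _*[H] (rleg s) ^![H]) :=
  adj_comp (sadj H (lleg s)) (tadj H (rleg s)).

(** The representative serves to produce some left adjoint; its right adjoint is transported to the
    functor of the class, which depends on no choice. *)
Definition class_adj (y x : op (span_cat hJ)) (m : hom y x) :
    adjunction _ (pmap P0 m) :=
  adj_iso_r (span_adj (representative m))
    (srs_natural (representative_in m)) (srs_iso S (representative_in m)).

Definition left_realisation_op : @pseudofunctor (op (op (span_cat hJ))) H :=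
  left_adjoint_pf class_adj.

Definition left_realisation : @pseudofunctor (span_cat hJ) H :=
  pf_unop left_realisation_op.

Let ladj : star_adjunction P0 left_realisation_op :=
  left_adjoint_star class_adj.

Let A (x y : J) (m : span_class x y) :
    adjunction (@pmap (span_cat hJ) H left_realisation x y m)
      (@pmap (op (span_cat hJ)) H P0 y x m) :=
  @star_adj (op (span_cat hJ)) H P0 left_realisation_op ladj y x m.

Section Comparison.
Context (x y : J) (m : span_class x y) (s : span x y) (ms : m s).

Lemma srs_inv_natural :
  @natural _ _ (@pmap (op (span_cat hJ)) H P0 y x m)
    (fcomp (lleg s) _*[H] (rleg s) ^![H])
    (fun K => iso_inv (srs_iso S ms K)).
Proof. exact: natural_inv (srs_natural ms). Qed.

Lemma srs_inv_nat (K L : H y) (k : hom K L) :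
  iso_inv (srs_iso S ms L) \oc fmap (@pmap (op (span_cat hJ)) H P0 y x m) k =
  fmap (lleg s) _*[H] (fmap (rleg s) ^![H] k) \oc iso_inv (srs_iso S ms K).
Proof. exact: srs_inv_natural. Qed.

Let m_ssr := mates_ex (A m) (span_adj s) srs_inv_natural
  (fun K => iso_inv_iso (srs_iso S ms K)).

(** Defined by conjugation from the inverse of [srs], for any member of the class: the chosen
    representative has no special status here. *)
Definition left_ssr (K : H x) :
    hom (@pmap (span_cat hJ) H left_realisation x y m K)
        ((rleg s) _![H] ((lleg s) ^*[H] K)) := sval m_ssr K.

Lemma mates_ssr : mates (A m) (span_adj s) left_ssr
  (fun K => iso_inv (srs_iso S ms K)).
Proof. exact: svalP m_ssr. Qed.

Lemma left_ssr_natural : @natural _ _ _ (fcomp (rleg s) _![H] (lleg s) ^*[H])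
  left_ssr.
Proof.
apply: mates_natural srs_inv_natural _ mates_ssr => K; exact: iso_inv_iso.
Qed.

Lemma left_ssr_iso (K : H x) : is_iso (left_ssr K).
Proof.
apply: (mates_iso srs_inv_natural _ mates_ssr) => L; exact: iso_inv_iso.
Qed.

End Comparison.

Lemma left_mates_id (x : J) :
  mates (adj_id (H x)) (A (class_of (id_span x)))
    (@punit (span_cat hJ) H left_realisation x (@idm (span_cat hJ) x) erefl)
    (@punit (op (span_cat hJ)) H P0 x (@idm (span_cat hJ) x) erefl).
Proof.
move=> K; rewrite /= compm1; have := star_adj_id ladj (x := x) K.
by move=> ->; exact: (punit_nat P0).
Qed.

Lemma left_mates_comp (x y z : J) (m : span_class x y) (n : span_class y z)
    (mn : span_class x z) (e : span_comp hJ n m = mn) :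
  mates (adj_comp (A m) (A n)) (A mn)
    (@pcomp (span_cat hJ) H left_realisation x y z m n mn e)
    (@pcomp (op (span_cat hJ)) H P0 z y x n m mn e).
Proof.
move=> K; rewrite aunit_comp /=.
have := @star_adj_comp _ _ _ _ ladj z y x n m mn e K.
by rewrite -!compA.
Qed.

(** Both sides are mates of arrows between right adjoints, and these arrows agree by [srs_id] after
    inverting [srs]. *)
Lemma left_ssr_id (x : J) (K : H x) :
  left_ssr (class_of_in (id_span x)) K
    \oc @punit (span_cat hJ) H left_realisation x (@idm (span_cat hJ) x)
          erefl K =
  punit (lower_shriek H) erefl ((idm x) ^*[H] K) \oc cpunit (upper_star H) K.
Proof.
have M1 := mates_comp (srs_inv_natural (class_of_in (id_span x)))
  (left_mates_id (x := x)) (mates_ssr (class_of_in (id_span x))).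
have M2 : mates (adj_id (H x)) (span_adj (id_span x))
  (fun K => punit (lower_shriek H) erefl ((idm x) ^*[H] K)
     \oc cpunit (upper_star H) K)
  (fun K => fmap (idm x) _*[H] (cpunit (upper_shriek H) K)
     \oc punit (lower_star H) erefl K).
  have M := mates_pre (sadj H (idm x)) (@shriek_mates_id _ H x).
  have {}M : mates (sadj H (idm x)) (span_adj (id_span x))
    (fun K => punit (lower_shriek H) erefl ((idm x) ^*[H] K))
    (fun K => fmap (idm x) _*[H] (cpunit (upper_shriek H) K)).
    by move=> F; rewrite M adj_comp_unit_r.
  apply: (mates_comp _ (@star_mates_id _ H x) M).
  apply: natural_post (cpunit_natural _).
have b12 K' : iso_inv (srs_iso S (class_of_in (id_span x)) K')
      \oc @punit (op (span_cat hJ)) H P0 x (@idm (span_cat hJ) x) erefl K' =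
    fmap (idm x) _*[H] (cpunit (upper_shriek H) K')
      \oc punit (lower_star H) erefl K'.
  rewrite -(srs_id S) !compA iso_invl comp1m.
  exact: (punit_nat (lower_star H)).
have {}M1 : mates (adj_id (H x)) (span_adj (id_span x))
  (fun K => left_ssr (class_of_in (id_span x)) K
    \oc @punit (span_cat hJ) H left_realisation x (@idm (span_cat hJ) x) erefl
      K)
  (fun K => fmap (idm x) _*[H] (cpunit (upper_shriek H) K)
     \oc punit (lower_star H) erefl K).
  by move=> F; rewrite M1 b12.
refine (mates_uniq_l _ _ M1 M2 K).
- apply: natural_comp; first exact: punit_natural.
  exact: natural_post (cpunit_natural _).
- move=> K'; apply: is_iso_comp; first exact: punit_iso.
  exact: (is_iso_fmap _ (cpunit_iso _ _)).
Qed.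

Section Composition.
Context (x y z : J) (m : span_class x y) (n : span_class y z)
  (mn : span_class x z) (e : span_comp hJ n m = mn)
  (s : span x y) (t : span y z) (c : span x z)
  (ms : m s) (nt : n t) (mnc : mn c)
  (q : hom (apex c) (apex s)) (q' : hom (apex c) (apex t))
  (pb : is_pullback q q' (rleg s) (lleg t))
  (el : lleg s \oc q = lleg c) (er : rleg t \oc q' = rleg c).

(** The composite to be computed passes from t_r! t_l^* s_r! s_l^* through t_r! q'_! q^* s_l^* and
    t_r! q'_! c_l^* to c_r! c_l^*. The three adjunctions, bracketed so that whiskering applies,
    belong to the first three functors, and each of the arrows [step0] to [step3] is paired with its
    counterpart between right adjoints. *)
Let B := adj_comp (sadj H (lleg s)) (adj_comp (adj_comp (tadj H (rleg s))
  (sadj H (lleg t))) (tadj H (rleg t))).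

Let B' := adj_comp (sadj H (lleg s)) (adj_comp (adj_comp (sadj H q)
  (tadj H q')) (tadj H (rleg t))).

Let B'' := adj_comp (sadj H (lleg c)) (adj_comp (tadj H q') (tadj H (rleg t))).

Let step0 : mates (adj_comp (A m) (A n)) B
  (fun K => fmap (rleg t) _![H] (fmap (lleg t) ^*[H] (left_ssr ms K))
     \oc left_ssr nt (@pmap (span_cat hJ) H left_realisation x y m K))
  (fun K => iso_inv (srs_iso S ms ((lleg t) _*[H] ((rleg t) ^![H] K)))
     \oc fmap (@pmap (op (span_cat hJ)) H P0 y x m) (iso_inv (srs_iso S nt K))).
Proof.
have M := mates_comp (natural_pre _ (srs_inv_natural ms))
  (mates_pre (A m) (mates_ssr nt))
  (mates_post (span_adj t) (srs_inv_natural ms) (mates_ssr ms)).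
by move=> K; rewrite -[RHS]M !aunit_comp /= !fmapM -!compA.
Qed.

Let icomate_natural : @natural _ _ (fcomp (rleg s) ^![H] (lleg t) _*[H])
  (fcomp q _*[H] q' ^![H]) (fun K => iso_inv (comate_iso lc pb K)).
Proof. exact: natural_inv (comate_natural lc pb). Qed.

Let step1 : mates B B'
  (fun K => fmap (rleg t) _![H] (mate lo pb ((lleg s) ^*[H] K)))
  (fun K => fmap (lleg s) _*[H]
     (iso_inv (comate_iso lc pb ((rleg t) ^![H] K)))).
Proof.
exact: mates_pre (mates_post _ icomate_natural (mates_mate lc pb)).
Qed.

Let step2 : mates B' B''
  (fun K => fmap (rleg t) _![H] (fmap q' _![H] (cpcomp (upper_star H) el K)))
  (fun K => pcomp (lower_star H) el (q' ^![H] ((rleg t) ^![H] K))).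
Proof.
have M := mates_post (adj_comp (tadj H q') (tadj H (rleg t)))
  (pcomp_natural (lower_star H) el) (star_mates_comp el).
by move=> K; rewrite [LHS]M !aunit_comp /= !fmapM -!compA.
Qed.

Let step3 : mates B'' (span_adj c)
  (fun K => pcomp (lower_shriek H) er ((lleg c) ^*[H] K))
  (fun K => fmap (lleg c) _*[H] (cpcomp (upper_shriek H) er K)).
Proof. exact: mates_pre (shriek_mates_comp er). Qed.

Lemma left_ssr_comp (K : H x) :
  left_ssr mnc K \oc @pcomp (span_cat hJ) H left_realisation x y z m n mn e K =
  pcomp (lower_shriek H) er ((lleg c) ^*[H] K)
    \oc fmap ((rleg t) _![H]) (fmap (q' _![H]) (cpcomp (upper_star H) el K))
    \oc fmap ((rleg t) _![H]) (lower_mate lo pb ((lleg s) ^*[H] K))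
    \oc fmap ((rleg t) _![H]) (fmap ((lleg t) ^*[H]) (left_ssr ms K))
    \oc left_ssr nt (@pmap (span_cat hJ) H left_realisation x y m K).
Proof.
have M1 := mates_comp (srs_inv_natural mnc) (left_mates_comp e) (mates_ssr mnc).
have M01 := mates_comp (natural_post _ (natural_pre _ icomate_natural)) step0
  step1.
have n2 : @natural _ _
    (fcomp (lleg s) _*[H] (fcomp (fcomp q _*[H] q' ^![H]) (rleg t) ^![H]))
    (fcomp (lleg c) _*[H] (fcomp q' ^![H] (rleg t) ^![H]))
    (fun K => pcomp (lower_star H) el (q' ^![H] ((rleg t) ^![H] K))).
  by move=> F G k; exact: pcomp_nat.
have M02 := mates_comp n2 M01 step2.
have M2 := mates_comp (natural_post _ (cpcomp_natural er _)) M02 step3.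
(* This is [srs_comp] solved for the inverse of the realisation of the composite span, which
   requires inverting [comate] and the realisations of the two factors. *)
have b12 L : iso_inv (srs_iso S mnc L) \oc
    @pcomp (op (span_cat hJ)) H P0 z y x n m mn e L =
  fmap (lleg c) _*[H] (cpcomp (upper_shriek H) er L) \oc
  (pcomp (lower_star H) el (q' ^![H] ((rleg t) ^![H] L)) \oc
   (fmap (lleg s) _*[H] (iso_inv (comate_iso lc pb ((rleg t) ^![H] L))) \oc
    (iso_inv (srs_iso S ms ((lleg t) _*[H] ((rleg t) ^![H] L))) \oc
     fmap (@pmap (op (span_cat hJ)) H P0 y x m) (iso_inv (srs_iso S nt L))))).
  apply: (iso_mono (srs_iso S mnc _)); rewrite (compl _ (iso_invr _)) comp1m.
  rewrite -(compl2 _ (pcomp_nat _ el _)).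
  have E := srs_comp S e ms nt mnc pb el er L; rewrite -!compA in E.
  rewrite (compl3 _ E) -!compA.
  have E' : fmap (lleg s) _*[H] (lower_comate lo pb ((rleg t) ^![H] L)) \oc
      fmap (lleg s) _*[H] (iso_inv (comate_iso lc pb ((rleg t) ^![H] L))) =
      idm _.
    by rewrite -fmapM -fmap1 -(iso_invr (comate_iso lc pb _)) {2}/comate -lock.
  rewrite (compl _ E') comp1m.
  rewrite -(compl2 _ (srs_inv_nat ms _)) (compl _ (iso_invr _)) comp1m.
  by rewrite -fmapM iso_invr fmap1 compm1.
have nb := natural_comp (pcomp_natural P0 e) (srs_inv_natural mnc).
have ib L : is_iso (iso_inv (srs_iso S mnc L) \oc
    @pcomp (op (span_cat hJ)) H P0 z y x n m mn e L).
  apply: is_iso_comp; last exact: iso_inv_iso.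
  exact: (@pcomp_iso (op (span_cat hJ)) H P0 z y x n m mn e L).
have {}M2 : mates (adj_comp (A m) (A n)) (span_adj c)
  (fun K => pcomp (lower_shriek H) er ((lleg c) ^*[H] K)
    \oc fmap ((rleg t) _![H]) (fmap (q' _![H]) (cpcomp (upper_star H) el K))
    \oc fmap ((rleg t) _![H]) (lower_mate lo pb ((lleg s) ^*[H] K))
    \oc fmap ((rleg t) _![H]) (fmap ((lleg t) ^*[H]) (left_ssr ms K))
    \oc left_ssr nt (@pmap (span_cat hJ) H left_realisation x y m K))
  (fun L => iso_inv (srs_iso S mnc L) \oc
    @pcomp (op (span_cat hJ)) H P0 z y x n m mn e L).
  by move=> F; rewrite M2 b12 /mate -lock -!compA.
exact: (mates_uniq_l nb ib M1 M2 K).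
Qed.

End Composition.

Lemma left_realisationP : star_shriek_realisation lo left_realisation.
Proof.
exists left_ssr.
- by move=> x y m s ms K L k; exact: left_ssr_natural.
- by move=> x y m s ms K; exact: left_ssr_iso.
- by move=> x K; exact: left_ssr_id.
- by move=> *; exact: left_ssr_comp.
Qed.

End Left_adjoint_realisation.
End Realisations.

Section Identity_iso_inv.
Context (C : category) (O : C -> category) (P Q : pseudofunctor O)
  (w : forall (x y : C) (f : hom x y) (F : O x),
     hom (pmap Q f F) (pmap P f F)).
Context
  (w_nat : forall (x y : C) (f : hom x y),
    @natural _ _ (pmap Q f) (pmap P f) (w f))
  (w_iso : forall (x y : C) (f : hom x y) (F : O x), is_iso (w f F))
  (w_punit : forall (x : C) (F : O x),
     w (idm x) F \oc punit Q erefl F = punit P erefl F)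
  (w_pcomp : forall (x y z : C) (f : hom x y) (g : hom y z) h
     (e : g \oc f = h) (F : O x),
     w h F \oc pcomp Q e F =
     pcomp P e F \oc w g (pmap P f F) \oc fmap (pmap Q g) (w f F)).

(** The realisations of H_{!*} lead from f_{l*} f_r^! to the functor of a class, against the
    direction wanted for the isomorphism, so the comparison is inverted. *)
Definition identity_pf_iso_inv : pf_iso P Q.
Proof.
apply: (@identity_pf_iso _ _ P Q (fun x y f F => iso_inv (w_iso f F))).
- move=> x y f; exact: (natural_inv (w_iso f) (@w_nat x y f)).
- by move=> x y f F; exact: iso_inv_iso.
- by move=> x F; rewrite -w_punit compA iso_invl comp1m.
- move=> x y z f g h e F.
  apply: (iso_mono (w_iso h F)); rewrite (compl _ (iso_invr _)) comp1m !compA.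
  rewrite w_pcomp -!compA (compl _ (fmap_tri _ (iso_invr _))) fmap1 comp1m.
  by rewrite iso_invr compm1.
Defined.

End Identity_iso_inv.

Section Mackey.
Context (J : category) (hJ : has_pullbacks J) (H : four_functors J)
  (lo : lower_exchange H) (lc : is_lower_coherent lo).

Lemma pullback_id_horizontal (a c : J) (g : hom a c) :
  is_pullback (idm a) g g (idm c).
Proof.
apply: pullback_build; first by rewrite compm1 comp1m.
  by move=> t u v; rewrite comp1m => e; exists u; rewrite comp1m.
by move=> t w w'; rewrite !comp1m.
Qed.

Lemma pullback_id_vertical (a b : J) (f : hom a b) :
  is_pullback f (idm a) (idm b) f.
Proof. exact: pullback_flip (pullback_id_horizontal f). Qed.

Lemma lower_mateE (a b c d : J) (f : hom a b) (g : hom a c)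
    (p : hom b d) (h : hom c d) (pb : is_pullback f g p h) (M : H b) :
  lower_mate lo pb M = mate lo pb M.
Proof. by rewrite /mate -lock. Qed.

Lemma lower_comateE (a b c d : J) (f : hom a b) (g : hom a c)
    (p : hom b d) (h : hom c d) (pb : is_pullback f g p h) (M : H c) :
  lower_comate lo pb M = comate lo pb M.
Proof. by rewrite /comate -lock. Qed.

Lemma cpcomp_unit (x y : J) (f : hom x y) (P : @pseudofunctor (op J) H)
    (e : f \oc idm x = f) (K : H y) :
  cpcomp P e K \oc cpunit P (cpmap P f K) = idm _.
Proof. exact: (@punit_l (op J) H P y x f (idm x) erefl e K). Qed.

Section Star_shriek.
Context (P : @pseudofunctor (span_cat hJ) H) (R : star_shriek_realisation lo P).

Section Covariant.
Context (x y : J) (f : hom x y).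
Let i (F : H x) := is_iso_fmap f _![H] (cpunit_iso (upper_star H) F).

(** On a span with identity left leg the realisation takes values in f_! applied to the inverse
    image along an identity; the unit constraint of the inverse image is removed. For [ssr_con]
    below it is the unit constraint of the direct image with proper supports. *)
Definition ssr_cov (F : H x) :
    hom (pmap (pf_restrict (span_i hJ) P) f F) (f _![H] F) :=
  locked (iso_inv (i F) \oc ssr R (class_of_in (cov_span f)) F).

Lemma ssr_covP (F : H x) :
  fmap f _![H] (cpunit (upper_star H) F) \oc ssr_cov F =
  ssr R (class_of_in (cov_span f)) F.
Proof. by rewrite /ssr_cov -lock compA iso_invr comp1m. Qed.

Lemma ssr_cov_nat : natural ssr_cov.
Proof.
move=> F G k; apply: (iso_mono (i G)).
rewrite !compA ssr_covP (ssr_nat R (class_of_in (cov_span f))) -fmapM.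
by rewrite cpunit_nat fmapM -compA ssr_covP.
Qed.

Lemma ssr_cov_iso (F : H x) : is_iso (ssr_cov F).
Proof.
rewrite /ssr_cov -lock; exact: (@is_iso_comp (H y) _ _ _ _ _
  (ssr_iso R (class_of_in (cov_span f)) F) (iso_inv_iso (i F))).
Qed.

End Covariant.

Section Contravariant.
Context (x y : J) (f : hom y x).

Definition ssr_con (F : H x) :
    hom (@pmap (op J) H (pf_restrict (span_j hJ) P) x y f F) (f ^*[H] F) :=
  locked (iso_inv (punit_iso (lower_shriek H) erefl (f ^*[H] F))
    \oc ssr R (class_of_in (contra_span f)) F).

Lemma ssr_conP (F : H x) :
  punit (lower_shriek H) erefl (f ^*[H] F) \oc ssr_con F =
  ssr R (class_of_in (contra_span f)) F.
Proof. by rewrite /ssr_con -lock compA iso_invr comp1m. Qed.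

Lemma ssr_con_nat : natural ssr_con.
Proof.
move=> F G k; apply: (iso_mono (punit_iso (lower_shriek H) erefl (f ^*[H] G))).
rewrite !compA ssr_conP (ssr_nat R (class_of_in (contra_span f))).
by rewrite punit_nat -compA ssr_conP.
Qed.

Lemma ssr_con_iso (F : H x) : is_iso (ssr_con F).
Proof.
rewrite /ssr_con -lock; exact: (@is_iso_comp (H y) _ _ _ _ _
  (ssr_iso R (class_of_in (contra_span f)) F) (iso_inv_iso _)).
Qed.

End Contravariant.

(** Composites of covariant spans, and likewise of contravariant ones, involve base change only
    along squares with two identity sides, where it reduces to unit constraints; these cancel
    against those used to define the comparisons. *)
Lemma mackey_star_shriek : is_mackey_star_shriek H P.
Proof.
split; constructor.
- apply: (@identity_pf_iso _ _ (pf_restrict (span_i hJ) P) (lower_shriek H)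
    ssr_cov).
  + by move=> *; exact: ssr_cov_nat.
  + by move=> *; exact: ssr_cov_iso.
  + move=> x F.
    apply: (iso_mono (is_iso_fmap _ (cpunit_iso (upper_star H) F))).
    rewrite compA ssr_covP; apply: etrans (etrans (ssr_id R F)
      (punit_nat (lower_shriek H) erefl (cpunit (upper_star H) F))).
    (* The restricted pseudo-functor takes its unit constraint at a different proof that the arrow
       is an identity. *)
    by congr (_ \oc punit _ _ _); exact: Prop_irrelevance.
  + move=> x y z f g h e F.
    apply: (iso_mono (is_iso_fmap _ (cpunit_iso (upper_star H) F))).
    rewrite compA ssr_covP.
    (* The fibre product of the legs [f] and the identity is realised by the apex of the first span,
       with projections an identity and [f]. *)
    have E := ssr_comp R (fmap_eqM (span_i hJ) e) (class_of_in (cov_span f))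
      (class_of_in (cov_span g)) (class_of_in (cov_span h))
      (pullback_id_horizontal f) (comp1m (idm x)) e F.
    rewrite /= in E; rewrite [LHS]E -!compA lower_mateE -(ssr_covP g).
    rewrite (compl2 _ (fmap_sq g _![H] (esym (cpunit_nat (upper_star H) _)))).
    rewrite (compl _ (fmap_tri g _![H] (mate_id_horizontal lc _ _))).
    rewrite (compl _ (fmap_tri g _![H] (fmap_tri f _![H] (cpcomp_unit _ _ F)))).
    rewrite !fmap1 comp1m -ssr_covP fmapM -!compA.
    by rewrite (compl2 _ (pcomp_nat _ e _)).
- apply: (@identity_pf_iso _ _ (pf_restrict (span_j hJ) P) (upper_star H)
    ssr_con).
  + by move=> *; exact: ssr_con_nat.
  + by move=> *; exact: ssr_con_iso.
  + move=> x F; apply: (iso_mono (punit_iso (lower_shriek H) erefl _)).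
    rewrite compA ssr_conP; apply: etrans (ssr_id R F).
    by congr (_ \oc punit _ _ _); exact: Prop_irrelevance.
  + move=> x y z f g h e F.
    apply: (iso_mono (punit_iso (lower_shriek H) erefl _)).
    rewrite compA ssr_conP.
    have E := ssr_comp R (fmap_eqM (span_j hJ) e)
      (class_of_in (@contra_span J y x f))
      (class_of_in (@contra_span J z y g)) (class_of_in (@contra_span J z x h))
      (pullback_id_vertical (g : @hom J z y)) e (comp1m (idm z)) F.
    rewrite /= in E.
    rewrite [LHS]E -!compA lower_mateE -(ssr_conP (g : @hom J z y)).
    rewrite !(compl2 _ (esym (punit_nat (lower_shriek H) erefl _))).
    rewrite (compl _ (punit_l (lower_shriek H) _ _ _)) comp1m.
    rewrite -(ssr_conP (f : @hom J y x)) !fmapM -!compA.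
    rewrite (compl _ (mate_id_vertical lc _ _)).
    by rewrite (compl2 _ (esym (punit_nat (lower_shriek H) erefl _))).
Qed.

End Star_shriek.

Section Shriek_star.
Context (P : @pseudofunctor (op (span_cat hJ)) H)
  (S : shriek_star_realisation lo P).

Section Covariant.
Context (x y : J) (f : hom y x).

Definition srs_cov (F : H x) :
    hom (f ^![H] F)
      (@pmap (op J) H (pf_restrict (op_functor (span_i hJ)) P) x y f F) :=
  locked (srs S (class_of_in (cov_span f)) F
    \oc punit (lower_star H) erefl (f ^![H] F)).

Lemma srs_covE (F : H x) : srs_cov F =
  srs S (class_of_in (cov_span f)) F \oc punit (lower_star H) erefl (f ^![H] F).
Proof. by rewrite /srs_cov -lock. Qed.

Lemma srs_cov_nat : natural srs_cov.
Proof.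
move=> F G k; rewrite !srs_covE -!compA punit_nat compA.
by rewrite (srs_nat S (class_of_in (cov_span f))) -compA.
Qed.

Lemma srs_cov_iso (F : H x) : is_iso (srs_cov F).
Proof.
rewrite srs_covE; exact: (@is_iso_comp (H y) _ _ _ _ _
  (punit_iso (lower_star H) erefl _) (srs_iso S (class_of_in (cov_span f)) F)).
Qed.

End Covariant.

Section Contravariant.
Context (x y : J) (f : hom x y).

Definition srs_con (F : H x) :
    hom (f _*[H] F) (pmap (pf_restrict (span_j_op hJ) P) f F) :=
  locked (srs S (class_of_in (contra_span f)) F
    \oc fmap f _*[H] (cpunit (upper_shriek H) F)).

Lemma srs_conE (F : H x) : srs_con F =
  srs S (class_of_in (contra_span f)) F
    \oc fmap f _*[H] (cpunit (upper_shriek H) F).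
Proof. by rewrite /srs_con -lock. Qed.

Lemma srs_con_nat : natural srs_con.
Proof.
move=> F G k; rewrite !srs_conE -!compA -fmapM cpunit_nat fmapM compA.
by rewrite (srs_nat S (class_of_in (contra_span f))) -compA.
Qed.

Lemma srs_con_iso (F : H x) : is_iso (srs_con F).
Proof.
rewrite srs_conE; exact: (@is_iso_comp (H y) _ _ _ _ _
  (is_iso_fmap _ (cpunit_iso (upper_shriek H) F))
  (srs_iso S (class_of_in (contra_span f)) F)).
Qed.

End Contravariant.

Lemma mackey_shriek_star : is_mackey_shriek_star H P.
Proof.
split; constructor.
- apply: (@identity_pf_iso_inv _ _ (pf_restrict (op_functor (span_i hJ)) P)
    (upper_shriek H) srs_cov).
  + by move=> *; exact: srs_cov_nat.
  + by move=> *; exact: srs_cov_iso.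
  + move=> x F; rewrite (@srs_covE x x (idm x)); apply: etrans (srs_id S F) _.
    by congr (@punit (op (span_cat hJ)) H P x _ _ F); exact: Prop_irrelevance.
  + move=> x y z f g h e F; rewrite (@srs_covE x z h).
    have E := srs_comp S (fmap_eqM (op_functor (span_i hJ)) e)
      (class_of_in (@cov_span J z y g)) (class_of_in (@cov_span J y x f))
      (class_of_in (@cov_span J z x h))
      (pullback_id_horizontal (g : @hom J z y)) (comp1m (idm z)) e F.
    rewrite /= lower_comateE -!compA in E.
    rewrite (@srs_covE x y f) (@srs_covE y z g) -!compA fmapM.
    (* A unit constraint is expanded into a [comate] of an identity square, so that the left side of
       [srs_comp] can be recognised. *)
    rewrite /= -[X in _ \oc (_ \oc (_ \oc (_ \oc X)))](comate_id_horizontal lc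
      (pullback_id_horizontal (g : @hom J z y))).
    rewrite !(compl2 _ (punit_nat (lower_star H) erefl _)).
    rewrite (compl4 _ (esym E)) -!compA; congr (_ \oc _).
    rewrite -!(compl2 _ (punit_nat (lower_star H) erefl _)).
    rewrite (compl _ (punit_l (lower_star H) _ _ _)) comp1m.
    by rewrite -(punit_nat (lower_star H) erefl).
- apply: (@identity_pf_iso_inv _ _ (pf_restrict (span_j_op hJ) P)
    (lower_star H) srs_con).
  + by move=> *; exact: srs_con_nat.
  + by move=> *; exact: srs_con_iso.
  + move=> x F; rewrite srs_conE -compA -(punit_nat (lower_star H)) compA.
    apply: etrans (srs_id S F) _.
    by congr (@punit (op (span_cat hJ)) H P x _ _ F); exact: Prop_irrelevance.
  + move=> x y z f g h e F; rewrite !srs_conE.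
    have E := srs_comp S (fmap_eqM (span_j_op hJ) e)
      (class_of_in (contra_span g)) (class_of_in (contra_span f))
      (class_of_in (contra_span h))
      (pullback_id_vertical f) e (comp1m (idm x)) F.
    rewrite /= lower_comateE -!compA in E.
    rewrite -!compA fmapM (compl2 _
      (fmap_sq g _*[H] (cpunit_nat (upper_shriek H) _))).
    rewrite -(comate_id_vertical lc (pullback_id_vertical f)) !fmapM -!compA.
    rewrite /= (compl4 _ (esym E)) -!compA; congr (_ \oc _).
    rewrite (compl _ (fmap_tri g _*[H] (fmap_tri f _*[H] (cpcomp_unit _ _ _)))).
    by rewrite !fmap1 comp1m pcomp_nat.
Qed.

End Shriek_star.
End Mackey.

(** * Uniqueness of right adjoints and change of the functors f^! *)

Section Right_adjoint_comparison.
Context (C D : category) (L : functor C D) (R R' : functor D C)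
  (A : adjunction L R) (A' : adjunction L R').

Definition right_comparison (y : D) : hom (R y) (R' y) :=
  fmap R' (acounit A y) \oc aunit A' (R y).

Lemma right_comparison_natural : natural right_comparison.
Proof.
move=> x y k; rewrite /right_comparison -compA aunit_nat compA -fmapM.
by rewrite acounit_nat fmapM -compA.
Qed.

Lemma right_comparison_unit x :
  right_comparison (L x) \oc aunit A x = aunit A' x.
Proof.
by rewrite /right_comparison -compA aunit_nat compA -fmapM atriangleL fmap1
  comp1m.
Qed.

Lemma right_comparison_counit y :
  acounit A' y \oc fmap L (right_comparison y) = acounit A y.
Proof. exact: adj_transpose_r. Qed.

Lemma mates_right_comparison : mates A A' (fun x => idm (L x)) right_comparison.
Proof. by move=> x; rewrite fmap1 comp1m right_comparison_unit. Qed.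

End Right_adjoint_comparison.

(** Comparisons preserve counits, and an arrow into a value of a right adjoint is determined by its
    composite with the counit; so the two comparisons are inverse to each other. *)
Lemma right_comparison_iso (C D : category) (L : functor C D)
    (R R' : functor D C) (A : adjunction L R) (A' : adjunction L R') y :
  is_iso (right_comparison A A' y).
Proof.
exists (right_comparison A' A y).
by split; [apply: (adj_inj_r (A := A))|apply: (adj_inj_r (A := A'))];
  rewrite fmapM compA !right_comparison_counit fmap1 compm1.
Qed.

(* Right adjoints are unique up to isomorphism, so that statements about
   arbitrary [f^!] reduce to any particular choice of them. *)
Section Change_of_upper_shriek.
Context (J : category) (hJ : has_pullbacks J) (O : J -> category)
  (Hd Hl : @pseudofunctor J O) (Hu Hs Hs' : @pseudofunctor (op J) O)
  (adj1 : star_adjunction Hd Hu) (adj2 : shriek_adjunction Hl Hs)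
  (adj2' : shriek_adjunction Hl Hs').

Let H := FourFunctors adj1 adj2.
Let H' := FourFunctors adj1 adj2'.

Let al (x y : J) (f : hom x y) (K : O y) : hom (cpmap Hs f K) (cpmap Hs' f K) :=
  locked (right_comparison (shriek_adj adj2 f) (shriek_adj adj2' f) K).

Let alE (x y : J) (f : hom x y) (K : O y) :
  al f K = right_comparison (shriek_adj adj2 f) (shriek_adj adj2' f) K.
Proof. by rewrite /al -lock. Qed.

Let al_nat (x y : J) (f : hom x y) (F G : O y) (k : hom F G) :
  al f G \oc fmap (cpmap Hs f) k = fmap (cpmap Hs' f) k \oc al f F.
Proof. rewrite !alE; exact: right_comparison_natural. Qed.

Let al_iso (x y : J) (f : hom x y) (K : O y) : is_iso (al f K).
Proof. rewrite alE; exact: right_comparison_iso. Qed.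

Let al_counit (x y : J) (f : hom x y) (K : O y) :
  acounit (shriek_adj adj2' f) K \oc fmap (pmap Hl f) (al f K) =
  acounit (shriek_adj adj2 f) K.
Proof. rewrite alE; exact: right_comparison_counit. Qed.

(** Both sides are mates of the same unit constraint of f_!, hence equal by uniqueness. *)
Let al_unit (x : J) (K : O x) : al (idm x) K \oc cpunit Hs K = cpunit Hs' K.
Proof.
have M := mates_comp (right_comparison_natural (shriek_adj adj2 (idm x))
   (shriek_adj adj2' (idm x))) (@shriek_mates_id _ H x)
  (mates_right_comparison (shriek_adj adj2 (idm x)) (shriek_adj adj2' (idm x))).
have M' := @shriek_mates_id _ H' x.
have {}M : mates (adj_id (O x)) (shriek_adj adj2' (idm x)) (punit Hl erefl)
    (fun K => al (idm x) K \oc cpunit Hs K).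
  by move=> F; rewrite [LHS]M comp1m /= alE.
refine (mates_uniq_r _ _ _ M M' K); last exact: punit_iso.
- move=> F G k; rewrite -compA; apply: etrans (compl2 _ (al_nat _ _)).
  by congr (_ \oc _); exact: (@cpunit_nat _ H).
- exact: (@cpunit_natural _ H').
Qed.

(** Transposed to counits, both sides are the composite of the counits of [f] and [g] for the first
    choice of right adjoints. *)
Let al_comp (x y z : J) (f : hom x y) (g : hom y z) (h : hom x z)
    (e : g \oc f = h) (K : O z) :
  al h K \oc cpcomp Hs e K =
  cpcomp Hs' e K \oc (fmap (cpmap Hs' f) (al g K) \oc al f (cpmap Hs g K)).
Proof.
have E : acounit (shriek_adj adj2 h) K \oc (fmap (pmap Hl h) (cpcomp Hs e K)
    \oc pcomp Hl e (cpmap Hs f (cpmap Hs g K))) =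
  acounit (shriek_adj adj2 g) K \oc
    fmap (pmap Hl g) (acounit (shriek_adj adj2 f) (cpmap Hs g K)).
  exact: (@shriek_counit_comp _ H).
have E' : acounit (shriek_adj adj2' h) K \oc (fmap (pmap Hl h) (cpcomp Hs' e K)
    \oc pcomp Hl e (cpmap Hs' f (cpmap Hs' g K))) =
  acounit (shriek_adj adj2' g) K \oc
    fmap (pmap Hl g) (acounit (shriek_adj adj2' f) (cpmap Hs' g K)).
  exact: (@shriek_counit_comp _ H').
apply: (adj_inj_r (A := shriek_adj adj2' h)).
apply: (iso_epi (pcomp_iso Hl e _)).
rewrite !fmapM -!compA (compl _ (al_counit _ _)) E.
rewrite -(pcomp_nat Hl e) -(compl2 _ (pcomp_nat Hl e _)) (compl3 _ E') -!compA.
rewrite (compl2 _ (fmap_sq (pmap Hl g) (acounit_nat (shriek_adj adj2' f) _))).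
by rewrite (compl _ (al_counit _ _)) (fmap_tri (pmap Hl g) (al_counit _ _)).
Qed.

Section Square.
Context (lo : lower_exchange H)
  (lo_nat : forall (a b c d : J) (f : hom a b) (g : hom a c) (p : hom b d)
      (h : hom c d) (pb : is_pullback f g p h) (F G : H a) (k : hom F G),
    lo _ _ _ _ _ _ _ _ pb G \oc fmap (p _![H]) (fmap (f _*[H]) k) =
    fmap (h _*[H]) (fmap (g _![H]) k) \oc lo _ _ _ _ _ _ _ _ pb F).

Let lo' : lower_exchange H' := lo.

(** A comate is made of a unit for [p], the exchange and a counit for [g]. The exchange does not
    involve f^! at all, and the comparisons respect units and counits. *)
Lemma lower_comate_change (a b c d : J) (f : hom a b) (g : hom a c)
    (p : hom b d) (h : hom c d) (pb : is_pullback f g p h) (M : O c) :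
  al p (pmap Hd h M) \oc lower_comate lo pb M =
  lower_comate lo' pb M \oc fmap (pmap Hd f) (al g M).
Proof.
rewrite /lower_comate -!fmapM (compA _ _ (al _ _)) al_nat -compA.
have al_adj := right_comparison_unit (shriek_adj adj2 p) (shriek_adj adj2' p).
rewrite -!compA alE al_adj /= (aunit_nat (shriek_adj adj2' p)) [RHS]compA
  -fmapM.
congr (fmap _ _ \oc _); rewrite -[RHS]compA; rewrite [X in _ = _ \oc X]lo_nat.
rewrite compA -fmapM; congr (fmap _ _ \oc _).
exact/esym/al_counit.
Qed.

Lemma lower_comate_change_nat (a b c d : J) (f : hom a b) (g : hom a c)
    (p : hom b d) (h : hom c d) (pb : is_pullback f g p h) (M N : O c)
    (k : hom M N) :
  lower_comate lo' pb N \oc fmap (pmap Hd f) (fmap (cpmap Hs' g) k) =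
  fmap (cpmap Hs' p) (fmap (pmap Hd h) k) \oc lower_comate lo' pb M.
Proof.
rewrite /lower_comate -!fmapM -compA (aunit_nat (shriek_adj adj2' p)).
rewrite !compA -!fmapM; congr (fmap _ _ \oc _).
rewrite -compA [X in _ \oc X]lo_nat !compA -!fmapM; congr (fmap _ _ \oc _).
exact: (acounit_nat (shriek_adj adj2' g)).
Qed.

Lemma comate_iso_change (a b c d : J) (f : hom a b) (g : hom a c)
    (p : hom b d) (h : hom c d) (pb : is_pullback f g p h) (M : O c) :
  is_iso (lower_comate lo' pb M) -> is_iso (lower_comate lo pb M).
Proof.
move=> i; apply: (is_iso_compl (al_iso p (pmap Hd h M))).
rewrite [X in is_iso X]lower_comate_change; apply: is_iso_comp i.
exact: (is_iso_fmap _ (al_iso _ _)).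
Qed.

Context (P : @pseudofunctor (op (span_cat hJ)) H)
  (S : shriek_star_realisation (H := H') lo' P).

Definition changed_srs (x y : J) (m : span_class x y) (s : span x y)
    (ms : m s) (K : O y) :
    hom (pmap Hd (lleg s) (cpmap Hs (rleg s) K))
        (@pmap (op (span_cat hJ)) H P y x m K) :=
  srs S ms K \oc fmap (pmap Hd (lleg s)) (al (rleg s) K).

(** Only the factor f_r^! changes, so the old realisation is precomposed with the comparison of
    right adjoints; its axioms use that this comparison respects constraints and comates. *)
Lemma changed_realisation : shriek_star_realisation (H := H) lo P.
Proof.
exists changed_srs; rewrite /changed_srs.
- move=> x y m s ms K L k.
  rewrite -compA -fmapM al_nat fmapM compA (srs_nat S ms); exact/esym/compA.
- move=> x y m s ms K; apply: is_iso_comp; last exact: (srs_iso S ms).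
  exact: (is_iso_fmap _ (al_iso _ _)).
- move=> x K; rewrite -(srs_id S) -al_unit -!compA; congr (_ \oc _).
  by rewrite /H /H' /= !compA (punit_nat Hd).
- move=> x y z m n mn e s t c ms nt mnc q q' pb el er K.
  have E := srs_comp S e ms nt mnc pb el er K; rewrite /H' /= -!compA in E.
  have := lower_comate_change pb (cpmap Hs (rleg t) K).
  rewrite /H /=; move: (lower_comate lo pb _) => k Ek.
  rewrite !fmapM -!compA -(compl2 _ (pcomp_nat Hd el _)).
  rewrite (fmap_sq _ (fmap_sq _ (al_comp er K))) !fmapM.
  rewrite (compl3 _ E) -!compA; congr (_ \oc (_ \oc _)).
  rewrite (compl2 _ (fmap_sq (pmap Hd (lleg s)) (al_nat (rleg s) _))).
  rewrite (compl2 _ (fmap_sq (pmap Hd (lleg s)) (al_nat (rleg s) _))).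
   rewrite (fmap_sq (pmap Hd (lleg s)) Ek).
  congr (_ \oc _).
  by rewrite (compl2 _ (fmap_sq (pmap Hd (lleg s))
    (lower_comate_change_nat pb _))).
Qed.

End Square.
End Change_of_upper_shriek.

(** * Direct images with supports along a partial map *)

Section Sections.
Context (X : topologicalType) (F : sheaf X).

Lemma res_res (U V W : opens X) (h : V `<=` U) (k : W `<=` V) (s : F U) :
  res k (res h s) = res (fun x Wx => h x (k x Wx)) s.
Proof. exact: resM. Qed.

Lemma sec_empty (U : opens X) (s t : F U) : (forall x, ~ oset U x) -> s = t.
Proof. by move=> U0; apply: sheaf_ext => x /U0. Qed.

Lemma res_inj (U V : opens X) (h : V `<=` U) (s t : F U) :
  U `<=` V -> res h s = res h t -> s = t.
Proof.
move=> k e; rewrite -(res1 (fun _ => id) s) -(res1 (fun _ => id) t).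
by rewrite -(resM h k (fun _ => id) s) e (resM h k (fun _ => id) t).
Qed.

End Sections.

(* A continuous map to [X] defined on a closed subset of [Y]: [pm_open] with
   empty [U] says that the domain of definition is closed. *)
Record partial_map (Y X : topologicalType) := PartialMap {
  pm_rel :> Y -> X -> Prop;
  pm_fun : forall y x x', pm_rel y x -> pm_rel y x' -> x = x';
  pm_open : forall U : opens X,
    open [set y | forall x, pm_rel y x -> oset U x] }.

Definition empty_open (X : topologicalType) : opens X := Opens (@open0 X).

Section Preimage.
Context (Y X : topologicalType) (R : partial_map Y X).

Definition upre (U : opens X) : opens Y := Opens (pm_open R U).

Lemma upreS (U V : opens X) : V `<=` U -> upre V `<=` upre U.
Proof. by move=> h y k x /k /h. Qed.

Lemma upre0 (U : opens X) : upre (empty_open X) `<=` upre U.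
Proof. exact: upreS. Qed.

End Preimage.

Section Pull.
Context (A : fieldType) (Y X : topologicalType) (R : partial_map Y X).
Implicit Types (K : mod_sheaf A Y) (U V : opens X).

(* [upre R (empty_open X)] is the complement of the domain of [R]. *)
Definition pull_sec K U : small :=
  {s : K (upre R U) | forall h : upre R (empty_open X) `<=` upre R U,
     res h s = m_zero (msh_str K _)}.

Lemma pull_sec_eq K U (s t : pull_sec K U) : sval s = sval t -> s = t.
Proof.
by case: s t => s ps [t pt] /= e; subst t; congr exist; exact: Prop_irrelevance.
Qed.

Definition pull_res K U V (h : V `<=` U) (s : pull_sec K U) : pull_sec K V.
Proof.
exists (res (upreS (R := R) h) (sval s)) => k.
by rewrite res_res; exact: (proj2_sig s).
Defined.

Lemma pull_res1 K U (h : U `<=` U) (s : pull_sec K U) : pull_res h s = s.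
Proof. by apply: pull_sec_eq; exact: res1. Qed.

Lemma pull_resM K U V (W : opens X) (h : V `<=` U) (k : W `<=` V) (l : W `<=` U)
    (s : pull_sec K U) : pull_res k (pull_res h s) = pull_res l s.
Proof. by apply: pull_sec_eq; exact: resM. Qed.

(** The sets [upre R V] for the members of a cover need not cover [upre R U], because points outside
    the domain of [R] lie in it unconditionally and the cover may be empty. The complement of the
    domain is added as one more member, indexed by [None]; there the vanishing condition prescribes
    the zero section. *)
Lemma pull_glue K U (D : opens X -> Prop) :
  (forall V, D V -> V `<=` U) ->
  (forall x, oset U x -> exists V, D V /\ oset V x) ->
  forall t : (forall V, D V -> pull_sec K V),
  (forall (V V' W : opens X) (DV : D V) (DV' : D V') (h : W `<=` V)
      (h' : W `<=` V'),
    pull_res h (t V DV) = pull_res h' (t V' DV')) ->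
  exists! s : pull_sec K U, forall V (DV : D V) (h : V `<=` U),
    pull_res h s = t V DV.
Proof.
move=> DU cov t agr.
pose W (i : option {V | D V}) := if i is Some v then upre R (sval v)
  else upre R (empty_open X).
have WU i : W i `<=` upre R U.
  by case: i => [[V DV]|]; [exact: upreS (DU V DV)|exact: upre0].
pose z := m_zero (msh_str K (upre R (empty_open X))).
pose u (i : option {V | D V}) : K (W i) :=
  if i is Some v then sval (t (sval v) (proj2_sig v)) else z.
have covW y : oset (upre R U) y -> exists i, oset (W i) y.
  move=> Uy; have [[x Rx]|nR] := pselect (exists x, R y x); last first.
    by exists None => /= x Rx; case: nR; exists x.
  have [V [DV Vx]] := cov x (Uy x Rx); exists (Some (exist _ V DV)) =>
    /= x' Rx'.
  by rewrite (pm_fun Rx' Rx).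
have zero v (O : opens Y) (h : O `<=` W (Some v)) (k : O `<=` W None) :
    res h (u (Some v)) = res k (u None).
  rewrite -(resM (upre0 (R := R) (sval v)) k)
    (proj2_sig (t (sval v) (proj2_sig v))).
  by [].
have [//||s sP] := @sheaf_glue Y K (upre R U) _ W WU u.
  move=> [[V DV]|] [[V' DV']|] O h k; last exact: res_irr.
  - have oI : open (V `&` V') by apply: openI; exact: oset_open.
    have l : O `<=` upre R (Opens oI).
      by move=> y Oy x Rx; split; [exact: (h y Oy x Rx)|exact: (k y Oy x Rx)].
    have := agr V V' (Opens oI) DV DV' (@subIsetl _ _ _) (@subIsetr _ _ _).
    by move=> /(congr1 (fun r => res l (sval r))) /=;
      rewrite !(resM _ _ h) !(resM _ _ k).
  - exact: zero.
  - exact/esym/zero.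
have s0 (h : upre R (empty_open X) `<=` upre R U) : res h s = z.
  exact: etrans (res_irr h (WU None) s) (sP None).
exists (exist _ s s0); split=> [V DV h|s' s'P].
  apply: pull_sec_eq.
  exact: etrans (res_irr _ _ _) (sP (Some (exist _ V DV))).
apply: pull_sec_eq; apply: sheaf_ext => y /covW[i Wy].
exists (W i), (WU i); split=> //; rewrite sP.
case: i Wy => [[V DV]|] Wy /=.
  rewrite -(s'P V DV (DU V DV)) /=; exact: res_irr.
by apply/esym; exact: (proj2_sig s').
Qed.

Definition pull_sheaf K : sheaf X :=
  @Sheaf X (pull_sec K) (@pull_res K) (@pull_res1 K) (@pull_resM K)
    (@pull_glue K).

Section Structure.
Context (K : mod_sheaf A Y) (U : opens X).
Let ms := msh_str K (upre R U).

Let z : pull_sec K U.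
Proof. by exists (m_zero ms) => h; exact: semilinear0 (msh_res K h). Defined.
Let o (s : pull_sec K U) : pull_sec K U.
Proof.
exists (m_opp ms (sval s)) => h.
by rewrite (semilinearN (msh_res K h)) (proj2_sig s) m_opp0.
Defined.
Let d (s t : pull_sec K U) : pull_sec K U.
Proof.
exists (m_add ms (sval s) (sval t)) => h.
by have [-> _] := msh_res K h; rewrite (proj2_sig s) (proj2_sig t) m_add0.
Defined.
Let l (a : A) (s : pull_sec K U) : pull_sec K U.
Proof.
exists (m_scale ms a (sval s)) => h.
by have [_ ->] := msh_res K h; rewrite (proj2_sig s) m_scale0.
Defined.

Lemma pull_addA : associative d.
Proof. by move=> x y w; apply: pull_sec_eq; exact: m_addA. Qed.
Lemma pull_addC : commutative d.
Proof. by move=> x y; apply: pull_sec_eq; exact: m_addC. Qed.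
Lemma pull_add0 : left_id z d.
Proof. by move=> x; apply: pull_sec_eq; exact: m_add0. Qed.
Lemma pull_addN : left_inverse z o d.
Proof. by move=> x; apply: pull_sec_eq; exact: m_addN. Qed.
Lemma pull_scaleA a b x : l a (l b x) = l (r_mul (field_ring A) a b) x.
Proof. by apply: pull_sec_eq; exact: m_scaleA. Qed.
Lemma pull_scale1 : left_id (r_one (field_ring A)) l.
Proof. by move=> x; apply: pull_sec_eq; exact: m_scale1. Qed.
Lemma pull_scaleDr : right_distributive l d.
Proof. by move=> a x y; apply: pull_sec_eq; exact: m_scaleDr. Qed.
Lemma pull_scaleDl x a b : l (r_add (field_ring A) a b) x = d (l a x) (l b x).
Proof. by apply: pull_sec_eq; exact: m_scaleDl. Qed.

Definition pull_str : module_str (field_ring A) (pull_sec K U) :=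
  ModuleStr pull_addA pull_addC pull_add0 pull_addN pull_scaleA pull_scale1
    pull_scaleDr pull_scaleDl.

End Structure.

Lemma pull_res_linear K U V (h : V `<=` U) :
  is_semilinear id (pull_str K U) (pull_str K V) (@pull_res K U V h).
Proof.
have [r1 r2] := msh_res K (upreS (R := R) h).
by split=> [s t|a s]; apply: pull_sec_eq; [exact: r1|exact: r2].
Qed.

Definition pull_ob (K : ShA A Y) : ShA A X :=
  @ModSheaf A X (pull_sheaf K) (pull_str K) (@pull_res_linear K).

Section Hom.
Context (K L : ShA A Y) (m : mod_sheaf_hom K L).

Let k U (s : pull_ob K U) : pull_ob L U.
Proof.
exists (m _ (sval s)) => h.
by rewrite -msm_nat (proj2_sig s); exact: semilinear0 (msm_linear m _).
Defined.

Lemma pull_hom_nat U V (h : V `<=` U) (s : pull_ob K U) :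
  k (res h s) = res h (k s).
Proof. by apply: pull_sec_eq; exact: msm_nat. Qed.

Lemma pull_hom_linear U :
  is_semilinear id (msh_str (pull_ob K) U) (msh_str (pull_ob L) U) (@k U).
Proof.
have [m1 m2] := msm_linear m (upre R U).
by split=> [s t|a s]; apply: pull_sec_eq; [exact: m1|exact: m2].
Qed.

Definition pull_hom : hom (pull_ob K) (pull_ob L) :=
  ModSheafHom pull_hom_nat pull_hom_linear.

End Hom.

Lemma pull1 (K : ShA A Y) : pull_hom (idm K) = idm (pull_ob K).
Proof. by apply: mod_sheaf_hom_eq => U s; exact: pull_sec_eq. Qed.

Lemma pullM (F G K : ShA A Y) (m : hom F G) (n : hom G K) :
  pull_hom (n \oc m) = pull_hom n \oc pull_hom m.
Proof. by apply: mod_sheaf_hom_eq => U s; exact: pull_sec_eq. Qed.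

Definition pull : functor (ShA A Y) (ShA A X) :=
  @Functor (ShA A Y) (ShA A X) pull_ob pull_hom pull1 pullM.

End Pull.

Section Pull_diagram.
Context (A : fieldType) (C : category) (T : C -> topologicalType)
  (r : forall x y : C, hom x y -> partial_map (T x) (T y)).
Context (r1 : forall (x : C) (u : hom x x), u = idm x ->
    forall a b, r u a b <-> a = b)
  (rM : forall (x y z : C) (f : hom x y) (g : hom y z) (h : hom x z),
    g \oc f = h -> forall a c, r h a c <-> exists b, r f a b /\ r g b c).

Let O (x : C) := ShA A (T x).
Let map (x y : C) (f : hom x y) : functor (O x) (O y) := pull A (r f).

Lemma upre_id (x : C) (u : hom x x) (e : u = idm x) (U : opens (T x)) :
  upre (r u) U `<=` U.
Proof. by move=> a /(_ a); apply; apply/r1. Qed.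

Lemma upre_id' (x : C) (u : hom x x) (e : u = idm x) (U : opens (T x)) :
  U `<=` upre (r u) U.
Proof. by move=> a Ua b /(r1 e) <-. Qed.

Lemma upre_comp (x y z : C) (f : hom x y) (g : hom y z) (h : hom x z)
    (e : g \oc f = h) (U : opens (T z)) :
  upre (r h) U `<=` upre (r f) (upre (r g) U).
Proof. by move=> a Ua b fab c gbc; apply: Ua; apply/(rM e); exists b. Qed.

Lemma upre_comp' (x y z : C) (f : hom x y) (g : hom y z) (h : hom x z)
    (e : g \oc f = h) (U : opens (T z)) :
  upre (r f) (upre (r g) U) `<=` upre (r h) U.
Proof. by move=> a Ua c /(rM e)[b [fab gbc]]; exact: Ua gbc. Qed.

(** An identity relation is defined everywhere, so its vanishing condition concerns sections over an
    empty set and holds trivially. *)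
Let upre0_id (x : C) (u : hom x x) (e : u = idm x) a :
  ~ oset (upre (r u) (empty_open (T x))) a.
Proof. by move=> /(_ a); apply; apply/(r1 e). Qed.

Section Unit.
Context (x : C) (u : hom x x) (e : u = idm x) (K : O x).

Definition pull_unit_fun (U : opens (T x)) (s : K U) : map u K U.
Proof.
exists (res (upre_id e (U := U)) s) => h.
by apply: sec_empty => a; exact: upre0_id.
Defined.

Lemma pull_unit_nat (U V : opens (T x)) (h : V `<=` U) (s : K U) :
  pull_unit_fun (res h s) = res h (pull_unit_fun s).
Proof. by apply: pull_sec_eq; rewrite /= !res_res; exact: res_irr. Qed.

Lemma pull_unit_linear (U : opens (T x)) :
  is_semilinear id (msh_str K U) (msh_str (map u K) U) (@pull_unit_fun U).
Proof.
have [m1 m2] := msh_res K (upre_id e (U := U)).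
by split=> [s t|a s]; apply: pull_sec_eq; [exact: m1|exact: m2].
Qed.

Definition pull_unit : hom K (map u K) :=
  ModSheafHom pull_unit_nat pull_unit_linear.

Lemma pull_unit_iso : is_iso pull_unit.
Proof.
apply: ShA_iso => U.
exists (fun s => res (upre_id' e (U := U)) (sval s)) => s /=.
  by rewrite res_res res1.
by apply: pull_sec_eq; rewrite /= res_res res1.
Qed.

End Unit.

Section Comp.
Context (x y z : C) (f : hom x y) (g : hom y z) (h : hom x z)
  (e : g \oc f = h) (K : O x).

Definition pull_comp_fun (U : opens (T z)) (s : map g (map f K) U) : map h K U.
Proof.
exists (res (upre_comp e (U := U)) (sval (sval s))) => k.
have := proj2_sig s (upre0 (R := r g) U) => /(congr1 sval) /= E.
(* A point unrelated under the composite is one all of whose relatives under [r f] are unrelated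
   under [r g]; the outer vanishing condition therefore applies to it. *)
have l : upre (r h) (empty_open (T z)) `<=`
  upre (r f) (upre (r g) (empty_open (T z))) by
    exact: (upre_comp e (U := empty_open (T z))).
rewrite res_res -(resM (upreS (R := r f) (upre0 (R := r g) U)) l) E.
exact: semilinear0 (msh_res K l).
Defined.

Lemma pull_comp_nat (U V : opens (T z)) (i : V `<=` U)
    (s : map g (map f K) U) :
  pull_comp_fun (res i s) = res i (pull_comp_fun s).
Proof. by apply: pull_sec_eq; rewrite /= !res_res; exact: res_irr. Qed.

Lemma pull_comp_linear (U : opens (T z)) :
  is_semilinear id (msh_str (map g (map f K)) U) (msh_str (map h K) U)
    (@pull_comp_fun U).
Proof.
have [m1 m2] := msh_res K (upre_comp e (U := U)).
by split=> [s t|a s]; apply: pull_sec_eq; [exact: m1|exact: m2].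
Qed.

Definition pull_comp : hom (map g (map f K)) (map h K) :=
  ModSheafHom pull_comp_nat pull_comp_linear.

Let inv_sub (U : opens (T z)) (s : map h K U) : map f K (upre (r g) U).
Proof.
exists (res (upre_comp' e (U := U)) (sval s)) => k.
have l : upre (r f) (empty_open (T y)) `<=` upre (r h) (empty_open (T z)).
  by move=> a k' c /(rM e)[b [/k']].
rewrite res_res -(resM (upre0 (R := r h) U) l) (proj2_sig s).
exact: semilinear0 (msh_res K l).
Defined.

Let inv (U : opens (T z)) (s : map h K U) : map g (map f K) U.
Proof.
exists (inv_sub s) => k; apply: pull_sec_eq => /=.
have l : upre (r f) (upre (r g) (empty_open (T z))) `<=`
  upre (r h) (empty_open (T z)) by
    exact: (upre_comp' e (U := empty_open (T z))).
rewrite res_res -(resM (upre0 (R := r h) U) l) (proj2_sig s).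
exact: semilinear0 (msh_res K l).
Defined.

Lemma pull_comp_iso : is_iso pull_comp.
Proof.
apply: ShA_iso => U; exists (@inv U) => s.
  by do 2!apply: pull_sec_eq; rewrite /= res_res res1.
by apply: pull_sec_eq; rewrite /= res_res res1.
Qed.

End Comp.

(** The relations compose strictly, so source and target of each constraint have sections over equal
    open sets. All constraints are restrictions, and each coherence law says that two restrictions
    with the same ends agree. *)
Definition pull_pf : @pseudofunctor C O.
Proof.
refine (@Pseudofunctor C O map (fun x u e F => pull_unit e F)
  (fun x y z f g h e F => pull_comp e F) _ _ _ _ _ _ _).
- move=> x u e F G k; apply: mod_sheaf_hom_eq => U s; apply: pull_sec_eq.
  exact/esym/msm_nat.
- by move=> x u e F; exact: pull_unit_iso.
- move=> x y z f g h e F G k; apply: mod_sheaf_hom_eq => U s.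
  apply: pull_sec_eq; exact/esym/msm_nat.
- by move=> x y z f g h e F; exact: pull_comp_iso.
- move=> x y f u eu e F; apply: mod_sheaf_hom_eq => U s; apply: pull_sec_eq.
  by rewrite /= res_res res1.
- move=> x y f u eu e F; apply: mod_sheaf_hom_eq => U s; apply: pull_sec_eq.
  by rewrite /= res_res res1.
- move=> x y z w f g h gf hg hgf e1 e2 e3 e4 F.
  apply: mod_sheaf_hom_eq => U s; apply: pull_sec_eq; rewrite /= !res_res.
  exact: res_irr.
Defined.

End Pull_diagram.

(** * Partial maps attached to spans of closed embeddings *)

Section Closed_embeddings.
Context (A : fieldType) (J : category) (hJ : has_pullbacks J)
  (X : functor J (Top A))
  (hX : forall (x y : J) (f : hom x y), closed_embedding (transition X f))
  (hpb : preserves_pullbacks X).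

(** The universal property is tested on constant maps. Their source is the space [X b] itself,
    nonempty by the point [s] and already an object of the category, which avoids showing that a
    one-point space is one. *)
Lemma pullback_point (a b c d : J) (f : hom a b) (g : hom a c) (p : hom b d)
    (h : hom c d) (pb : is_pullback f g p h) (s : X b) (t : X c) :
  transition X p s = transition X h t ->
  exists w : X a, transition X f w = s /\ transition X g w = t.
Proof.
move=> e.
have cs : {k : continuousType (X b) (X b) | forall z, k z = s}.
  by exists (cst s).
have ct : {k : continuousType (X b) (X c) | forall z, k z = t}.
  by exists (cst t).
have [u uE] := cs; have [v vE] := ct.
have [|w [w1 w2]] := pullback_lift (hpb pb) (t := X b) (u := u) (v := v).
  by apply/continuousEP => z /=; rewrite uE vE.
exists ((w : continuousType _ _) s); split.
  by rewrite -[RHS](uE s) -w1.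
by rewrite -[RHS](vE s) -w2.
Qed.

Definition span_rel (x y : J) (s : span x y) (b : X y) (a : X x) : Prop :=
  exists z, transition X (rleg s) z = b /\ transition X (lleg s) z = a.

Lemma span_rel_equiv (x y : J) (s t : span x y) b a :
  span_equiv s t -> span_rel s b a -> span_rel t b a.
Proof.
move=> [k [_ el er]] [z [<- <-]]; exists (transition X k z).
by rewrite (transitionM er z) (transitionM el z).
Qed.

Lemma span_rel_fun (x y : J) (s : span x y) b a a' :
  span_rel s b a -> span_rel s b a' -> a = a'.
Proof.
move=> [z [<- <-]] [z' [+ <-]].
by have [inj _ _] := hX (rleg s); move=> /inj ->.
Qed.

(** The set is the union of the complement of the range of the right leg, open since the range is
    closed, and of an open set that extends the preimage of [U] under the left leg, which exists
    since the right leg is an embedding. *)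
Lemma span_rel_open (x y : J) (s : span x y) (U : opens (X x)) :
  open [set b | forall a, span_rel s b a -> oset U a].
Proof.
have [inj cl op] := hX (rleg s).
have [V oV EV] := op _ (oset_open (preopen (transition X (lleg s)) U)).
have -> : [set b | forall a, span_rel s b a -> oset U a] =
    ~` range (transition X (rleg s)) `|` V.
  apply/seteqP; split=> b.
  - move=> Ub; have [[z _ zb]|nb] := pselect (range (transition X (rleg s)) b).
      right; rewrite -zb; have : oset U (transition X (lleg s) z).
        by apply: Ub; exists z.
      move=> Uz; have : (transition X (rleg s) @^-1` V) z by rewrite -EV.
      by [].
    by left.
  - move=> [nb|Vb] a [z [zb <-]]; first by case: nb; exists z.
    suff : (preopen (transition X (lleg s)) U : set _) z by [].
    by rewrite EV /= zb.
by apply: openU => //; exact: closed_openC.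
Qed.

Section Class.
Context (x y : J) (m : span_class x y).

(** Quantifying over all members makes the relation depend on the class alone; by [class_relP] any
    single member computes it. *)
Definition class_rel (b : X y) (a : X x) : Prop :=
  exists s, m s /\ span_rel s b a.

Lemma class_relP (s : span x y) b a : m s -> class_rel b a <-> span_rel s b a.
Proof.
move=> ms; split=> [[t [mt]]|r]; last by exists s.
exact: span_rel_equiv (in_class_equiv mt ms).
Qed.

Lemma class_rel_fun b a a' : class_rel b a -> class_rel b a' -> a = a'.
Proof.
have [s ms] := in_class_ex m.
move=> /(class_relP _ _ ms) r /(class_relP _ _ ms); exact: span_rel_fun r.
Qed.

Lemma class_rel_open (U : opens (X x)) :
  open [set b | forall a, class_rel b a -> oset U a].
Proof.
have [s ms] := in_class_ex m.
have -> : [set b | forall a, class_rel b a -> oset U a] =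
    [set b | forall a, span_rel s b a -> oset U a].
  by apply/seteqP; split=> b Ub a /(class_relP _ _ ms); exact: Ub.
exact: span_rel_open.
Qed.

Definition class_map : partial_map (X y) (X x) :=
  PartialMap class_rel_fun class_rel_open.

End Class.

Lemma class_map_id (x : J) (u : span_class x x) :
  u = class_of (id_span x) -> forall a b, class_map u a b <-> a = b.
Proof.
move=> -> a b; apply: iff_trans (class_relP _ _ (class_of_in _)) _.
have E z : transition X (idm x) z = z by exact: transition1.
by split=> [[z [<- <-]]//|->]; exists b; rewrite /= !E.
Qed.

(** Commutativity of the fibre square gives one direction. For the other, two related pairs have
    matching points in the apices, and these lift to a point of the fibre product since X preserves
    fibre products. *)
Lemma class_map_comp (x y z : J) (m : span_class x y) (n : span_class y z)
    (mn : span_class x z) : span_comp hJ n m = mn ->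
  forall a c, class_map mn a c <-> exists b, class_map n a b /\ class_map m b c.
Proof.
move=> e a c.
have [s ms] := in_class_ex m; have [t nt] := in_class_ex n.
have [k kc] := composite_ex hJ s t; have mnk : mn k by rewrite -e; exists s, t.
have [q [q' [pb el er]]] := kc; have [sq _] := pb.
have P w : transition X (rleg s) (transition X q w) =
    transition X (lleg t) (transition X q' w).
  by rewrite -[LHS](transitionM sq w) (transitionM (erefl (lleg t \oc q')) w).
split.
  move=> /(class_relP _ _ mnk)[w [<- <-]].
  exists (transition X (rleg s) (transition X q w)); split.
    apply/(class_relP _ _ nt); exists (transition X q' w).
    by rewrite P (transitionM er w).
  apply/(class_relP _ _ ms); exists (transition X q w).
  by rewrite (transitionM el w).
move=> [b [/(class_relP _ _ nt)[w [<- wb]] /(class_relP _ _ ms)[w' [w'b <-]]]].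
have [|v [v1 v2]] := pullback_point pb (s := w') (t := w); first by rewrite wb.
apply/(class_relP _ _ mnk); exists v.
by rewrite (transitionM el v) (transitionM er v) /= v1 v2.
Qed.

Definition span_pf : @pseudofunctor (op (span_cat hJ)) (ShX X) :=
  @pull_pf A (op (span_cat hJ)) (fun x => X x) (fun x y m => class_map m)
    (fun x u e => class_map_id e)
    (fun x y z f g h e => class_map_comp e).

(** For a covariant span the partial map is the inverse of the embedding on its range; pulling back
    along it gives sections that vanish off the range, which is the functor of sections supported on
    the closed subspace. *)
Definition H_upper_shriek : @pseudofunctor (op J) (ShX X) :=
  pf_restrict (op_functor (span_i hJ)) span_pf.

Lemma class_map_cov (x y : J) (f : hom x y) b a :
  class_map (class_of (cov_span f)) b a <-> transition X f a = b.
Proof.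
apply: iff_trans (class_relP _ _ (class_of_in _)) _.
have E z : transition X (idm x) z = z by exact: transition1.
by split=> [[z [<- <-]]|<-]; [rewrite E|exists a; rewrite /= E].
Qed.

End Closed_embeddings.

(** * The adjunction of f_! with sections supported on the range of a closed embedding *)

Section Shriek_pull_adjunction.
Context (A : fieldType) (X Y : topologicalType) (f : continuousType X Y)
  (hY : hausdorff_space Y) (lcY : locally_compact [set: Y])
  (ef : closed_embedding f) (R : partial_map Y X)
  (hR : forall y x, R y x <-> f x = y).

Let L : functor (ShA A X) (ShA A Y) := proper_direct_image A f hY lcY.

Lemma preopen_upre (U : opens X) : preopen f (upre R U) `<=` U.
Proof. by move=> x /(_ x); apply; apply/hR. Qed.

Lemma upre_preopen (V : opens Y) : V `<=` upre R (preopen f V).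
Proof. by move=> y Vy x /hR E; rewrite -E in Vy. Qed.

Definition proper_sec (F : ShA A X) (V : opens Y) (s : F (preopen f V)) :
    L F V :=
  exist _ s (@closed_embedding_proper _ _ _ _ F V s ef).

Definition shriek_pull_unit_fun (F : ShA A X) (U : opens X) (s : F U) :
  pull A R (L F) U.
Proof.
exists (proper_sec (res (preopen_upre (U := U)) s)) => h.
(* The complement of the range has empty preimage, so the vanishing condition is automatic. *)
apply: shriek_sec_eq; apply: sec_empty => x;
  exact: (@preopen_upre (empty_open X)).
Defined.

(** A section of f_! f^! G over [V] is a section of [G] over the union of [V] and the complement of
    the range, which is [upre R (preopen f V)]; the counit restricts it to [V]. *)
Definition shriek_pull_counit_fun (G : ShA A Y) (V : opens Y)
    (s : L (pull A R G) V) : G V :=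
  res (upre_preopen (V := V)) (sval (sval s)).

Lemma shriek_pull_unit_nat (F : ShA A X) (U V : opens X) (h : V `<=` U)
    (s : F U) :
  shriek_pull_unit_fun (res h s) = res h (shriek_pull_unit_fun s).
Proof.
apply: pull_sec_eq; apply: shriek_sec_eq; rewrite /= !res_res; exact: res_irr.
Qed.

Lemma shriek_pull_unit_linear (F : ShA A X) (U : opens X) :
  is_semilinear id (msh_str F U) (msh_str (pull A R (L F)) U)
    (@shriek_pull_unit_fun F U).
Proof.
have [m1 m2] := msh_res F (preopen_upre (U := U)).
by split=> [s t|a s]; apply: pull_sec_eq; apply: shriek_sec_eq;
  [exact: m1|exact: m2].
Qed.

Definition shriek_pull_unit (F : ShA A X) : hom F (pull A R (L F)) :=
  ModSheafHom (@shriek_pull_unit_nat F) (@shriek_pull_unit_linear F).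

Lemma shriek_pull_counit_nat (G : ShA A Y) (U V : opens Y) (h : V `<=` U)
    (s : L (pull A R G) U) :
  shriek_pull_counit_fun (res h s) = res h (shriek_pull_counit_fun s).
Proof. by rewrite /shriek_pull_counit_fun /= !res_res; exact: res_irr. Qed.

Lemma shriek_pull_counit_linear (G : ShA A Y) (V : opens Y) :
  is_semilinear id (msh_str (L (pull A R G)) V) (msh_str G V)
    (@shriek_pull_counit_fun G V).
Proof.
have [m1 m2] := msh_res G (upre_preopen (V := V)).
by split=> [s t|a s]; [exact: m1|exact: m2].
Qed.

Definition shriek_pull_counit (G : ShA A Y) : hom (L (pull A R G)) G :=
  ModSheafHom (@shriek_pull_counit_nat G) (@shriek_pull_counit_linear G).

Definition shriek_pull_adjunction : adjunction L (pull A R).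
Proof.
refine (@Adjunction _ _ L (pull A R) shriek_pull_unit shriek_pull_counit
  _ _ _ _).
- move=> F G k; apply: mod_sheaf_hom_eq => U s; apply: pull_sec_eq.
  by apply: shriek_sec_eq; exact/esym/msm_nat.
- by move=> F G k; apply: mod_sheaf_hom_eq => U s; exact/esym/msm_nat.
- move=> F; apply: mod_sheaf_hom_eq => U s; apply: shriek_sec_eq => /=.
  by rewrite res_res res1.
- move=> G; apply: mod_sheaf_hom_eq => U s; apply: pull_sec_eq => /=.
  by rewrite /shriek_pull_counit_fun /= res_res res1.
Defined.

End Shriek_pull_adjunction.

Section Upper_shriek.
Context (A : fieldType) (J : category) (hJ : has_pullbacks J)
  (X : functor J (Top A))
  (hX : forall (x y : J) (f : hom x y), closed_embedding (transition X f))
  (hpb : preserves_pullbacks X).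

Let Hs := H_upper_shriek hJ hX hpb.

Definition upper_shriek_adj (x y : J) (f : hom x y) :
    adjunction (pmap (H_lower_shriek hX) f) (cpmap Hs f) :=
  shriek_pull_adjunction A (@space_hausdorff A (X y)) (@space_lc A (X y))
    (hX f) (class_map_cov hX f).

Definition upper_shriek_adjunction : shriek_adjunction (H_lower_shriek hX) Hs.
Proof.
apply: (@ShriekAdjunction _ _ _ _ upper_shriek_adj).
- move=> x F; apply: mod_sheaf_hom_eq => U s; apply: pull_sec_eq.
  by apply: shriek_sec_eq; rewrite /= res_res; exact: res_irr.
- move=> x y z f g h e F; apply: mod_sheaf_hom_eq => U s; apply: pull_sec_eq.
  by apply: shriek_sec_eq; rewrite /= !res_res; exact: res_irr.
Defined.

End Upper_shriek.

(** * Canonical exchange morphisms and realisation of H_{!*} *)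

Section Concrete_exchange.
Context (A : fieldType) (J : category) (hJ : has_pullbacks J)
  (X : functor J (Top A))
  (hX : forall (x y : J) (f : hom x y), closed_embedding (transition X f))
  (hpb : preserves_pullbacks X)
  (Hu : @pseudofunctor (op J) (ShX X))
  (adj1 : star_adjunction (H_lower_star X) Hu).

Let H0 := FourFunctors adj1 (upper_shriek_adjunction hJ hX hpb).

Let lo0 : lower_exchange H0 :=
  fun a b c d f g p h pb F => canonical_exchange hX pb F.

Section Comate.
Context (a b c d : J) (f : hom a b) (g : hom a c) (p : hom b d) (h : hom c d)
  (pb : is_pullback f g p h) (M : ShX X c).

Let Rg := class_map hX (class_of (cov_span g)).
Let Rp := class_map hX (class_of (cov_span p)).

Let sub1 (U : opens (X b)) : preopen (transition X h) (upre Rp U) `<=`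
  upre Rg (preopen (transition X f) U).
Proof.
move=> z Uz w /(class_map_cov hX) gw; apply: Uz; apply/(class_map_cov hX).
rewrite -gw -[LHS](transitionM (erefl (p \oc f)) w).
by have [-> _] := pb; exact: (transitionM (erefl (h \oc g)) w).
Qed.

Let sub2 (U : opens (X b)) : upre Rg (preopen (transition X f) U) `<=`
  preopen (transition X h) (upre Rp U).
Proof.
move=> z Uz w /(class_map_cov hX) /(pullback_point hpb pb)[v [<- vz]].
by apply: Uz; apply/(class_map_cov hX).
Qed.

Let inv (U : opens (X b))
    (t : pull A Rp (direct_image A (transition X h) M) U) :
  pull A Rg M (preopen (transition X f) U).
Proof.
exists (res (sub2 (U := U)) (sval t)) => k.
have l : upre Rg (empty_open (X a)) `<=`
    preopen (transition X h) (upre Rp (empty_open (X b))).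
  by move=> z z0; exact: (@sub2 (empty_open (X b)) z z0).
have := proj2_sig t (upre0 (R := Rp) U) => /= E.
rewrite res_res -(resM (preopenS (f := transition X h) (upre0 (R := Rp) U)) l)
  E.
exact: semilinear0 (msh_res M l).
Defined.

(** The comate is a restriction between sections of [M] over two open sets. One inclusion between
    them is commutativity of the square, and the opposite one is the pullback property on points, so
    they coincide. *)
Lemma canonical_comate_iso : is_iso (lower_comate lo0 pb M).
Proof.
apply: ShA_iso => U; exists (@inv U) => s.
  apply: pull_sec_eq.
  by rewrite /= /shriek_pull_counit_fun /= !res_res res1.
apply: pull_sec_eq.
by rewrite /= /shriek_pull_counit_fun /= !res_res res1.
Qed.

End Comate.

Section Realisation.

Let P := span_pf hJ hX hpb.

Section Class.
Context (x y : J) (m : span_class x y) (s : span x y) (ms : m s) (K : ShX X y).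

Let R := class_map hX (class_of (cov_span (rleg s))).

Let sub1 (U : opens (X x)) : upre (class_map hX m) U `<=`
  upre R (preopen (transition X (lleg s)) U).
Proof.
move=> z Uz w /(class_map_cov hX) rw; apply: Uz.
by apply/(class_relP _ _ ms); exists w.
Qed.

Let sub2 (U : opens (X x)) : upre R (preopen (transition X (lleg s)) U) `<=`
  upre (class_map hX m) U.
Proof.
move=> z Uz v /(class_relP _ _ ms)[w [rw <-]]; apply: (Uz w).
by apply/class_map_cov.
Qed.

(** The relation of the class is that of the member [s], so sections on both sides live over the
    same open set of X_y and vanish on the same part of it. *)
Definition canonical_srs_fun (U : opens (X x))
  (t : direct_image A (transition X (lleg s)) (pull A R K) U) :
  pull A (class_map hX m) K U.
Proof.
exists (res (sub1 (U := U)) (sval t)) => k.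
have l : upre (class_map hX m) (empty_open (X x)) `<=`
  upre R (empty_open (X (apex s))).
  by move=> z z0; exact: (@sub1 (empty_open (X x)) z z0).
rewrite res_res -(resM (upre0 (R := R) _) l) (proj2_sig t).
exact: semilinear0 (msh_res K l).
Defined.

Lemma canonical_srs_nat (U V : opens (X x)) (h : V `<=` U)
    (t : direct_image A (transition X (lleg s)) (pull A R K) U) :
  canonical_srs_fun (res h t) = res h (canonical_srs_fun t).
Proof. by apply: pull_sec_eq; rewrite /= !res_res; exact: res_irr. Qed.

Lemma canonical_srs_linear (U : opens (X x)) :
  is_semilinear id
    (msh_str (direct_image A (transition X (lleg s)) (pull A R K)) U)
    (msh_str (pull A (class_map hX m) K) U) (@canonical_srs_fun U).
Proof.
have [m1 m2] := msh_res K (sub1 (U := U)).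
by split=> [t u|k t]; apply: pull_sec_eq; [exact: m1|exact: m2].
Qed.

Definition canonical_srs :
    hom ((lleg s) _*[H0] ((rleg s) ^![H0] K))
        (@pmap (op (span_cat hJ)) H0 P y x m K) :=
  ModSheafHom canonical_srs_nat canonical_srs_linear.

Let inv (U : opens (X x)) (t : pull A (class_map hX m) K U) :
  direct_image A (transition X (lleg s)) (pull A R K) U.
Proof.
exists (res (sub2 (U := U)) (sval t)) => k.
have l : upre R (empty_open (X (apex s))) `<=`
    upre (class_map hX m) (empty_open (X x)).
  by move=> z Uz; apply: sub2 => w rw; case: (Uz w rw).
rewrite res_res -(resM (upre0 (R := class_map hX m) _) l) (proj2_sig t).
exact: semilinear0 (msh_res K l).
Defined.

Lemma canonical_srs_iso : is_iso canonical_srs.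
Proof.
by apply: ShA_iso => U; exists (@inv U) => t; apply: pull_sec_eq;
  rewrite /= res_res res1.
Qed.

End Class.

Lemma canonical_realisation : shriek_star_realisation (H := H0) lo0 P.
Proof.
apply: (@ShriekStarRealisation _ hJ H0 lo0 P canonical_srs).
- move=> x y m s ms K L k; apply: mod_sheaf_hom_eq => U t; apply: pull_sec_eq.
  exact/esym/msm_nat.
- by move=> *; exact: canonical_srs_iso.
- move=> x K; apply: mod_sheaf_hom_eq => U t; apply: pull_sec_eq.
  by rewrite /= !res_res; exact: res_irr.
- move=> x y z m n mn e s t c ms nt mnc q q' pb el er K.
  apply: mod_sheaf_hom_eq => U u; apply: pull_sec_eq.
  by rewrite /= !res_res; exact: res_irr.
Qed.

End Realisation.

Section Abstract.
Context (Hs : @pseudofunctor (op J) (ShX X))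
  (adj2 : shriek_adjunction (H_lower_shriek hX) Hs).

Let H := FourFunctors adj1 adj2.

Definition canonical_lower : lower_exchange H :=
  fun a b c d f g p h pb F => canonical_exchange hX pb F.

Lemma canonical_lower_nat (a b c d : J) (f : hom a b) (g : hom a c)
    (p : hom b d) (h : hom c d) (pb : is_pullback f g p h) (F G : H a)
    (k : hom F G) :
  canonical_lower pb G \oc fmap (p _![H]) (fmap (f _*[H]) k) =
  fmap (h _*[H]) (fmap (g _![H]) k) \oc canonical_lower pb F.
Proof.
by apply: mod_sheaf_hom_eq => U s; apply: shriek_sec_eq; exact/esym/msm_nat.
Qed.

(** The equations do not mention f^! and compare restrictions. Invertibility of the comate is known
    for the explicit f^! and is carried over to the given one. *)
Lemma canonical_lower_coherent : is_lower_coherent canonical_lower.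
Proof.
split.
- exact: canonical_lower_nat.
- move=> a b b' c d d' f f' g p q h h' ff hh ef eh pb1 pb2 pb F.
  apply: mod_sheaf_hom_eq => U s; apply: shriek_sec_eq.
  by rewrite /= !res_res; exact: res_irr.
- move=> a b c d c' d' f g p h g' p' k gg pp eg ep pb1 pb2 pb F.
  apply: mod_sheaf_hom_eq => U s; apply: shriek_sec_eq.
  by rewrite /= !res_res; exact: res_irr.
- move=> a c g pb F; apply: mod_sheaf_hom_eq => U s; apply: shriek_sec_eq.
  by rewrite /= !res_res; exact: res_irr.
- move=> a c g pb F; apply: mod_sheaf_hom_eq => U s; apply: shriek_sec_eq.
  by rewrite /= !res_res; exact: res_irr.
- move=> a b c d f g p h pb M.
  exact: (comate_iso_change (adj2' := upper_shriek_adjunction hJ hX hpb)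
    canonical_lower_nat (canonical_comate_iso pb M)).
Qed.

Lemma canonical_realisation_ex :
  inhabited (shriek_star_realisation canonical_lower (span_pf hJ hX hpb)).
Proof.
constructor; exact: (changed_realisation canonical_lower_nat
  canonical_realisation).
Qed.

End Abstract.

End Concrete_exchange.

(** * Inverse images *)

Lemma openI_open (X : topologicalType) (U V : opens X) : open (U `&` V).
Proof. by apply: openI; exact: oset_open. Qed.

Definition meet (X : topologicalType) (U V : opens X) : opens X :=
  Opens (@openI_open X U V).

Lemma meetl (X : topologicalType) (U V : opens X) : meet U V `<=` U.
Proof. by move=> x []. Qed.

Lemma meetr (X : topologicalType) (U V : opens X) : meet U V `<=` V.
Proof. by move=> x []. Qed.

Section Extension.
Context (X Y : topologicalType) (f : continuousType X Y).
Context (Z : opens Y -> Type)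
  (zres : forall U V : opens Y, V `<=` U -> Z U -> Z V).
Context (zresM : forall (U V W : opens Y) (h : V `<=` U) (k : W `<=` V)
    (l : W `<=` U) s, zres k (zres h s) = zres l s).
Context (M : opens X -> Type)
  (mres : forall U V : opens X, V `<=` U -> M U -> M V).
Context (mresM : forall (U V W : opens X) (h : V `<=` U) (k : W `<=` V)
    (l : W `<=` U) s, mres k (mres h s) = mres l s).
Context (m : forall V : opens Y, Z V -> M (preopen f V)).
Context (m_nat : forall (U V : opens Y) (h : V `<=` U)
     (k : preopen f V `<=` preopen f U) (s : Z U),
     m (zres h s) = mres k (m s)).

(* Bijectivity of [m] on stalks.  [Z] and [M] are not assumed to be sheaves: the
   algebraic operations are extended along [F * F -> M * M]. *)
Record is_locally_bijective : Prop := {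
  lb_inj : forall (V : opens Y) (s t : Z V) (x : X) (W : opens X)
    (h : W `<=` preopen f V), oset W x -> mres h (m s) = mres h (m t) ->
    exists (V' : opens Y) (k : V' `<=` V),
      oset V' (f x) /\ zres k s = zres k t;
  lb_surj : forall (U : opens X) (u : M U) (x : X), oset U x ->
    exists (V : opens Y) (s : Z V) (W : opens X) (h : W `<=` U)
      (k : W `<=` preopen f V), oset W x /\ mres h u = mres k (m s) }.

Context (lb : is_locally_bijective).
Context (T : topologicalType) (g : T -> X) (v : opens X -> opens T)
  (vP : forall U t, oset (v U) t <-> oset U (g t)) (N : sheaf T)
  (w : opens Y -> opens T) (wP : forall V t, oset (w V) t <-> oset V (f (g t)))
  (k : forall V : opens Y, Z V -> N (w V)).
Context (k_nat : forall (U V : opens Y) (h : V `<=` U) (l : w V `<=` w U)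
  (s : Z U),
     k (zres h s) = res l (k s)).

(** Here [v] and [w] are preimages under [g] and under the composite of [f] with [g]. They are
    specified only through membership, so that they may be identities, or preimages under a map that
    equals the composite only pointwise. *)
Definition is_extension (l : forall U : opens X, M U -> N (v U)) : Prop :=
  (forall (U V : opens X) (h : V `<=` U) (j : v V `<=` v U) (u : M U),
     l V (mres h u) = res j (l U u)) /\
  (forall (V : opens Y) (s : Z V) (j : v (preopen f V) `<=` w V),
     l _ (m s) = res j (k s)).

Let vS (U V : opens X) : V `<=` U -> v V `<=` v U.
Proof. by move=> h t /vP /h /vP. Qed.

Let vw (V : opens Y) : v (preopen f V) `<=` w V.
Proof. by move=> t /vP /wP. Qed.

Let wS (U V : opens Y) : V `<=` U -> w V `<=` w U.
Proof. by move=> h t /wP /h /wP. Qed.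

(** Every section of [M] comes locally from [Z], where compatibility with [m] and [k] fixes the
    value. *)
Lemma extension_uniq l l' : is_extension l -> is_extension l' ->
  forall U u, l U u = l' U u.
Proof.
move=> [l1 l2] [l1' l2'] U u; apply: sheaf_ext => t /vP Ut.
have [V [s [W [h [j [Wt e]]]]]] := lb_surj lb u Ut.
exists (v W), (vS h); split; first exact/vP.
by rewrite -(l1 _ _ h) -(l1' _ _ h) e (l1 _ _ _ (vS j)) (l1' _ _ _ (vS j)) l2 //
  l2'.
Qed.

(** The point on which the extension rests: representatives with the same image in [M] become equal
    in [Z] near each point by local injectivity, so that their images under [k] agree locally and
    hence agree. *)
Let agree (V V' : opens Y) (s : Z V) (s' : Z V') (W : opens X)
    (j : W `<=` preopen f V) (j' : W `<=` preopen f V') (O : opens T)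
    (h : O `<=` w V) (h' : O `<=` w V') :
  mres j (m s) = mres j' (m s') -> O `<=` v W ->
  res h (k s) = res h' (k s').
Proof.
move=> e OW; apply: sheaf_ext => t Ot.
have Wt : oset W (g t) by apply/vP; exact: OW.
pose l := @meetl _ V V'; pose r := @meetr _ V V'.
have i : W `<=` preopen f (meet V V').
  by move=> x Wx; split; [exact: (j x Wx)|exact: (j' x Wx)].
have [|V1 [i1 [V1x e1]]] := lb_inj lb (s := zres l s) (t := zres r s') (h := i)
  Wt.
  rewrite (m_nat l (preopenS (f := f) l)) (m_nat r (preopenS (f := f) r)).
  by rewrite !(mresM _ _ j) !(mresM _ _ j').
exists (meet O (w V1)), (@meetl _ _ _); split; first by split=> //; apply/wP.
have q : meet O (w V1) `<=` w (meet V V').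
  by move=> y [Oy /wP Vy]; apply/wP; exact: (i1 _ Vy).
have i2 := wS i1.
have := congr1 (fun z => res (@meetr _ O (w V1)) (k z)) e1 => /=.
rewrite !(k_nat i1 i2) (k_nat l (wS l)) (k_nat r (wS r)) !res_res => E.
apply: etrans (etrans E _); exact: res_irr.
Qed.

Record local_rep (U : opens X) (u : M U) := LocalRep {
  lr_dom : opens Y;
  lr_sec : Z lr_dom;
  lr_open : opens X;
  lr_sub : lr_open `<=` U;
  lr_pre : lr_open `<=` preopen f lr_dom;
  lr_eq : mres lr_sub u = mres lr_pre (m lr_sec) }.

Let rep_sub (U : opens X) (u : M U) (i : local_rep u) :
  v (lr_open i) `<=` w (lr_dom i).
Proof. by move=> t /vP /(lr_pre (l := i)) /wP. Qed.

(** All local representatives are glued at once, which makes the value independent of choices and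
    compatibility with restriction easy to check. *)
Let value_ex (U : opens X) (u : M U) : exists n : N (v U),
  forall i : local_rep u, res (vS (lr_sub (l := i))) n = res (rep_sub (i := i))
    (k (lr_sec i)).
Proof.
apply: (@sheaf_glue T N (v U) (local_rep u) (fun i => v (lr_open i))
  (fun i => vS (lr_sub (l := i)))
    (fun i => res (rep_sub (i := i)) (k (lr_sec i)))).
  move=> t /vP /(lb_surj lb u)[V [s [W [h [j [Wt e]]]]]].
  by exists (LocalRep e); apply/vP.
move=> i j O h h'; rewrite !res_res.
pose W := meet (lr_open i) (lr_open j).
have ji : W `<=` preopen f (lr_dom i) by move=> x [/lr_pre].
have jj : W `<=` preopen f (lr_dom j) by move=> x [_ /lr_pre].
apply: (agree (W := W) (j := ji) (j' := jj)).
  have q : W `<=` U by move=> x [/lr_sub].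
  rewrite -(mresM (lr_pre (l := i)) (@meetl _ _ _)) -lr_eq (mresM _ _ q).
  by rewrite -(mresM (lr_pre (l := j)) (@meetr _ _ _)) -lr_eq (mresM _ _ q).
by move=> t Ot; apply/vP; split; apply/vP; [exact: h|exact: h'].
Qed.

Definition extension (U : opens X) (u : M U) : N (v U) :=
  sval (cid (value_ex u)).

Let extension_rep (U : opens X) (u : M U) (i : local_rep u) :
  res (vS (lr_sub (l := i))) (extension u) =
  res (rep_sub (i := i)) (k (lr_sec i)).
Proof. exact: (svalP (cid (value_ex u))). Qed.

Lemma extensionP : is_extension extension.
Proof.
split=> [U V h j u|V s j].
- apply: sheaf_ext => t /vP /(lb_surj lb (mres h u))[O [s [W [i [l [Wt e]]]]]].
  exists (v W), (vS i); split; first exact/vP.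
  have E := @extension_rep _ _ (LocalRep e); rewrite /= in E.
  apply: etrans E _.
  have iU : W `<=` U by move=> x /i /h.
  have e' : mres iU u = mres l (m s) by rewrite -e; apply/esym; exact: mresM.
  have := @extension_rep _ _ (LocalRep e') => /= E'.
  rewrite res_res; apply: etrans (etrans (esym E') _); exact: res_irr.
- have id1 : preopen f V `<=` preopen f V by [].
  have := @extension_rep _ _ (@LocalRep _ (m s) V s _ id1 id1 erefl) => /= E.
  by rewrite -(res1 (vS id1) (extension (m s))) E; exact: res_irr.
Qed.

End Extension.

Section Germs.
Context (X Y : topologicalType) (f : continuousType X Y) (Z : sheaf Y).

Definition germ_eq (y : Y) (a b : {V : opens Y & Z V}) : Prop :=
  exists (W : opens Y) (h : W `<=` projT1 a) (k : W `<=` projT1 b),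
    oset W y /\ res h (projT2 a) = res k (projT2 b).

Lemma germ_eq_sym y a b : germ_eq y a b -> germ_eq y b a.
Proof. by move=> [W [h [k [Wy e]]]]; exists W, k, h. Qed.

Lemma germ_eq_trans y a b c : germ_eq y a b -> germ_eq y b c -> germ_eq y a c.
Proof.
move=> [W [h [k [Wy e]]]] [W' [h' [k' [Wy' e']]]].
exists (meet W W'), (fun x i => h x (meetl i)), (fun x i => k' x (meetr i)).
split; first by split.
rewrite -(resM h (@meetl _ W W')) e -(resM k' (@meetr _ W W')) -e' !res_res.
exact: res_irr.
Qed.

Lemma germ_eq_refl y a : oset (projT1 a) y -> germ_eq y a a.
Proof. by move=> ay; exists (projT1 a), (fun _ => id), (fun _ => id). Qed.

(* A section of the inverse image sheaf, as the family of its germs; the germ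
   at [x] is the class of its representatives, empty if [x] is not in [U]. *)
Definition is_germ_section (U : opens X)
    (s : X -> {V : opens Y & Z V} -> Prop) : Prop :=
  (forall x b, s x b -> oset U x) /\
  forall x, oset U x -> exists a (W : opens X),
    [/\ oset W x, W `<=` U, W `<=` preopen f (projT1 a) &
      forall x', oset W x' -> forall b, s x' b <-> germ_eq (f x') a b].

Definition germ_sec (U : opens X) : small := {s | is_germ_section U s}.

Lemma germ_sec_eq (U : opens X) (s t : germ_sec U) :
  (forall x b, sval s x b <-> sval t x b) -> s = t.
Proof.
case: s t => s ps [t pt] /= e.
have E : s = t by apply/funext => x; apply/funext => b; apply/propext/e.
by subst t; congr exist; exact: Prop_irrelevance.
Qed.

Definition germ_res (U V : opens X) (h : V `<=` U) (s : germ_sec U) :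
  germ_sec V.
Proof.
exists (fun x b => oset V x /\ sval s x b); split=> [x b []//|x Vx].
have [_ /(_ x (h x Vx))[a [W [Wx WU Wa sW]]]] := proj2_sig s.
exists a, (meet V W); split=> // [x' []//|x' [_ /Wa]//|x' [Vx' Wx'] b].
by rewrite -sW //; split=> [[]|].
Defined.

Lemma germ_res1 (U : opens X) (h : U `<=` U) (s : germ_sec U) :
  germ_res h s = s.
Proof.
apply: germ_sec_eq => x b; split=> [[]//|sx]; split=> //.
by have [sU _] := proj2_sig s; exact: sU sx.
Qed.

Lemma germ_resM (U V W : opens X) (h : V `<=` U) (k : W `<=` V) (l : W `<=` U)
    (s : germ_sec U) : germ_res k (germ_res h s) = germ_res l s.
Proof.
apply: germ_sec_eq => x b; split=> [[Wx [_ sx]]//|[Wx sx]].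
by split=> //; split=> //; exact: k.
Qed.

Lemma germ_glue (U : opens X) (D : opens X -> Prop) :
  (forall V, D V -> V `<=` U) ->
  (forall x, oset U x -> exists V, D V /\ oset V x) ->
  forall t : (forall V, D V -> germ_sec V),
  (forall (V V' W : opens X) (DV : D V) (DV' : D V') (h : W `<=` V)
      (h' : W `<=` V'),
    germ_res h (t V DV) = germ_res h' (t V' DV')) ->
  exists! s : germ_sec U, forall V (DV : D V) (h : V `<=` U),
    germ_res h s = t V DV.
Proof.
move=> DU cov t agr.
pose s x b := exists V (DV : D V), sval (t V DV) x b.
have sE V (DV : D V) x b : oset V x -> s x b <-> sval (t V DV) x b.
  move=> Vx; split=> [[V' [DV' s']]|]; last by exists V, DV.
  have [/(_ _ _ s') V'x _] := proj2_sig (t V' DV').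
  have := agr V V' (meet V V') DV DV' (@meetl _ _ _) (@meetr _ _ _).
  move=> /(congr1 (fun r => sval r x b)) /= E.
  have : oset (meet V V') x /\ sval (t V' DV') x b by split=> //; split.
  by rewrite -E => -[].
have ps : is_germ_section U s.
  split=> [x b [V [DV sx]]|x Ux].
    by apply: DU (DV) _ _; have [p _] := proj2_sig (t V DV); exact: p sx.
  have [V [DV Vx]] := cov x Ux.
  have [_ /(_ x Vx)[a [W [Wx WV Wa tW]]]] := proj2_sig (t V DV).
  exists a, W; split=> // [x' /WV /(DU _ DV)//|x' Wx' b].
  by apply: iff_trans (sE _ DV _ _ (WV _ Wx')) _; exact: tW.
exists (exist _ s ps); split=> [V DV h|s' s'P].
  apply: germ_sec_eq => x b /=; split=> [[Vx /(sE _ DV _ _ Vx)]//|tx].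
  have [p _] := proj2_sig (t V DV); have Vx := p _ _ tx.
  by split=> //; apply/(sE _ DV).
apply: germ_sec_eq => x b /=; split=> [[V [DV]]|s'x].
  by rewrite -(s'P V DV (DU V DV)) => -[].
have [p _] := proj2_sig s'; have [V [DV Vx]] := cov x (p _ _ s'x).
by exists V, DV; rewrite -(s'P V DV (DU V DV)).
Qed.

Definition germ_sheaf : sheaf X :=
  @Sheaf X germ_sec germ_res germ_res1 germ_resM germ_glue.

Definition germ_map_fun (V : opens Y) (s : Z V) : germ_sheaf (preopen f V).
Proof.
exists (fun x b => oset V (f x) /\ germ_eq (f x) (existT _ V s) b).
split=> [x b []//|x Vx]; exists (existT _ V s), (preopen f V); split=> //.
by move=> x' Vx' b; split=> [[]|].
Defined.

Lemma germ_map_nat (U V : opens Y) (h : V `<=` U)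
    (k : preopen f V `<=` preopen f U) (s : Z U) :
  germ_map_fun (res h s) = res k (germ_map_fun s).
Proof.
have E x : oset V (f x) -> germ_eq (f x) (existT _ V (res h s)) (existT _ U s).
  by move=> Vx; exists V, (fun _ => id), h; split=> //=; rewrite res1.
apply: germ_sec_eq => x b; split=> [[Vx sx]|[Vx [Ux sx]]].
  split=> //; split; first exact: (h _ Vx).
  by apply: germ_eq_trans sx; apply: germ_eq_sym; exact: E.
by split=> //; apply: germ_eq_trans sx; exact: E.
Qed.

Definition germ_map : sheaf_map f Z germ_sheaf :=
  @SheafMap X Y f Z germ_sheaf germ_map_fun germ_map_nat.

Definition is_inverse_image (M : sheaf X) (m : sheaf_map f Z M) : Prop :=
  is_locally_bijective (@res Y Z) (@res X M) m.

(** Injectivity: an equality of germ families, evaluated at the germ of [t] itself, says that the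
    germs of [s] and [t] agree. Surjectivity is the local condition in the definition of a germ
    section. *)
Lemma germ_map_inverse_image : is_inverse_image germ_map.
Proof.
split=> [V s t x W h Wx|U u x Ux].
- move=> /(congr1 (fun r => sval r x (existT _ V t))) /= E.
  have Vx := h x Wx.
  have : oset W x /\ oset V (f x) /\
      germ_eq (f x) (existT _ V t) (existT _ V t).
    by do 2!split=> //; exact: germ_eq_refl.
  rewrite -E => -[_ [_ [V' [k [k' [V'x e]]]]]]; exists V', k; split=> //.
  by rewrite /= in e; rewrite e; exact: res_irr.
- have [_ /(_ x Ux)[[V s] [W [Wx WU Wa uW]]]] := proj2_sig u.
  exists V, s, W, WU, Wa; split=> //; apply: germ_sec_eq => x' b /=.
  split=> [[Wx' ux]|[Wx' [_ e]]]; split=> //; last by apply/uW.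
  by split; [exact: (Wa x' Wx')|apply/(uW x' Wx')].
Qed.

End Germs.

Section Universal_arrows.
Context (C D : category) (R : functor D C) (L0 : C -> D)
  (eta : forall x, hom x (R (L0 x)))
  (uni : forall x y (u : hom x (R y)),
     exists! v : hom (L0 x) y, fmap R v \oc eta x = u).

Let lift x y (u : hom x (R y)) : hom (L0 x) y := sval (cid (uni u)).

Let liftP x y (u : hom x (R y)) : fmap R (lift u) \oc eta x = u.
Proof. by have [] := svalP (cid (uni u)). Qed.

Let lift_uniq x y (v w : hom (L0 x) y) :
  fmap R v \oc eta x = fmap R w \oc eta x -> v = w.
Proof.
move=> e; have [z [_ zu]] := uni (fmap R w \oc eta x).
by rewrite -(zu v) // (zu w).
Qed.

Definition universal_functor : functor C D.
Proof.
refine (@Functor C D L0 (fun x y k => lift (eta y \oc k)) _ _).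
- by move=> x; apply: lift_uniq; rewrite liftP compm1 fmap1 comp1m.
- move=> x y z k l; apply: lift_uniq; rewrite liftP fmapM -compA liftP.
  by rewrite (compl _ (liftP _)) compA.
Defined.

Definition universal_adjunction : adjunction universal_functor R.
Proof.
refine (@Adjunction C D universal_functor R eta (fun y => lift (idm (R y)))
  _ _ _ _).
- by move=> x x' k; rewrite /= liftP.
- move=> y y' k; apply: lift_uniq; rewrite /= !fmapM -!compA !liftP.
  by rewrite (compl _ (liftP _)) comp1m compm1.
- by move=> x; apply: lift_uniq; rewrite /= fmapM -compA liftP compA liftP
    fmap1.
- by move=> y; rewrite liftP.
Defined.

End Universal_arrows.

Section Inverse_image_module.
Context (A : fieldType) (X Y : topologicalType) (f : continuousType X Y)
  (F : mod_sheaf A Y) (M : sheaf X) (m : sheaf_map f F M)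
  (ii : is_inverse_image m).

Let pres (E : topologicalType) (G : sheaf E) (U V : opens E) (h : V `<=` U)
  (p : G U * G U) : G V * G V := (res h p.1, res h p.2).

Let m2 (V : opens Y) (p : F V * F V) : M (preopen f V) * M (preopen f V) :=
  (m V p.1, m V p.2).

(** Two separate representatives are restricted to the intersection of their domains, which gives a
    representative of the pair. *)
Let lb2 : is_locally_bijective (Z := fun V => (F V * F V)%type) (@pres Y F)
  (M := fun U => (M U * M U)%type) (@pres X M) m2.
Proof.
split=> [V [s1 s2] [t1 t2] x W h Wx [e1 e2]|U [u1 u2] x Ux].
- have [V1 [k1 [V1x E1]]] := lb_inj ii Wx e1.
  have [V2 [k2 [V2x E2]]] := lb_inj ii Wx e2.
  exists (meet V1 V2), (fun y i => k1 y (meetl i)); split; first by split.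
  congr pair => /=.
    by rewrite -!(resM k1 (@meetl _ V1 V2)) E1.
  by rewrite -!(resM k2 (@meetr _ V1 V2)) E2.
- have [V1 [s1 [W1 [h1 [k1 [W1x E1]]]]]] := lb_surj ii u1 Ux.
  have [V2 [s2 [W2 [h2 [k2 [W2x E2]]]]]] := lb_surj ii u2 Ux.
  pose l := @meetl _ V1 V2; pose r := @meetr _ V1 V2.
  exists (meet V1 V2), (res l s1, res r s2), (meet W1 W2),
    (fun y i => h1 y (meetl i)).
  have k : meet W1 W2 `<=` preopen f (meet V1 V2).
    by move=> y [/k1 i /k2 j]; split.
  exists k; split; first by split.
  congr pair; rewrite /= (sm_nat m _ (preopenS _)) res_res.
    by rewrite -(resM h1 (@meetl _ W1 W2)) E1 res_res; exact: res_irr.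
  by rewrite -(resM h2 (@meetr _ W1 W2)) E2 res_res; exact: res_irr.
Qed.

Section Operation.
Context (op : forall V : opens Y, F V -> F V -> F V).
Context (op_nat : forall (U V : opens Y) (h : V `<=` U) (s t : F U),
     op (res h s) (res h t) = res h (op s t)).

Let k (V : opens Y) (p : F V * F V) : M (preopen f V) := m V (op p.1 p.2).

Let k_nat (U V : opens Y) (h : V `<=` U) (l : preopen f V `<=` preopen f U)
  (p : F U * F U) : k (pres h p) = res l (k p).
Proof. by rewrite /k /= op_nat (sm_nat m h l). Qed.

Let pres_M (E : topologicalType) (G : sheaf E) (U V W : opens E)
    (h : V `<=` U) (i : W `<=` V) (l : W `<=` U) (p : G U * G U) :
  pres i (pres h p) = pres l p.
Proof. by rewrite /pres /= !(resM _ _ l). Qed.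

Let m2_nat (U V : opens Y) (h : V `<=` U) (l : preopen f V `<=` preopen f U)
  (p : F U * F U) : m2 (pres h p) = pres l (m2 p).
Proof. by rewrite /m2 /pres /= !(sm_nat m h l). Qed.

Definition extended_op (U : opens X) (s t : M U) : M U :=
  extension (@pres_M X M) m2_nat lb2
    (g := id) (v := id) (fun U t => iff_refl _) (N := M)
    (w := preopen f) (fun V t => iff_refl _) k_nat (s, t).

Let extended_opP := extensionP (@pres_M X M) m2_nat lb2
    (g := id) (v := id) (fun U t => iff_refl _) (N := M)
    (w := preopen f) (fun V t => iff_refl _) k_nat.

Lemma extended_op_res (U V : opens X) (h : V `<=` U) (s t : M U) :
  res h (extended_op s t) = extended_op (res h s) (res h t).
Proof. by have [/(_ _ _ h h (s, t)) <-] := extended_opP. Qed.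

Lemma extended_opE (V : opens Y) (s t : F V) :
  extended_op (m V s) (m V t) = m V (op s t).
Proof.
have [_ /(_ V (s, t) (fun _ => id))] := extended_opP.
by rewrite res1.
Qed.

End Operation.

(** Three sections are represented simultaneously, the largest number of section variables in an
    axiom of modules. *)
Lemma inverse_image_rep3 (U : opens X) (u1 u2 u3 : M U) (x : X) : oset U x ->
  exists (V : opens Y) (s1 s2 s3 : F V) (W : opens X) (h : W `<=` U)
    (k : W `<=` preopen f V), oset W x /\
    [/\ res h u1 = res k (m V s1), res h u2 = res k (m V s2) &
        res h u3 = res k (m V s3)].
Proof.
move=> Ux.
have [V [[s1 s2] [W [h [k [Wx [E1 E2]]]]]]] := lb_surj lb2 (u1, u2) Ux.
have [V' [s3 [W' [h' [k' [W'x E3]]]]]] := lb_surj ii u3 Ux.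
pose l := @meetl _ V V'; pose r := @meetr _ V V'.
exists (meet V V'), (res l s1), (res l s2), (res r s3), (meet W W'),
  (fun y i => h y (meetl i)).
have j : meet W W' `<=` preopen f (meet V V').
  by move=> y [/k i /k' i']; split.
exists j; split; first by split.
rewrite /= in E1 E2.
split; rewrite (sm_nat m _ (preopenS _)) res_res.
- by rewrite -(resM h (@meetl _ W W')) E1 res_res; exact: res_irr.
- by rewrite -(resM h (@meetl _ W W')) E2 res_res; exact: res_irr.
- rewrite -(resM h' (@meetr _ W W') (fun y i => h y (meetl i))) E3 res_res.
  exact: res_irr.
Qed.

Definition is_local_op (a : forall U : opens X, M U -> M U -> M U -> M U) :=
  forall (U V : opens X) (h : V `<=` U) (u1 u2 u3 : M U),
    res h (a U u1 u2 u3) = a V (res h u1) (res h u2) (res h u3).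

(** Identities between operations compatible with restriction are local, and locally all arguments
    come from [F]. The module axioms are thereby inherited from [F]. *)
Lemma local_op_eq (a b : forall U : opens X, M U -> M U -> M U -> M U) :
  is_local_op a -> is_local_op b ->
  (forall V s1 s2 s3, a _ (m V s1) (m V s2) (m V s3) =
    b _ (m V s1) (m V s2) (m V s3)) ->
  forall U u1 u2 u3, a U u1 u2 u3 = b U u1 u2 u3.
Proof.
move=> la lb e U u1 u2 u3; apply: sheaf_ext => x Ux.
have [V [s1 [s2 [s3 [W [h [k [Wx [E1 E2 E3]]]]]]]]] :=
  inverse_image_rep3 u1 u2 u3 Ux.
by exists W, h; split=> //; rewrite la lb E1 E2 E3 -la -lb e.
Qed.

Let add_nat (U V : opens Y) (h : V `<=` U) (s t : F U) :
  m_add (msh_str F V) (res h s) (res h t) = res h (m_add (msh_str F U) s t).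
Proof. by have [-> _] := msh_res F h. Qed.

Let opp_nat (U V : opens Y) (h : V `<=` U) (s t : F U) :
  m_opp (msh_str F V) (res h s) = res h (m_opp (msh_str F U) s).
Proof. by rewrite (semilinearN (msh_res F h)). Qed.

Let scale_nat (a : A) (U V : opens Y) (h : V `<=` U) (s t : F U) :
  m_scale (msh_str F V) a (res h s) = res h (m_scale (msh_str F U) a s).
Proof. by have [_ ->] := msh_res F h. Qed.

Let madd := extended_op add_nat.
(** Unary operations are extended as binary ones that ignore the second argument, and are then
    evaluated on the diagonal. *)
Let mopp U s := @extended_op (fun V s _ => m_opp (msh_str F V) s) opp_nat U s s.
Let mscale a U s :=
  @extended_op (fun V s _ => m_scale (msh_str F V) a s) (scale_nat a) U s s.
Let whole_sub (U : opens X) : U `<=` preopen f (whole Y).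
Proof. by []. Qed.
Let mzero (U : opens X) : M U :=
  res (@whole_sub U) (m (whole Y) (m_zero (msh_str F (whole Y)))).

Let madd_res (U V : opens X) (h : V `<=` U) s t :
  res h (madd s t) = madd (res h s) (res h t).
Proof. exact: extended_op_res. Qed.
Let mopp_res (U V : opens X) (h : V `<=` U) s :
  res h (mopp s) = mopp (res h s).
Proof. exact: extended_op_res. Qed.
Let mscale_res a (U V : opens X) (h : V `<=` U) s :
  res h (mscale a s) = mscale a (res h s).
Proof. exact: extended_op_res. Qed.
Let mzero_res (U V : opens X) (h : V `<=` U) : res h (mzero U) = mzero V.
Proof. exact: resM. Qed.

Let maddE (V : opens Y) (s t : F V) :
  madd (m V s) (m V t) = m V (m_add (msh_str F V) s t).
Proof. exact: extended_opE. Qed.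
Let moppE (V : opens Y) (s : F V) : mopp (m V s) = m V (m_opp (msh_str F V) s).
Proof. exact: extended_opE. Qed.
Let mscaleE a (V : opens Y) (s : F V) :
  mscale a (m V s) = m V (m_scale (msh_str F V) a s).
Proof. exact: extended_opE. Qed.
Let mzeroE (V : opens Y) : mzero (preopen f V) = m V (m_zero (msh_str F V)).
Proof.
have h : V `<=` whole Y by [].
rewrite -(semilinear0 (msh_res F h)) (sm_nat m h (preopenS (f := f) h)).
exact: res_irr.
Qed.

Let resE := (madd_res, mopp_res, mscale_res, mzero_res).
Let mE := (maddE, moppE, mscaleE, mzeroE).

Section Structure.
Context (U : opens X).

Let addA : associative (@madd U).
Proof.
apply: (local_op_eq (a := fun U s t u => madd s (madd t u))
  (b := fun U s t u => madd (madd s t) u)) =>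
    [? ? ? ? ? ?|? ? ? ? ? ?|V s1 s2 s3].
- by rewrite !resE.
- by rewrite !resE.
- by rewrite !mE m_addA.
Qed.

Let addC : commutative (@madd U).
Proof.
move=> s t; apply: (local_op_eq (a := fun U s t u => madd s t)
  (b := fun U s t u => madd t s) _ _ _ s t s) =>
    [? ? ? ? ? ?|? ? ? ? ? ?|V s1 s2 s3].
- by rewrite !resE.
- by rewrite !resE.
- by rewrite !mE m_addC.
Qed.

Let add0 : left_id (mzero U) (@madd U).
Proof.
move=> s; apply: (local_op_eq (a := fun U s t u => madd (mzero U) s)
  (b := fun U s t u => s) _ _ _ s s s) => [? ? ? ? ? ?|? ? ? ? ? ?|V s1 s2 s3].
- by rewrite !resE.
- by [].
- by rewrite !mE m_add0.
Qed.

Let addN : left_inverse (mzero U) (@mopp U) (@madd U).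
Proof.
move=> s; apply: (local_op_eq (a := fun U s t u => madd (mopp s) s)
  (b := fun U s t u => mzero U) _ _ _ s s s) =>
    [? ? ? ? ? ?|? ? ? ? ? ?|V s1 s2 s3].
- by rewrite !resE.
- by rewrite !resE.
- by rewrite !mE m_addN.
Qed.

Let scaleA a b s : mscale a (mscale b s) = @mscale (a * b)%R U s.
Proof.
apply: (local_op_eq (a := fun U s t u => mscale a (mscale b s))
  (b := fun U s t u => mscale (a * b)%R s) _ _ _ s s s) =>
    [? ? ? ? ? ?|? ? ? ? ? ?|V s1 s2 s3].
- by rewrite !resE.
- by rewrite !resE.
- by rewrite !mE m_scaleA.
Qed.

Let scale1 : left_id 1%R (fun a => @mscale a U).
Proof.
move=> s; apply: (local_op_eq (a := fun U s t u => mscale 1%R s)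
  (b := fun U s t u => s) _ _ _ s s s) => [? ? ? ? ? ?|? ? ? ? ? ?|V s1 s2 s3].
- by rewrite !resE.
- by [].
- by rewrite !mE [m_scale _ _ _]m_scale1.
Qed.

Let scaleDr : right_distributive (fun a => @mscale a U) (@madd U).
Proof.
move=> a s t; apply: (local_op_eq (a := fun U s t u => mscale a (madd s t))
  (b := fun U s t u => madd (mscale a s) (mscale a t)) _ _ _ s t s)
  => [? ? ? ? ? ?|? ? ? ? ? ?|V s1 s2 s3].
- by rewrite !resE.
- by rewrite !resE.
- by rewrite !mE m_scaleDr.
Qed.

Let scaleDl s a b : @mscale (a + b)%R U s = madd (mscale a s) (mscale b s).
Proof.
apply: (local_op_eq (a := fun U s t u => mscale (a + b)%R s)
  (b := fun U s t u => madd (mscale a s) (mscale b s)) _ _ _ s s s)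
  => [? ? ? ? ? ?|? ? ? ? ? ?|V s1 s2 s3].
- by rewrite !resE.
- by rewrite !resE.
- by rewrite !mE [m_scale _ _ _]m_scaleDl.
Qed.

Definition inverse_image_str : module_str (field_ring A) (M U) :=
  @ModuleStr A (field_ring A) (M U) (mzero U) (@mopp U) (@madd U)
    (fun a => @mscale a U) addA addC add0 addN scaleA scale1 scaleDr scaleDl.

End Structure.

Lemma inverse_image_res_linear (U V : opens X) (h : V `<=` U) :
  is_semilinear id (inverse_image_str U) (inverse_image_str V) (@res X M U V h).
Proof. by split=> [s t|a s] /=; rewrite resE. Qed.

Definition inverse_image_module : mod_sheaf A X :=
  ModSheaf inverse_image_res_linear.

Lemma inverse_image_map_linear (V : opens Y) :
  is_semilinear id (msh_str F V) (inverse_image_str (preopen f V)) (m V).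
Proof. by split=> [s t|a s] /=; rewrite mE. Qed.

Lemma inverse_image_map_nat (U V : opens Y) (h : V `<=` U) (s : F U) :
  m V (res h s) = res (preopenS (f := f) h) (m U s).
Proof. exact: sm_nat. Qed.

Definition inverse_image_unit :
    hom (F : ShA A Y) (direct_image A f inverse_image_module) :=
  @ModSheafHom A Y F (direct_image A f inverse_image_module) m
    inverse_image_map_nat inverse_image_map_linear.

Section Universal.
Context (N : ShA A X) (u : hom (F : ShA A Y) (direct_image A f N)).

Let u_nat (U V : opens Y) (h : V `<=` U) (l : preopen f V `<=` preopen f U)
  (s : F U) : msm_fun u (res h s) = @res X N _ _ l (msm_fun u s).
Proof. by rewrite msm_nat /=; exact: res_irr. Qed.

Let ext := extension (@resM X M) (sm_nat m) ii (g := id) (v := id)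
  (fun U t => iff_refl _) (N := N) (w := preopen f) (fun V t => iff_refl _)
    u_nat.

Let extP := extensionP (@resM X M) (sm_nat m) ii (g := id) (v := id)
  (fun U t => iff_refl _) (N := N) (w := preopen f) (fun V t => iff_refl _)
    u_nat.

Let ext_res (U V : opens X) (h : V `<=` U) (s : M U) :
  ext (res h s) = res h (ext s).
Proof. by have [/(_ _ _ h h s)] := extP. Qed.

Let extE (V : opens Y) (s : F V) : ext (m V s) = msm_fun u s.
Proof. by have [_ /(_ V s (fun _ => id))] := extP; rewrite res1. Qed.

Let ext_linear (U : opens X) :
  is_semilinear id (inverse_image_str U) (msh_str N U) (@ext U).
Proof.
split=> [s t|a s] /=; apply: sheaf_ext => x Ux.
- have [V [s1 [s2 [_ [W [h [k [Wx [E1 E2 _]]]]]]]]] :=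
    inverse_image_rep3 s t s Ux.
  exists W, h; split=> //.
  have [-> _] := msh_res N h; rewrite -!ext_res resE E1 E2 -resE mE !ext_res.
  rewrite !extE; have [-> _] := msm_linear u V.
  by have [-> _] := msh_res N k.
- have [V [s1 [_ [_ [W [h [k [Wx [E1 _ _]]]]]]]]] :=
    inverse_image_rep3 s s s Ux.
  exists W, h; split=> //.
  have [_ ->] := msh_res N h; rewrite -!ext_res resE E1 -resE mE !ext_res.
  rewrite !extE; have [_ ->] := msm_linear u V.
  by have [_ ->] := msh_res N k.
Qed.

(** The factorisation is the extension of [u] along the locally bijective [m]; linearity is checked
    on local representatives, and uniqueness is that of extensions. *)
Lemma inverse_image_universal :
  exists! l : hom (inverse_image_module : ShA A X) N,
    fmap (direct_image A f) l \oc inverse_image_unit = u.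
Proof.
exists (@ModSheafHom A X inverse_image_module N (@ext) ext_res ext_linear).
split=> [|l le]; first by apply: mod_sheaf_hom_eq => V s; exact: extE.
apply: mod_sheaf_hom_eq => U s.
have lP : is_extension (@res X M) m (v := id) (w := preopen f)
    (fun V s => msm_fun u s) (fun U s => msm_fun l s).
  split=> [{}U V h j {}s|V {}s j]; first by rewrite msm_nat; exact: res_irr.
  by rewrite -le /= res1.
exact: (extension_uniq ii (g := id) (v := id) (fun U t => iff_refl _)
  (N := N) (w := preopen f) (fun V t => iff_refl _) extP lP).
Qed.

End Universal.
End Inverse_image_module.

Section Inverse_image_functor.
Context (A : fieldType) (X Y : topologicalType) (f : continuousType X Y).

Let L0 (F : ShA A Y) : ShA A X :=
  inverse_image_module (germ_map_inverse_image f (F : mod_sheaf A Y)).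

Let eta (F : ShA A Y) : hom F (direct_image A f (L0 F)) :=
  inverse_image_unit (germ_map_inverse_image f (F : mod_sheaf A Y)).

Let uni (F : ShA A Y) (N : ShA A X) (u : hom F (direct_image A f N)) :
  exists! l : hom (L0 F) N, fmap (direct_image A f) l \oc eta F = u.
Proof. exact: inverse_image_universal. Qed.

Definition inverse_image : functor (ShA A Y) (ShA A X) := universal_functor uni.

Definition inverse_image_adjunction :
  adjunction inverse_image (direct_image A f) := universal_adjunction uni.

End Inverse_image_functor.

(** * The topos over the opposite of [J] *)

Section Maps_over_identity.
Context (T : topologicalType) (u : continuousType T T) (uE : u =1 id).
Implicit Types (F G K : sheaf T) (U V : opens T).

Lemma preopen_id' U : U `<=` preopen u U.
Proof. by move=> x Ux /=; rewrite uE. Qed.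

(** An arrow of the fibre takes values over the preimage under a map that is only pointwise the
    identity. This form removes the preimage, so that composition becomes composition of maps on
    sections. *)
Definition plain F G (m : sheaf_map u F G) U (s : F U) : G U :=
  res (@preopen_id' U) (m U s).

Lemma plain_nat F G (m : sheaf_map u F G) U V (h : V `<=` U) (s : F U) :
  plain m (res h s) = res h (plain m s).
Proof.
rewrite /plain (sm_nat m h (preopenS (f := u) h)) !res_res; exact: res_irr.
Qed.

Lemma plainE F G (m : sheaf_map u F G) U (s : F U) :
  m U s = res (preopen_id uE (U := U)) (plain m s).
Proof. by rewrite /plain res_res res1. Qed.

Lemma plain_inj F G (m n : sheaf_map u F G) :
  (forall U s, plain m s = plain n s :> G U) -> m = n.
Proof. by move=> e; apply: sheaf_map_eq => U s; rewrite !plainE e. Qed.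

Section Of_plain.
Context F G (n : forall U, F U -> G U).
Context (n_nat : forall U V (h : V `<=` U) (s : F U),
  n (res h s) = res h (n s)).

Lemma of_plain_nat U V (h : V `<=` U) (k : preopen u V `<=` preopen u U)
    (s : F U) :
  res (preopen_id uE (U := V)) (n (res h s)) =
  res k (res (preopen_id uE (U := U)) (n s)).
Proof. by rewrite n_nat !res_res; exact: res_irr. Qed.

Definition of_plain : sheaf_map u F G :=
  @SheafMap T T u F G (fun U s => res (preopen_id uE (U := U)) (n s))
    of_plain_nat.

Lemma of_plainE U (s : F U) : plain of_plain s = n s.
Proof. by rewrite /plain /= res_res res1. Qed.

End Of_plain.

Lemma represented_glue U V (D : opens T -> Prop) :
  (forall W, D W -> W `<=` V) ->
  (forall x, oset V x -> exists W, D W /\ oset W x) ->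
  forall t : (forall W, D W -> W `<=` U),
  (forall (W W' O : opens T) (DW : D W) (DW' : D W') (h : O `<=` W)
     (h' : O `<=` W'), subset_trans h (t W DW) = subset_trans h' (t W' DW')) ->
  exists! s : V `<=` U, forall W (DW : D W) (h : W `<=` V),
    subset_trans h s = t W DW.
Proof.
move=> DV cov t _.
have s : V `<=` U by move=> x /cov[W [DW Wx]]; exact: (t W DW).
exists s; split=> [W DW h|s' _]; exact: Prop_irrelevance.
Qed.

(** The sections over [V] are the proofs that [V] lies in [U]: at most one by proof irrelevance,
    which also settles the gluing axiom. It serves to turn statements about arrows into statements
    about sections. *)
Definition represented U : sheaf T :=
  @Sheaf T (fun V => V `<=` U : Prop)
    (fun V W (h : W `<=` V) s => subset_trans h s)
    (fun V h s => Prop_irrelevance _ _)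
    (fun V W O h k l s => Prop_irrelevance _ _) (@represented_glue U).

Definition yoneda F U (s : F U) : sheaf_map u (represented U) F :=
  @of_plain (represented U) F (fun V (i : V `<=` U) => res i s)
    (fun V W h i => esym (resM i h (subset_trans h i) s)).

Lemma yonedaE F U (s : F U) V (i : V `<=` U) :
  plain (yoneda s) (i : represented U V) = res i s.
Proof. exact: of_plainE. Qed.

End Maps_over_identity.

Section Open_site.
Context (T : topologicalType).

Definition open_covering (U : opens T)
  (C : forall V : opens T, (V `<=` U : Prop) -> Prop) : Prop :=
  forall x, oset U x -> exists (V : opens T) (h : V `<=` U), C V h /\ oset V x.

Definition open_site : site.
Proof.
refine (@Site (opens T) (fun V U => V `<=` U : Prop) (fun U => fun _ => id)
  (fun U V W h k => subset_trans k h) (fun U V h => Prop_irrelevance _ _)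
  (fun U V h => Prop_irrelevance _ _)
    (fun U V W O f g h => Prop_irrelevance _ _)
  (fun U C => open_covering C /\ forall (V W : opens T) (f : V `<=` U)
    (g : W `<=` V),
     C V f -> C W (subset_trans g f)) _ _ _ _).
- by move=> U C [_ sC].
- by move=> U; split=> // x Ux; exists U, (fun _ => id).
- move=> U C V f [covC sC]; split=> [x Vx|W O g h].
    have [W [h [CW Wx]]] := covC x (f x Vx).
    exists (meet V W), (@meetl _ V W); split; last by split.
    have -> : subset_trans (@meetl _ V W) f = subset_trans (@meetr _ V W) h.
      exact: Prop_irrelevance.
    exact: sC.
  move=> CW; have -> : subset_trans (subset_trans h g) f =
    subset_trans h (subset_trans g f) by exact: Prop_irrelevance.
  exact: sC.
- move=> U C D [covC sC] sD loc; split=> // x Ux.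
  have [V [h [CV Vx]]] := covC x Ux.
  have [/(_ x Vx)[W [k [DW Wx]]] _] := loc V h CV.
  by exists W, (subset_trans k h).
Defined.

Section Sheaf_to_site.
Context (F : sheaf T).

Lemma to_site_glue (U : opens T)
    (C : forall V : opens T, (V `<=` U : Prop) -> Prop) :
  @s_cov open_site U C ->
  forall t : (forall (V : opens T) (f : V `<=` U), C V f -> F V),
  (forall (V W : opens T) (f : V `<=` U) (g : W `<=` V) (Cf : C V f)
     (Cfg : C W (subset_trans g f)),
     res g (t V f Cf) = t W (subset_trans g f) Cfg) ->
  exists! s : F U, forall (V : opens T) (f : V `<=` U) (Cf : C V f),
    res f s = t V f Cf.
Proof.
move=> [cov sC] t agr.
have irr (V : opens T) (f f' : V `<=` U) Cf Cf' : t V f Cf = t V f' Cf'.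
  have e : f = f' by exact: Prop_irrelevance.
  by subst f'; congr t; exact: Prop_irrelevance.
have [||s sP] := @sheaf_glue T F U {V : opens T & {f : V `<=` U | C V f}}
  (fun i => projT1 i) (fun i => sval (projT2 i))
  (fun i => t (projT1 i) (sval (projT2 i)) (proj2_sig (projT2 i))) _.
- move=> x /cov[V [f [Cf Vx]]].
  by exists (existT _ V (exist _ f Cf)).
- move=> [V [f Cf]] [V' [f' Cf']] W h k /=.
  rewrite (agr _ _ _ _ _ (sC _ _ _ h Cf)) (agr _ _ _ _ _ (sC _ _ _ k Cf')).
  exact: irr.
- exists s; split=> [V f Cf|s' s'P];
    first exact: (sP (existT _ V (exist _ f Cf))).
  apply: sheaf_ext => x /cov[V [f [Cf Vx]]]; exists V, f; split=> //.
  by rewrite s'P; exact: (sP (existT _ V (exist _ f Cf))).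
Qed.

Definition to_site : site_sheaf open_site :=
  @SiteSheaf open_site (fun U => F U) (fun U V h s => res h s)
    (fun U s => res1 _ s) (fun U V W f g s => esym (resM g f _ s))
    to_site_glue.

End Sheaf_to_site.

Section Site_to_sheaf.
Context (G : site_sheaf open_site).

Let gres (U V : opens T) (h : V `<=` U) (s : ss_ob G U) : ss_ob G V :=
  @ss_res _ G V U h s.

Lemma of_site_res1 (U : opens T) (h : U `<=` U) s : gres h s = s.
Proof.
rewrite /gres (_ : h = fun _ => id); first exact: (@ss_res1 _ G U s).
exact: Prop_irrelevance.
Qed.

Lemma of_site_resM (U V W : opens T) (h : V `<=` U) (k : W `<=` V)
    (l : W `<=` U) s : gres k (gres h s) = gres l s.
Proof.
rewrite /gres (_ : l = subset_trans k h); last exact: Prop_irrelevance.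
exact/esym/(@ss_resM _ G W V U k h s).
Qed.

Lemma of_site_glue (U : opens T) (D : opens T -> Prop) :
  (forall V, D V -> V `<=` U) ->
  (forall x, oset U x -> exists V, D V /\ oset V x) ->
  forall t : (forall V, D V -> ss_ob G V),
  (forall (V V' W : opens T) (DV : D V) (DV' : D V') (h : W `<=` V)
      (h' : W `<=` V'), gres h (t V DV) = gres h' (t V' DV')) ->
  exists! s : ss_ob G U, forall V (DV : D V) (h : V `<=` U), gres h s = t V DV.
Proof.
move=> DU cov t agr.
(* The sieve generated by the cover. A section on one of its members is the restriction from a
   chosen member of [D], and the agreement hypothesis makes the choice irrelevant. *)
pose C (V : opens T) (_ : V `<=` U : Prop) := exists V', D V' /\ V `<=` V'.
have covC : @s_cov open_site U C.
  split=> [x /cov[V [DV Vx]]|V W f g [V' [DV' VV']]].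
    by exists V, (DU V DV); split=> //; exists V; split.
  by exists V'; split=> //; exact: subset_trans VV'.
pose w (V : opens T) (f : V `<=` U) (Cf : C V f) := cid Cf.
pose t' (V : opens T) f (Cf : C V f) : ss_ob G V :=
  gres (proj2 (projT2 (w V f Cf))) (t _ (proj1 (projT2 (w V f Cf)))).
have agr' (V W : opens T) (f : V `<=` U) (g : W `<=` V) (Cf : C V f)
    (Cfg : C W (subset_trans g f)) : gres g (t' V f Cf) = t' W _ Cfg.
  rewrite /t' (of_site_resM _ _ (subset_trans g (proj2 (projT2 (w V f Cf))))).
  exact: agr.
have [s [sP sU]] := @ss_glue _ G U C covC t' agr'.
exists s; split=> [V DV h|s' s'P].
  have Ch : C V h by exists V; split.
  apply: etrans (sP V h Ch) _; rewrite /t' (agr _ _ _ _ DV _ (fun _ => id)).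
  exact: of_site_res1.
apply: sU => V f Cf; rewrite /t' -(s'P _ _ (DU _ (proj1 (projT2 (w V f Cf))))).
exact/esym/of_site_resM.
Qed.

Definition of_site : sheaf T :=
  @Sheaf T (fun U => ss_ob G U) gres of_site_res1 of_site_resM of_site_glue.

End Site_to_sheaf.

End Open_site.

Section Topos.
Context (A : fieldType) (J : category) (X : functor J (Top A)).

Let E (x : J) : transition X (idm x) =1 id := transition1 (erefl (idm x)).

Section Fibre.
Context (x : op J).
Let T : topologicalType := X x.

Definition to_site_map (F G : fibre (Sh_top X) x) (m : hom F G) :
    site_sheaf_hom (to_site (F : sheaf T)) (to_site (G : sheaf T)) :=
  @SiteSheafHom (open_site T) (to_site (F : sheaf T)) (to_site (G : sheaf T))
    (fun U s => plain (@E x) m s) (fun U V h s => plain_nat (@E x) m h s).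

Lemma plain_comp (F G K : fibre (Sh_top X) x) (m : hom F G) (n : hom G K)
    (U : opens T) (s : (F : sheaf T) U) :
  plain (@E x) (n \oc m) s = plain (@E x) n (plain (@E x) m s).
Proof.
rewrite /plain /= (sm_nat n _ (preopenS (@preopen_id' _ _ (@E x) U))) !res_res.
exact: res_irr.
Qed.

Definition to_site_functor :
  functor (fibre (Sh_top X) x) (site_topos (open_site T)).
Proof.
refine (@Functor (fibre (Sh_top X) x) (site_topos (open_site T))
  (fun F => to_site (F : sheaf T)) to_site_map _ _).
- by move=> F; apply: site_sheaf_hom_eq => U s;
    rewrite /= /plain /= res_res res1.
- by move=> F G K m n; apply: site_sheaf_hom_eq => U s; exact: plain_comp.
Defined.

Lemma fibre_topos : is_topos (fibre (Sh_top X) x).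
Proof.
exists (open_site T), to_site_functor; split=> [F G|G].
  exists (fun n :
      site_sheaf_hom (to_site (F : sheaf T)) (to_site (G : sheaf T)) =>
    of_plain (@E x) (n := fun U s => n U s) (fun U V h s => ssh_nat n h s) :
      hom F G).
    by move=> m; apply: plain_inj => U s; exact: of_plainE.
  by move=> n; apply: site_sheaf_hom_eq => U s; exact: of_plainE.
exists (of_site G : fibre (Sh_top X) x).
exists (@SiteSheafHom (open_site T) (to_site (of_site G)) G (fun U s => s)
  (fun U V h s => erefl)).
exists (@SiteSheafHom (open_site T) G (to_site (of_site G)) (fun U s => s)
  (fun U V h s => erefl)).
by split; apply: site_sheaf_hom_eq.
Qed.

End Fibre.

Section Arrow.
Context (x y : op J) (f : hom x y).
Let p : continuousType (X y) (X x) := @transition A J X y x f.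

(** Cocartesian arrows are tested against arrows over every composite [h], not only over [f].
    Extension is applied along the map of [g]; the map of [h] is only pointwise a composite, as the
    general form of [extension] allows. *)
Lemma inverse_image_cocartesian (F : sheaf (X x)) (G : sheaf (X y))
    (m : sheaf_map p F G) : is_inverse_image m ->
  @is_cocartesian _ (Sh_top X) x y f F G m.
Proof.
move=> ii z g h e K k.
pose q : continuousType (X z) (X y) := @transition A J X z y g.
pose r : continuousType (X z) (X x) := @transition A J X z x h.
have rE t : r t = p (q t) by exact: (@transitionM A J X z y x g f h e t).
have vP (U : opens (X y)) t : oset (preopen q U) t <-> oset U (q t) by [].
have wP (V : opens (X x)) t : oset (preopen r V) t <-> oset V (p (q t)).
  by rewrite /= rE.
have [l1 l2] := extensionP (@resM _ G) (sm_nat m) ii vP wP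
  (sm_nat (k : sheaf_map r F K)).
set l := extension _ _ _ _ _ _ in l1 l2.
exists (@SheafMap _ _ q G K l l1); split=> [|l' l'E].
  apply: sheaf_map_eq => V s /=.
  have j : preopen q (preopen p V) `<=` preopen r V by move=> t /wP.
  by rewrite (l2 V s j) res_res res1.
apply: sheaf_map_eq => U s; apply: (extension_uniq ii vP wP (conj l1 l2)).
split=> [{}U V i j {}s|V {}s j]; first exact: (sm_nat (l' : sheaf_map q G K)).
by rewrite -l'E /= res_res res1.
Qed.

(** Comparison with the germ sheaf, which is another cocartesian image of [F]: [m] inherits
    injectivity on germs through [l'], and surjectivity by returning along [l]. *)
Lemma cocartesian_inverse_image (F : sheaf (X x)) (G : sheaf (X y))
    (m : sheaf_map p F G) : @is_cocartesian _ (Sh_top X) x y f F G m ->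
  is_inverse_image m.
Proof.
move=> cm; pose m0 := germ_map p F.
have i0 := germ_map_inverse_image p F.
have c0 := inverse_image_cocartesian i0.
have [l [lE _]] := c0 _ (idm y) f (comp1m f) G m.
have [l' [l'E _]] := cm _ (idm y) f (comp1m f) _ m0.
have lP V s : plain (@E y) l (m0 V s) = m V s.
  rewrite -[in RHS]lE /plain /=; exact: res_irr.
have l'P V s : plain (@E y) l' (m V s) = m0 V s.
  rewrite -[in RHS]l'E /plain /=. exact: (@res_irr _ (germ_sheaf p F)).
pose G0 : fibre (Sh_top X) y := germ_sheaf p F.
pose G1 : fibre (Sh_top X) y := G.
(* Both the composite and the identity factor [m] through itself, so they agree by uniqueness. *)
have ll' : (l : hom G0 G1) \oc (l' : hom G1 G0) = idm G1.
  have [z [_ zu]] := cm _ (idm y) f (comp1m f) G m.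
  rewrite -(zu (idm G1)); last exact: dcomp1m.
  apply/esym/zu.
  by rewrite -(dcompA (comp1m f) (comp1m f)) l'E lE.
split=> [V s t t0 W h Wt e|U u t Ut].
  apply: (lb_inj i0 (h := h) Wt).
  by rewrite -!l'P -!plain_nat e.
have [V [s [W [h [k [Wt e]]]]]] := lb_surj i0 (plain (@E y) l' u) Ut.
exists V, s, W, h, k; split=> //.
have := congr1 (plain (@E y) l (U := W)) e.
rewrite (plain_nat (@E y) l h) (plain_nat (@E y) l k) lP => <-.
rewrite -(@plain_comp y G1 G0 G1 l' l) ll' /plain /= !res_res; exact: res_irr.
Qed.

End Arrow.

(** Cartesian lifts are direct images, with the identity on sections as the structure arrow;
    cocartesian lifts are germ sheaves. *)
Lemma Sh_top_bifibration : is_bifibration (Sh_top X).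
Proof.
move=> x y f; pose p : continuousType (X y) (X x) := @transition A J X y x f.
split=> [G|F].
- exists (direct_image_sheaf p G).
  exists (@SheafMap _ _ p (direct_image_sheaf p G) G (fun U s => s)
    (fun U V h k s => res_irr _ _ _)).
  move=> w g h e K k.
  pose q : continuousType (X x) (X w) := @transition A J X x w g.
  pose r : continuousType (X y) (X w) := @transition A J X y w h.
  have rE t : r t = q (p t) by exact: (@transitionM A J X y x w f g h e t).
  have j (U : opens (X w)) : preopen p (preopen q U) `<=` preopen r U.
    by move=> t; rewrite /= rE.
  have j' (U : opens (X w)) : preopen r U `<=` preopen p (preopen q U).
    by move=> t; rewrite /= rE.
  have n (U V : opens (X w)) (i : V `<=` U) (l : preopen q V `<=` preopen q U)
      (s : (K : sheaf _) U) :
    res (j V) ((k : sheaf_map r K G) V (res i s)) =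
    @res _ (direct_image_sheaf p G) _ _ l
      (res (j U) ((k : sheaf_map r K G) U s)).
    rewrite (sm_nat (k : sheaf_map r K G) i (preopenS (f := r) i)) /= !res_res.
    exact: res_irr.
  exists (@SheafMap _ _ q K (direct_image_sheaf p G)
    (fun U s => res (j U) ((k : sheaf_map r K G) U s)) n).
  split=> [|l lE]; first by apply: sheaf_map_eq => U s;
    rewrite /= !res_res res1.
  apply: sheaf_map_eq => U s; rewrite /= -lE /= !res_res; exact: res1.
- exists (germ_sheaf p F), (germ_map p F).
  exact: inverse_image_cocartesian (germ_map_inverse_image p F).
Qed.

End Topos.

(** * Left exactness of inverse images *)

Section Left_exactness.
Context (A : fieldType) (J : category) (X : functor J (Top A)).

Let E (x : J) : transition X (idm x) =1 id := transition1 (erefl (idm x)).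

Section Fibre.
Context (x : op J).

Lemma fibre_ext (F G : fibre (Sh_top X) x) (m n : hom F G) :
  (forall (U : opens (X x)) (s : (F : sheaf (X x)) U),
    plain (@E x) m s = plain (@E x) n s) -> m = n.
Proof. by move=> e; apply: (plain_inj e). Qed.

(** A section over [U] is the same as an arrow from the sheaf represented by [U], of which there is
    exactly one. *)
Lemma terminal_sections (F : fibre (Sh_top X) x) : is_terminal F ->
  forall U : opens (X x), exists s : (F : sheaf (X x)) U, forall t, t = s.
Proof.
move=> tF U; have [m [_ mu]] := tF (represented U : fibre (Sh_top X) x).
exists (plain (@E x) m ((fun _ => id) : represented U U)) => t.
rewrite (mu (yoneda (@E x) t) I) yonedaE; exact/esym/res1.
Qed.

Lemma sections_terminal (F : fibre (Sh_top X) x) :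
  (forall U : opens (X x), exists s : (F : sheaf (X x)) U, forall t, t = s) ->
  is_terminal F.
Proof.
move=> sF G; pose s U := sval (cid (sF U)).
have sP U t : t = s U by exact: (svalP (cid (sF U)) t).
have n (U V : opens (X x)) (h : V `<=` U) (t : (G : sheaf (X x)) U) :
  s V = res h (s U) by rewrite [RHS]sP.
exists (of_plain (@E x) (n := fun U _ => s U) n); split=> // m _.
by apply: fibre_ext => U t; rewrite of_plainE [RHS]sP.
Qed.

Section Square.
Context (a b c d : fibre (Sh_top X) x) (u : hom a b) (v : hom a c)
  (p : hom b d) (q : hom c d).

(** Limits of sheaves are computed on sections; this form makes transfer along inverse images a
    local matter. *)
Definition is_sectionwise_pullback : Prop :=
  [/\ forall (U : opens (X x)) (s : (a : sheaf (X x)) U),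
        plain (@E x) p (plain (@E x) u s) = plain (@E x) q (plain (@E x) v s),
      forall (U : opens (X x)) (s : (b : sheaf (X x)) U)
          (t : (c : sheaf (X x)) U),
        plain (@E x) p s = plain (@E x) q t ->
        exists r : (a : sheaf (X x)) U,
          plain (@E x) u r = s /\ plain (@E x) v r = t &
      forall (U : opens (X x)) (r r' : (a : sheaf (X x)) U),
        plain (@E x) u r = plain (@E x) u r' ->
        plain (@E x) v r = plain (@E x) v r' -> r = r'].

Lemma pullback_sectionwise : is_pullback u v p q -> is_sectionwise_pullback.
Proof.
move=> pb; have [e _] := pb; split=> [U s|U s t st|U r r' e1 e2].
- by rewrite -!plain_comp e.
- have [|w [w1 w2]] := pullback_lift pb
    (t := (represented U : fibre (Sh_top X) x))
    (u := yoneda (@E x) s) (v := yoneda (@E x) t).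
    apply: fibre_ext => V i; rewrite !plain_comp !yonedaE !plain_nat.
    by rewrite st.
  exists (plain (@E x) w ((fun _ => id) : represented U U)).
  by rewrite -!plain_comp w1 w2 !yonedaE !res1.
- have: yoneda (@E x) r = yoneda (@E x) r'
      :> @hom (fibre (Sh_top X) x) (represented U) a.
    apply: (pullback_ext pb); apply: fibre_ext => V i;
      rewrite !plain_comp !yonedaE !plain_nat; by rewrite (e1, e2).
  move=> /(congr1 (fun m => plain (@E x) m ((fun _ => id) : represented U U))).
  by rewrite !yonedaE !res1.
Qed.

Lemma sectionwise_pullback : is_sectionwise_pullback -> is_pullback u v p q.
Proof.
move=> [e ex un]; apply: pullback_build.
- by apply: fibre_ext => U s; rewrite !plain_comp.
- move=> t m n mn.
  have ex' (U : opens (X x)) (s : (t : sheaf (X x)) U) :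
      exists r : (a : sheaf (X x)) U,
        plain (@E x) u r = plain (@E x) m s /\
        plain (@E x) v r = plain (@E x) n s.
    by apply: ex; rewrite -!plain_comp mn.
  pose w U s := sval (cid (ex' U s)).
  have wP U s : plain (@E x) u (w U s) = plain (@E x) m s /\
      plain (@E x) v (w U s) = plain (@E x) n s by
        exact: (svalP (cid (ex' U s))).
  have w_nat (U V : opens (X x)) (h : V `<=` U) (s : (t : sheaf (X x)) U) :
      w V (res h s) = res h (w U s).
    apply: un; rewrite (plain_nat (@E x)).
      by rewrite (proj1 (wP _ _)) (proj1 (wP _ _)) (plain_nat (@E x)).
    by rewrite (proj2 (wP _ _)) (proj2 (wP _ _)) (plain_nat (@E x)).
  exists (of_plain (@E x) w_nat).
  split; apply: fibre_ext => U s; rewrite plain_comp of_plainE;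
    by have [? ?] := wP U s.
- move=> t w w' e1 e2; apply: fibre_ext => U s.
  by apply: un; rewrite -!plain_comp ?e1 ?e2.
Qed.

End Square.
End Fibre.

Section Arrow.
Context (x y : op J) (f : hom x y).
Let p0 : continuousType (X y) (X x) := @transition A J X y x f.

(** Each section of [b] comes locally from a section of [a], and those are all restrictions of the
    only global one. *)
Lemma inverse_image_terminal (a : fibre (Sh_top X) x) (b : fibre (Sh_top X) y)
    (m : @dhom _ (Sh_top X) x y f a b) :
  is_cocartesian m -> is_terminal a -> is_terminal b.
Proof.
move=> /cocartesian_inverse_image ii /terminal_sections ta.
apply: sections_terminal => U.
have [s0 _] := ta (whole (X x)).
have l : U `<=` preopen p0 (whole (X x)) by [].
exists (res l ((m : sheaf_map p0 _ _) _ s0)) => u; apply: sheaf_ext => z Uz.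
have [V [s [W [h [k [Wz e]]]]]] := lb_surj ii u Uz.
exists W, h; split=> //; rewrite e res_res.
have [t tP] := ta V; have i : V `<=` whole (X x) by [].
have -> : s = res i s0 by rewrite [LHS]tP [RHS]tP.
rewrite (sm_nat (m : sheaf_map p0 _ _) i (preopenS i)) res_res.
exact: res_irr.
Qed.

Lemma commute_plain (a b : fibre (Sh_top X) x) (a' b' : fibre (Sh_top X) y)
    (u : hom a b) (u' : hom a' b') (ka : @dhom _ (Sh_top X) x y f a a')
    (kb : @dhom _ (Sh_top X) x y f b b') :
  dcomp (comp1m f) u' ka = dcomp (compm1 f) kb u ->
  forall (V : opens (X x)) (s : (a : sheaf (X x)) V),
    plain (@E y) u' ((ka : sheaf_map p0 _ _) V s) =
    (kb : sheaf_map p0 _ _) V (plain (@E x) u s).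
Proof.
move=> e V s; rewrite /plain.
have := congr1 (fun m : sheaf_map p0 (a : sheaf (X x)) (b' : sheaf (X y)) =>
  m V s) e.
rewrite /= (sm_nat (kb : sheaf_map p0 _ _) _
  (preopenS (@preopen_id' _ _ (@E x) V))).
move=> e'; apply: etrans (etrans e' _); exact: res_irr.
Qed.

Section Pullback.
Context (a b c d : fibre (Sh_top X) x)
  (u : hom a b) (v : hom a c) (p : hom b d) (q : hom c d)
  (a' b' c' d' : fibre (Sh_top X) y)
  (u' : hom a' b') (v' : hom a' c') (p' : hom b' d') (q' : hom c' d')
  (ka : @dhom _ (Sh_top X) x y f a a') (kb : @dhom _ (Sh_top X) x y f b b')
  (kc : @dhom _ (Sh_top X) x y f c c') (kd : @dhom _ (Sh_top X) x y f d d')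
  (ca : is_cocartesian ka) (cb : is_cocartesian kb)
  (cc : is_cocartesian kc) (cd : is_cocartesian kd)
  (eu : dcomp (comp1m f) u' ka = dcomp (compm1 f) kb u)
  (ev : dcomp (comp1m f) v' ka = dcomp (compm1 f) kc v)
  (ep : dcomp (comp1m f) p' kb = dcomp (compm1 f) kd p)
  (eq : dcomp (comp1m f) q' kc = dcomp (compm1 f) kd q).

Let ia := cocartesian_inverse_image ca.
Let ib := cocartesian_inverse_image cb.
Let ic := cocartesian_inverse_image cc.
Let id' := cocartesian_inverse_image cd.

(** The data are represented locally by sections over X_x, where the given pullback applies;
    equalities descend to X_x after shrinking, by injectivity on germs, and the solutions are pushed
    forward and glued. *)
Lemma inverse_image_pullback : is_pullback u v p q -> is_pullback u' v' p' q'.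
Proof.
move=> /pullback_sectionwise[comm ex un]; apply: sectionwise_pullback.
(* Joint injectivity comes first, since it makes the local solutions found below agree on
   overlaps. *)
have un' (U : opens (X y)) (r r' : (a' : sheaf (X y)) U) :
    plain (@E y) u' r = plain (@E y) u' r' ->
    plain (@E y) v' r = plain (@E y) v' r' -> r = r'.
  move=> e1 e2; apply: sheaf_ext => z Uz.
  have [V1 [s1 [W1 [h1 [k1 [W1z E1]]]]]] := lb_surj ia r Uz.
  have [V2 [s2 [W2 [h2 [k2 [W2z E2]]]]]] := lb_surj ia r' Uz.
  pose V := meet V1 V2; pose W := meet W1 W2.
  pose l1 := @meetl _ V1 V2; pose l2 := @meetr _ V1 V2.
  have k : W `<=` preopen p0 V by move=> t [/k1 i1 /k2 i2]; split.
  have h : W `<=` U by move=> t [/h1].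
  have F1 : res h r = res k ((ka : sheaf_map p0 _ _) _ (res l1 s1)).
    rewrite (sm_nat (ka : sheaf_map p0 _ _) l1 (preopenS (f := p0) l1)) res_res.
    by rewrite -(resM h1 (@meetl _ W1 W2)) E1 res_res; exact: res_irr.
  have F2 : res h r' = res k ((ka : sheaf_map p0 _ _) _ (res l2 s2)).
    rewrite (sm_nat (ka : sheaf_map p0 _ _) l2 (preopenS (f := p0) l2)) res_res.
    by rewrite -(resM h2 (@meetr _ W1 W2)) E2 res_res; exact: res_irr.
  have Wz : oset W z by split.
  have G1 := congr1 (res h) e1; rewrite -!plain_nat F1 F2 !plain_nat in G1.
  have G2 := congr1 (res h) e2; rewrite -!plain_nat F1 F2 !plain_nat in G2.
  rewrite !(commute_plain eu) in G1; rewrite !(commute_plain ev) in G2.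
  (* The equalities in [b'] and [c'] hold already in [b] and [c] on smaller neighbourhoods, whose
     intersection serves for both. *)
  have [V3 [i3 [V3z H3]]] := lb_inj ib Wz G1.
  have [V4 [i4 [V4z H4]]] := lb_inj ic Wz G2.
  pose V5 := meet V3 V4.
  have i : V5 `<=` V by move=> t [/i3].
  have e5 : res i (res l1 s1) = res i (res l2 s2).
    apply: un; rewrite !(plain_nat (@E x) _ i).
      by rewrite -!(resM i3 (@meetl _ V3 V4) i) H3.
    by rewrite -!(resM i4 (@meetr _ V3 V4) i) H4.
  pose O := meet W (preopen p0 V5).
  exists O, (fun t i => h t (meetl i)); split; first by do 2!split.
  have j : O `<=` preopen p0 V5 by move=> t [].
  rewrite -!(resM h (@meetl _ W (preopen p0 V5))) F1 F2 !res_res.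
  have := congr1 (fun t => res j ((ka : sheaf_map p0 _ _) _ t)) e5.
  rewrite !(sm_nat (ka : sheaf_map p0 _ _) i (preopenS (f := p0) i)) !res_res.
  move=> e6; apply: etrans (etrans e6 _); exact: res_irr.
split=> //.
- move=> U s; apply: sheaf_ext => z Uz.
  have [V [t [W [h [k [Wz e]]]]]] := lb_surj ia s Uz.
  exists W, h; split=> //; rewrite -!plain_nat e.
  rewrite (plain_nat (@E y) u' k) (plain_nat (@E y) v' k).
  rewrite (plain_nat (@E y) p' k) (plain_nat (@E y) q' k).
  rewrite (commute_plain eu) (commute_plain ev).
  by rewrite (commute_plain ep) (commute_plain eq) comm.
- move=> U s t st.
  (* The cover is indexed by all local solutions, so no solution has to be chosen at each point. *)
  pose I := {W : opens (X y) & {r : (a' : sheaf (X y)) W | W `<=` U /\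
    forall h : W `<=` U,
      plain (@E y) u' r = res h s /\ plain (@E y) v' r = res h t}}.
  pose WU (i : I) : projT1 i `<=` U := proj1 (proj2_sig (projT2 i)).
  have rP (i : I) : plain (@E y) u' (sval (projT2 i)) = res (WU i) s /\
      plain (@E y) v' (sval (projT2 i)) = res (WU i) t.
    exact: (proj2 (proj2_sig (projT2 i)) (WU i)).
  have cov z : oset U z -> exists i : I, oset (projT1 i) z.
    move=> Uz.
    have [V1 [s1 [W1 [h1 [k1 [W1z E1]]]]]] := lb_surj ib s Uz.
    have [V2 [t2 [W2 [h2 [k2 [W2z E2]]]]]] := lb_surj ic t Uz.
    pose V := meet V1 V2; pose W := meet W1 W2.
    pose l1 := @meetl _ V1 V2; pose l2 := @meetr _ V1 V2.
    have k : W `<=` preopen p0 V by move=> y0 [/k1 i1 /k2 i2]; split.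
    have h : W `<=` U by move=> y0 [/h1].
    have F1 : res h s = res k ((kb : sheaf_map p0 _ _) _ (res l1 s1)).
      rewrite (sm_nat (kb : sheaf_map p0 _ _) l1 (preopenS (f := p0) l1))
        res_res.
      by rewrite -(resM h1 (@meetl _ W1 W2)) E1 res_res; exact: res_irr.
    have F2 : res h t = res k ((kc : sheaf_map p0 _ _) _ (res l2 t2)).
      rewrite (sm_nat (kc : sheaf_map p0 _ _) l2 (preopenS (f := p0) l2))
        res_res.
      by rewrite -(resM h2 (@meetr _ W1 W2)) E2 res_res; exact: res_irr.
    have Wz : oset W z by split.
    have G := congr1 (res h) st; rewrite -!plain_nat F1 F2 !plain_nat in G.
    rewrite (commute_plain ep) (commute_plain eq) in G.
    have [V3 [i3 [V3z H3]]] := lb_inj id' Wz G.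
    rewrite -!(plain_nat (@E x)) in H3.
    have [r [r1 r2]] := ex _ _ _ H3.
    pose O := meet W (preopen p0 V3).
    have j : O `<=` preopen p0 V3 by move=> y0 [].
    have OU : O `<=` U by move=> y0 [/h].
    have rP0 (h0 : O `<=` U) :
        plain (@E y) u' (res j ((ka : sheaf_map p0 _ _) _ r)) = res h0 s /\
        plain (@E y) v' (res j ((ka : sheaf_map p0 _ _) _ r)) = res h0 t.
      rewrite !(plain_nat (@E y)) (commute_plain eu) (commute_plain ev) r1 r2.
      rewrite (sm_nat (kb : sheaf_map p0 _ _) i3 (preopenS (f := p0) i3)).
      rewrite (sm_nat (kc : sheaf_map p0 _ _) i3 (preopenS (f := p0) i3))
        !res_res.
      rewrite -(resM h (@meetl _ W (preopen p0 V3)) h0 s) F1.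
      rewrite -(resM h (@meetl _ W (preopen p0 V3)) h0 t) F2 !res_res.
      by split; exact: res_irr.
    by exists (existT _ O (exist _ _ (conj OU rP0))); split.
  have [//|r rE] := sheaf_glue WU (t := fun i => sval (projT2 i)) cov.
    move=> i j V h k; apply: un'; rewrite !(plain_nat (@E y)).
      by rewrite (proj1 (rP i)) (proj1 (rP j)) !res_res; exact: res_irr.
    by rewrite (proj2 (rP i)) (proj2 (rP j)) !res_res; exact: res_irr.
  exists r; split; apply: sheaf_ext => z /cov[i iz]; exists (projT1 i), (WU i);
    split=> //; rewrite -(plain_nat (@E y)) rE; by have [] := rP i.
Qed.

End Pullback.
End Arrow.

Lemma Sh_top_cobase_change_lex : cobase_change_lex (Sh_top X).
Proof.
move=> x y f; split=> [a b m|]; first exact: inverse_image_terminal.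
move=> a b c d u v p q a' b' c' d' u' v' p' q' ka kb kc kd ca cb cc cd eu ev ep
  eq.
exact: (inverse_image_pullback ca cb cc cd eu ev ep eq).
Qed.

Lemma Sh_top_topos : is_topos_over (Sh_top X).
Proof.
split; [exact: fibre_topos|exact: Sh_top_bifibration|].
exact: Sh_top_cobase_change_lex.
Qed.

End Left_exactness.

(** * Modules over the constant ring *)

Section Module_str_eq.
Context (R : Type) (rs : ring_str R) (M : Type).

(** Zero and opposites are determined by the addition, through cancellation. *)
Lemma module_str_eq (s t : module_str rs M) :
  (forall x y, m_add s x y = m_add t x y) ->
  (forall a x, m_scale s a x = m_scale t a x) -> s = t.
Proof.
move=> eadd escale.
have z : m_zero s = m_zero t.
  by apply: (@m_addIr _ _ _ t _ _ (m_zero s)); rewrite -{1}eadd !m_add0.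
have o x : m_opp s x = m_opp t x.
  by apply: (@m_addIr _ _ _ t _ _ x); rewrite -{1}eadd !m_addN.
case: s t eadd escale z o => [zs os ds ss ? ? ? ? ? ? ? ?].
case=> [zt ot dt st ? ? ? ? ? ? ? ?] /= eadd escale z o; subst zt.
have E1 : os = ot by exact/funext.
have E2 : ds = dt by apply/funext => x; exact/funext.
have E3 : ss = st by apply/funext => x; exact/funext.
by subst ot dt st; congr ModuleStr; exact: Prop_irrelevance.
Qed.

End Module_str_eq.

Lemma mod_sheaf_eq (A : fieldType) (X : topologicalType) (M : sheaf X)
    (s t : forall U : opens X, module_str (field_ring A) (M U)) hs ht :
  (forall U, s U = t U) -> @ModSheaf A X M s hs = @ModSheaf A X M t ht.
Proof.
move=> e; have E : s = t by exact: functional_extensionality_dep.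
by subst t; congr ModSheaf; exact: Prop_irrelevance.
Qed.

Section Constant_action.
Context (A : fieldType) (X : topologicalType) (M : mod_sheaf A X).
Implicit Types U V W : opens X.

Definition const_on U (c : const_sec A U) V (a : A) : Prop :=
  V `<=` U /\ forall x (Ux : oset U x), oset V x -> const_val c Ux = a.

Lemma const_on_ex U (c : const_sec A U) x : oset U x ->
  exists V a, const_on c V a /\ oset V x.
Proof.
move=> Ux; have [V [Vx cV]] := proj2_sig c x Ux.
exists (meet U V), (const_val c Ux); split; last by split.
by split=> [y []//|y Uy [_ Vy]]; exact: cV.
Qed.

Section Scale.
Context U (c : const_sec A U) (s : M U).

(** Modules over the constant sheaf need an action of locally constant functions, whereas sheaves of
    A-modules have only scalars. The product is characterised on the open sets where the function is
    constant; gluing provides it. *)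
Definition is_const_scale (t : M U) : Prop :=
  forall V a (h : V `<=` U), const_on c V a ->
    res h t = m_scale (msh_str M V) a (res h s).

Lemma const_scale_ex : exists t, is_const_scale t.
Proof.
pose I := {Va : opens X * A | const_on c Va.1 Va.2}.
have [||t tP] := @sheaf_glue X M U I (fun i => (sval i).1)
  (fun i => proj1 (proj2_sig i))
  (fun i => m_scale (msh_str M _) (sval i).2 (res (proj1 (proj2_sig i)) s)).
- move=> x Ux; have [V [a [ca Vx]]] := const_on_ex c Ux.
  by exists (exist _ (V, a) ca).
- move=> [[V a] [/= VU ca]] [[W b] [/= WU cb]] O h k.
  have [_ ->] := msh_res M h; have [_ ->] := msh_res M k; rewrite !res_res.
  (* The two scalars agree only at the evidence of a point of [O]; over an empty [O] the sections
     agree anyway. *)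
  apply: sheaf_ext => x Ox.
  have E : a = b by rewrite -(ca x (VU x (h x Ox)) (h x Ox))
    -(cb x (VU x (h x Ox)) (k x Ox)).
  exists O, (fun _ => id); split=> //.
  by congr (res _ (m_scale _ _ _)); [exact: E|exact: res_irr].
- exists t => V a h ca; have := tP (exist _ (V, a) ca) => /= E.
  by rewrite (_ : h = proj1 ca) //; exact: Prop_irrelevance.
Qed.

Definition const_scale : M U := sval (cid const_scale_ex).

Lemma const_scaleP : is_const_scale const_scale.
Proof. exact: (svalP (cid const_scale_ex)). Qed.

Lemma const_scale_uniq t : is_const_scale t -> const_scale = t.
Proof.
move=> tP; apply: sheaf_ext => x /(const_on_ex c)[V [a [ca Vx]]].
by exists V, (proj1 ca); split=> //; rewrite (const_scaleP _ ca) (tP _ _ _ ca).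
Qed.

End Scale.

Lemma const_scale_cst U a (s : M U) :
  const_scale (const_cst U a) s = m_scale (msh_str M U) a s.
Proof.
apply: const_scale_uniq => V b h [_ cb]; have [_ ->] := msh_res M h.
apply: sheaf_ext => x Vx; exists V, (fun _ => id); split=> //.
by rewrite -(cb x (h x Vx) Vx).
Qed.

Lemma const_on_sub U V W (c : const_sec A U) a :
  const_on c V a -> W `<=` V -> const_on c W a.
Proof.
move=> [VU ca] WV; split=> [|x Ux /WV]; last exact: ca.
exact: subset_trans VU.
Qed.

Lemma const_local2 U (c d : const_sec A U) (s t : M U) :
  (forall V a b (h : V `<=` U), const_on c V a -> const_on d V b ->
    res h s = res h t) -> s = t.
Proof.
move=> e; apply: sheaf_ext => x Ux.
have [V [a [ca Vx]]] := const_on_ex c Ux.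
have [W [b [db Wx]]] := const_on_ex d Ux.
exists (meet V W), (fun y i => proj1 ca y (meetl i)); split; first by split.
apply: (e _ a b); first exact: (const_on_sub ca (@meetl _ _ _)).
exact: (const_on_sub db (@meetr _ _ _)).
Qed.

Lemma const_scale_res U V (h : V `<=` U) (c : const_sec A U) (s : M U) :
  res h (const_scale c s) = const_scale (const_res h c) (res h s).
Proof.
apply/esym/const_scale_uniq => W a k [_ ca].
have ca' : const_on c W a.
  split=> [x /k /h//|x Ux Wx]; rewrite -(ca x (k x Wx) Wx).
  exact: (const_val_irr c).
by rewrite !res_res; exact: const_scaleP ca'.
Qed.

Section Constant_action_laws.
Context (U : opens X).
Implicit Types (c d : const_sec A U) (s t : M U).
Let str := msh_str M U.

Lemma const_scaleA c d s :
  const_scale c (const_scale d s) =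
  const_scale (const_map2 (@GRing.mul A) c d) s.
Proof.
apply: (const_local2 (c := c) (d := d)) => V a b h ca db.
rewrite !(const_scaleP _ _ ca) (const_scaleP _ _ db) m_scaleA.
have cd : const_on (const_map2 (@GRing.mul A) c d) V (a * b)%R.
  by split=> // x Ux Vx; rewrite /= (proj2 ca x Ux Vx) (proj2 db x Ux Vx).
by rewrite (const_scaleP _ _ cd).
Qed.

Lemma const_scale1 s : const_scale (const_cst U 1%R) s = s.
Proof. by rewrite const_scale_cst [LHS]m_scale1. Qed.

Lemma const_scaleDr c s t :
  const_scale c (m_add str s t) = m_add str (const_scale c s) (const_scale c t).
Proof.
apply: const_scale_uniq => V a h ca; have [p1 p2] := msh_res M h.
by rewrite !p1 !(const_scaleP _ _ ca) m_scaleDr.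
Qed.

Lemma const_scaleDl s c d :
  const_scale (const_map2 (@GRing.add A) c d) s =
  m_add str (const_scale c s) (const_scale d s).
Proof.
apply: (const_local2 (c := c) (d := d)) => V a b h ca db.
have [p1 p2] := msh_res M h; rewrite p1.
have cd : const_on (const_map2 (@GRing.add A) c d) V (a + b)%R.
  by split=> // x Ux Vx; rewrite /= (proj2 ca x Ux Vx) (proj2 db x Ux Vx).
rewrite (const_scaleP _ _ ca) (const_scaleP _ _ db) (const_scaleP _ _ cd).
exact: m_scaleDl.
Qed.

End Constant_action_laws.
End Constant_action.

(** Linearity over A implies linearity over locally constant functions, since these are scalars
    locally. *)
Lemma const_scale_hom (A : fieldType) (X Y : topologicalType)
    (f : continuousType X Y) (F : mod_sheaf A Y) (G : ShA A X)
    (m : mod_sheaf_hom F (direct_image A f G)) (U : opens Y)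
    (c : const_sec A U) (s : F U) :
  m U (const_scale c s) =
  const_scale (const_pull_sec f c) (m U s : G (preopen f U)).
Proof.
apply: (@sheaf_ext X (G : mod_sheaf A X)) => x Ux.
have [V [a [ca Vx]]] := const_on_ex c (Ux : oset U (f x)).
exists (preopen f V), (preopenS (f := f) (proj1 ca)); split=> //.
have cfa : const_on (const_pull_sec f c) (preopen f V) a.
  split=> [|y Uy Vy]; first exact: (preopenS (f := f) (proj1 ca)).
  exact: (proj2 ca).
rewrite (const_scaleP _ _ cfa).
have N t := msm_nat m (proj1 ca) t; rewrite /= in N.
rewrite -N (const_scaleP _ _ ca) -N.
by have [_ ->] := msm_linear m V.
Qed.

Section Pointwise_module.
Context (A : fieldType) (X Y : topologicalType) (f : continuousType X Y)
  (Z : sheaf Y) (M : mod_sheaf A X).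

Let D := sheaf_map f Z M.
Let R := sheaf_map f Z (const_sheaf A X).
Let str U := msh_str M U.

Let zero : D.
Proof.
refine (@SheafMap X Y f Z M (fun U s => m_zero (str (preopen f U))) _).
by move=> U V h k s; rewrite (semilinear0 (msh_res M k)).
Defined.

Let opp (m : D) : D.
Proof.
refine (@SheafMap X Y f Z M (fun U s => m_opp (str (preopen f U)) (m U s)) _).
by move=> U V h k s; rewrite (sm_nat m h k) (semilinearN (msh_res M k)).
Defined.

Let add (m n : D) : D.
Proof.
refine (@SheafMap X Y f Z M
  (fun U s => m_add (str (preopen f U)) (m U s) (n U s)) _).
move=> U V h k s; rewrite (sm_nat m h k) (sm_nat n h k).
by have [-> _] := msh_res M k.
Defined.

Let scale (r : R) (m : D) : D.
Proof.
refine (@SheafMap X Y f Z M (fun U s => const_scale (r U s) (m U s)) _).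
by move=> U V h k s; rewrite const_scale_res (sm_nat m h k) (sm_nat r h k).
Defined.

Definition pointwise_str : module_str (cmap_ring A f Z) D.
Proof.
refine (@ModuleStr R (cmap_ring A f Z) D zero opp add scale _ _ _ _ _ _ _ _).
- by move=> m n k; apply: sheaf_map_eq => U s; exact: m_addA.
- by move=> m n; apply: sheaf_map_eq => U s; exact: m_addC.
- by move=> m; apply: sheaf_map_eq => U s; exact: m_add0.
- by move=> m; apply: sheaf_map_eq => U s; exact: m_addN.
- by move=> a b m; apply: sheaf_map_eq => U s; exact: const_scaleA.
- by move=> m; apply: sheaf_map_eq => U s; exact: const_scale1.
- by move=> a m n; apply: sheaf_map_eq => U s; exact: const_scaleDr.
- by move=> m a b; apply: sheaf_map_eq => U s; exact: const_scaleDl.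
Defined.

End Pointwise_module.

Lemma module_object_eq (B : category) (T : disp_category B) (R : ring_object T)
    (x : B) (o : T x)
    (s t : forall (w : B) (g : hom w x) (Z : T w),
       module_str (ro_str R g Z) (dhom g Z o)) hs ht :
  (forall w g Z, s w g Z = t w g Z) ->
  @ModuleObject B T R x o s hs = @ModuleObject B T R x o t ht.
Proof.
move=> e; have E : s = t.
  by do 3!apply: functional_extensionality_dep => ?; exact: e.
by subst t; congr ModuleObject; exact: Prop_irrelevance.
Qed.

Section Modules_over_constant_ring.
Context (A : fieldType) (J : category) (X : functor J (Top A)).

Let T := Sh_top X.
Let R := constant_ring X.

Let tr (x y : op J) (f : hom x y) : continuousType (X y) (X x) :=
  @transition A J X y x f.

Let E (x : J) : transition X (idm x) =1 id := transition1 (erefl (idm x)).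

Section Object.
Context (x : op J) (M : mod_sheaf A (X x)).

Let mstr (w : op J) (g : hom w x) (Z : T w) :
    module_str (ro_str R g Z) (@dhom _ T w x g Z (M : sheaf (X x))) :=
  pointwise_str (tr g) Z M.

Lemma object_pre (v w : op J) (k : hom v w) (g : hom w x) (h : hom v x)
    (e : g \oc k = h) (Y : T v) (Z : T w) (m : dhom k Y Z) :
  is_semilinear (fun r => dcomp e r m) (mstr g Z) (mstr h Y)
    (fun s => @dcomp _ T _ _ _ _ _ _ e _ _ (M : sheaf (X x)) s m).
Proof.
split=> [s t|r s]; apply: sheaf_map_eq => U z /=.
  by have [-> _] := msh_res M (preopen_comp (transitionM (X := X) e) (U := U)).
exact: const_scale_res.
Qed.

Definition module_object_of : module_object R x :=
  @ModuleObject _ T R x (M : sheaf (X x)) mstr object_pre.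

End Object.

Section Inverse.
Context (x : op J) (N : module_object R x).
Let S : sheaf (X x) := mo N.

(* Sections over [U] are maps from the sheaf represented by [U]. *)
Let yo (U : opens (X x)) (s : S U) : @dhom _ T x x (idm x) (represented U) S :=
  yoneda (@E x) s.

Let ev (U : opens (X x)) (m : @dhom _ T x x (idm x) (represented U) S) : S U :=
  plain (@E x) m ((fun _ => id) : represented U U).

Let evK (U : opens (X x)) (s : S U) : ev (yo s) = s.
Proof. by rewrite /ev yonedaE res1. Qed.

Let yoK (U : opens (X x)) m :
  yo (ev m) = m :> @dhom _ T x x (idm x) (represented U) S.
Proof.
apply: (@plain_inj _ _ (@E x)) => V i; rewrite yonedaE /ev -(plain_nat (@E x)).
congr (plain _ _ _); exact: (@Prop_irrelevance (V `<=` U)).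
Qed.

Let ms (U : opens (X x)) := mo_str N (idm x) (represented U : T x).
Let cst (U : opens (X x)) (a : A) :
    @dhom _ T x x (idm x) (represented U) (ro R x) :=
  cmap_cst (tr (idm x)) (represented U) a.

(** A module object has its structure on sets of arrows; transported by Yoneda from arrows out of
    the sheaf represented by [U], it becomes a structure on sections, with scalars acting through
    constant functions. *)
Let inv_str (U : opens (X x)) : module_str (field_ring A) (S U).
Proof.
refine (@ModuleStr A (field_ring A) (S U) (ev (m_zero (ms U)))
  (fun s => ev (m_opp (ms U) (yo s)))
  (fun s t => ev (m_add (ms U) (yo s) (yo t)))
  (fun a s => ev (m_scale (ms U) (cst U a) (yo s))) _ _ _ _ _ _ _ _).
- by move=> s t u; rewrite !yoK m_addA.
- by move=> s t; rewrite m_addC.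
- by move=> s; rewrite yoK m_add0 evK.
- by move=> s; rewrite yoK m_addN.
- move=> a b s; rewrite yoK m_scaleA; congr (ev (m_scale _ _ _)).
  by apply: cmap_eq.
- move=> s; rewrite -[RHS]evK -[in RHS](m_scale1 (ms U) (yo s)).
  by congr (ev (m_scale _ _ _)); apply: cmap_eq.
- by move=> a s t; rewrite !yoK m_scaleDr.
- move=> s a b; rewrite !yoK -m_scaleDl; congr (ev (m_scale _ _ _)).
  by apply: cmap_eq.
Defined.

Let incl (U V : opens (X x)) (h : V `<=` U) :
    @dhom _ T x x (idm x) (represented V) (represented U) :=
  yoneda (F := represented U) (@E x) (h : represented U V).

Let yo_incl (U V : opens (X x)) (h : V `<=` U) (s : S U) :
  dcomp (comp1m (idm x)) (yo s) (incl h) = yo (res h s).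
Proof.
apply: (@fibre_ext _ _ _ x) => W i; rewrite plain_comp !yonedaE res_res.
exact: res_irr.
Qed.

Let cst_incl (U V : opens (X x)) (h : V `<=` U) (a : A) :
  dcomp (comp1m (idm x)) (cst U a) (incl h) = cst V a.
Proof. exact: cmap_eq. Qed.

Let ev_incl (U V : opens (X x)) (h : V `<=` U) m :
  ev (dcomp (comp1m (idm x)) m (incl h)) = res h (ev m).
Proof. by rewrite -{1}(yoK m) yo_incl evK. Qed.

Lemma inverse_object_res (U V : opens (X x)) (h : V `<=` U) :
  is_semilinear id (inv_str U) (inv_str V) (@res _ S U V h).
Proof.
have [p1 p2] := mo_pre N (comp1m (idm x)) (incl h).
split=> [s t|a s] /=; rewrite -ev_incl.
  by rewrite p1 !yo_incl.
by rewrite p2 yo_incl cst_incl.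
Qed.

Definition inverse_object : mod_sheaf A (X x) := ModSheaf inverse_object_res.

(** Restricting along inclusions of represented sheaves reduces the action of [c] to open sets where
    it is constant, and there it is the action of a scalar by definition. *)
Let ev_scale (U : opens (X x)) (c : const_sec A U) (s : S U) :
  ev (m_scale (ms U) (yoneda (F := const_sheaf A (X x)) (@E x) c) (yo s)) =
  @const_scale A (X x) inverse_object U c s.
Proof.
apply/esym; apply: (@const_scale_uniq A (X x) inverse_object U c s) => V a h ca.
have [p1 p2] := mo_pre N (comp1m (idm x)) (incl h).
rewrite -[LHS]ev_incl p2 yo_incl /=; congr (ev (m_scale _ _ _)).
apply: cmap_eq => W i t Wt /=.
apply: (proj2 ca); apply: i; exact: preopen_id Wt.
Qed.

Section Over_arrow.
Context (w : op J) (g : hom w x) (Z : T w).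

(** The universal arrow over [g] out of the sheaf represented by [U]: it relates the structures on
    arrows over [g] to those in the fibre over [x]. *)
Let pre (U : opens (X w)) :
    @dhom _ T w x g (represented U) (represented (preopen (tr g) U)).
Proof.
refine (@SheafMap _ _ (tr g) (represented U)
  (represented (preopen (tr g) U)) (fun V i => preopenS (f := tr g) i) _).
move=> V W h k i.
exact: (@Prop_irrelevance (preopen (tr g) W `<=` preopen (tr g) U)).
Defined.

Let pre_yo (F : sheaf (X x)) (U : opens (X w)) (z : (Z : sheaf (X w)) U)
    (m : @dhom _ T w x g Z F) :
  dcomp (compm1 g) m
    (yoneda (@E w) z : @dhom _ T w w (idm w) (represented U) Z) =
  dcomp (comp1m g)
    (yoneda (@E x) ((m : sheaf_map (tr g) Z F) U z) :
      @dhom _ T x x (idm x) (represented _) F) (pre U).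
Proof.
apply: sheaf_map_eq => V i /=.
have k : preopen (tr (idm w)) V `<=` U by move=> t /(preopen_id (@E w)) /i.
rewrite res_res (sm_nat (m : sheaf_map (tr g) Z F) _ (preopenS (f := tr g) k)).
by rewrite !res_res; exact: res_irr.
Qed.

Let pre_inj (U : opens (X w)) (s t : S (preopen (tr g) U)) :
  dcomp (comp1m g) (yo s) (pre U) = dcomp (comp1m g) (yo t) (pre U) -> s = t.
Proof.
move=> /(congr1 (fun m : sheaf_map (tr g) (represented U) S =>
  m U ((fun _ => id) : represented U U))) /=; rewrite !res_res.
by move=> e; apply: (res_inj _ e).
Qed.

(** Naturality along the arrow classified by [z] reduces [Z] to a represented sheaf, and naturality
    along [pre] reduces [g] to an identity; there both structures are the one defined on
    sections. *)
Lemma inverse_object_str :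
  mo_str N g Z = pointwise_str (tr g) Z inverse_object.
Proof.
apply: module_str_eq => [m n|r m]; apply: sheaf_map_eq => U z; apply: pre_inj;
  rewrite -pre_yo;
  have [p1 p2] := mo_pre N (compm1 g)
    (yoneda (@E w) z : @dhom _ T w w (idm w) (represented U) Z);
  have [q1 q2] := mo_pre N (comp1m g) (pre U).
- by rewrite p1 !pre_yo -q1 /= yoK.
- by rewrite p2 !pre_yo -q2 /= -ev_scale yoK.
Qed.

End Over_arrow.

Lemma inverse_objectK : module_object_of inverse_object = N.
Proof.
have eta : N = @ModuleObject _ T R x (mo N) (mo_str N) (@mo_pre _ _ _ _ N).
  by case: N.
rewrite [RHS]eta; apply: module_object_eq => w g Z.
exact/esym/inverse_object_str.
Qed.

End Inverse.

Lemma module_object_ofK (x : op J) (M : mod_sheaf A (X x)) :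
  inverse_object (module_object_of M) = M.
Proof.
case: M => S str hres; apply: mod_sheaf_eq => U; apply: module_str_eq.
- move=> s t /=; rewrite /plain /= !res1.
  have [<- _] := hres _ _ (preopen_id (@E x) (U := U)).
  by rewrite res_res res1.
- move=> a s; rewrite /= /plain /= const_scale_cst res1.
  have [_ <-] := hres _ _ (preopen_id (@E x) (U := U)).
  by rewrite res_res res1.
Qed.

Lemma module_object_of_bij (x : op J) :
  bijective (@module_object_of x :
    bifibration_of (H_lower_star X) x -> modules_over R x).
Proof.
by exists (@inverse_object x);
  [exact: module_object_ofK|exact: inverse_objectK].
Qed.

Section Morphism.
Context (x y : op J) (f : hom x y) (F : ShX X x) (G : ShX X y).

Definition underlying_map
    (k : hom F (pmap (H_lower_star X) (f : @hom J y x) G)) :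
    sheaf_map (tr f) (F : mod_sheaf A (X x)) (G : mod_sheaf A (X y)).
Proof.
refine (@SheafMap _ _ (tr f) _ _ (fun U s => msm_fun k s) _).
move=> U V h l s; rewrite msm_nat; exact: res_irr.
Defined.

Lemma underlying_map_linear k : @is_module_hom _ T R x y f (module_object_of F)
  (module_object_of G) (underlying_map k).
Proof.
move=> w g h e Z; split=> [s t|r s]; apply: sheaf_map_eq => U z /=.
  have [-> _] := msm_linear k (preopen (tr g) U).
  by have [-> _] := msh_res (G : mod_sheaf A (X y))
    (preopen_comp (transitionM (X := X) e) (U := U)).
rewrite (@const_scale_hom A _ _ (tr f) F G k) const_scale_res.
by congr const_scale; exact: const_sec_eq.
Qed.

Definition module_hom_of
    (k : @dhom _ (bifibration_of (H_lower_star X)) x y f F G) :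
    @dhom _ (modules_over R) x y f (module_object_of F) (module_object_of G) :=
  @ModuleHom _ T R x y f (module_object_of F) (module_object_of G)
    (underlying_map k) (@underlying_map_linear k).

Section Inverse_hom.
Context (m : @dhom _ (modules_over R) x y f (module_object_of F)
  (module_object_of G)).

Let n : sheaf_map (tr f) (F : mod_sheaf A (X x)) (G : mod_sheaf A (X y)) :=
  mh_hom m.

Let n_nat (U V : opens (X x)) (h : V `<=` U) (s : (F : mod_sheaf A (X x)) U) :
  n V (res h s) = res (preopenS (f := tr f) h) (n U s).
Proof. exact: sm_nat. Qed.

(** Linearity on arrows out of all sheaves is applied to the arrows classified by [s] and [t] and
    evaluated at the tautological section of the sheaf represented by [U]. *)
Lemma module_hom_linear (U : opens (X x)) :
  is_semilinear id (msh_str (F : mod_sheaf A (X x)) U)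
    (msh_str (G : mod_sheaf A (X y)) (preopen (tr f) U)) (@n U).
Proof.
have [m1 m2] := @mh_linear _ T R x y f _ _ m x (idm x) f (compm1 f)
  (represented U).
have key (a b : sheaf_map (tr f) (represented U) (G : mod_sheaf A (X y))) :
  a = b -> a U ((fun _ => id) : represented U U) =
           b U ((fun _ => id) : represented U U).
  by move=> ->.
pose l := preopen_id (@E x) (U := U).
have L (j : preopen (tr f) U `<=` preopen (tr f) (preopen (tr (idm x)) U))
    (z : (F : mod_sheaf A (X x)) U) : res j (n _ (res l z)) = n U z.
  rewrite (sm_nat n l (preopenS (f := tr f) l)) res_res; exact: res1.
have [l1 l2] := msh_res (F : mod_sheaf A (X x)) l.
split=> [s t|a s].
- have := key _ _ (m1 (yoneda (@E x) s) (yoneda (@E x) t)).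
  by rewrite /= !res1 -l1 !L.
- have := key _ _ (m2 (cmap_cst (tr (idm x)) (represented U) a)
    (yoneda (@E x) s)).
  rewrite /= !res1 const_scale_cst -l2 !L => ->.
  by rewrite -const_scale_cst; congr const_scale; exact: const_sec_eq.
Qed.

Definition hom_of_module_hom :
    hom F (pmap (H_lower_star X) (f : @hom J y x) G) :=
  @ModSheafHom A (X x) F (direct_image A (tr f) G) n n_nat module_hom_linear.

End Inverse_hom.

Lemma module_hom_of_bij : bijective module_hom_of.
Proof.
exists hom_of_module_hom => k; first exact: mod_sheaf_hom_eq.
by apply: module_hom_eq; exact: sheaf_map_eq.
Qed.

End Morphism.

Definition modules_disp_iso :
  disp_iso (bifibration_of (H_lower_star X)) (modules_over R).
Proof.
apply: (@DispIso _ (bifibration_of (H_lower_star X)) (modules_over R)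
  (fun x M => module_object_of M) module_object_of_bij
  (fun x y f F G k => module_hom_of k)).
- by move=> x y f F G; exact: module_hom_of_bij.
- move=> x F; apply: module_hom_eq; apply: sheaf_map_eq => U s /=.
  exact: res_irr.
- move=> x y z f g h e F G K k l; apply: module_hom_eq.
  by apply: sheaf_map_eq => U s /=; exact: res_irr.
Defined.

End Modules_over_constant_ring.

(** * Comparison of f_! with f_* and conclusion *)

Section Shriek_star_comparison.
Context (A : fieldType) (J : category) (X : functor J (Top A))
  (hX : forall (x y : J) (f : hom x y), closed_embedding (transition X f)).

Definition forget_supports (x y : J) (f : hom x y) (F : ShX X x) :
    hom (pmap (H_lower_shriek hX) f F) (pmap (H_lower_star X) f F) :=
  @ModSheafHom A (X y) (pmap (H_lower_shriek hX) f F)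
    (pmap (H_lower_star X) f F) (fun U s => sval s) (fun U V h s => erefl)
    (fun U => conj (fun s t => erefl) (fun a s => erefl)).

(** Compact sets have compact preimages under a closed embedding, so every section has proper
    support. *)
Lemma forget_supports_iso (x y : J) (f : hom x y) (F : ShX X x) :
  is_iso (forget_supports f F).
Proof.
apply: ShA_iso => U.
exists (fun s => exist _ s (@closed_embedding_proper _ _ _ _ F U s (hX f))) =>
  s //.
exact: shriek_sec_eq.
Qed.

Definition shriek_star_iso : pf_iso (H_lower_shriek hX) (H_lower_star X).
Proof.
apply: (@identity_pf_iso _ _ (H_lower_shriek hX) (H_lower_star X)
  forget_supports).
- by move=> x y f F G k; exact: mod_sheaf_hom_eq.
- exact: forget_supports_iso.
- by move=> x F; exact: mod_sheaf_hom_eq.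
- by move=> x y z f g h e F; exact: mod_sheaf_hom_eq.
Defined.

End Shriek_star_comparison.

Unset Implicit Arguments.

Theorem proposition4p4p2 (A : fieldType) (J : category)
    (hJ : has_pullbacks J) (hD : is_index_category J)
    (X : functor J (Top A))
    (hX : forall (x y : J) (f : hom x y), closed_embedding (transition X f))
    (hpb : preserves_pullbacks X) :
  (exists Hu : @pseudofunctor (op J) (ShX X),
     inhabited (star_adjunction (H_lower_star X) Hu)) /\
  (exists Hs : @pseudofunctor (op J) (ShX X),
     inhabited (shriek_adjunction (H_lower_shriek hX) Hs)) /\
  forall (H_upper_star H_upper_shriek : @pseudofunctor (op J) (ShX X))
    (adj1 : star_adjunction (H_lower_star X) H_upper_star)
    (adj2 : shriek_adjunction (H_lower_shriek hX) H_upper_shriek),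
  let H := FourFunctors adj1 adj2 in
  exists C : cross_functor H,
    [/\ forall (a b c d : J) (f : hom a b) (g : hom a c) (p : hom b d)
          (h : hom c d) (pb : is_pullback f g p h) (F : ShX X a),
          @cf_lower J H C a b c d f g p h pb F = canonical_exchange hX pb F,
        is_grothendieck_cross_functor C (constant_ring X),
        (exists P : @pseudofunctor (span_cat hJ) H,
           inhabited (star_shriek_realisation (cf_lower C) P)) /\
        (forall P : @pseudofunctor (span_cat hJ) H,
           inhabited (star_shriek_realisation (cf_lower C) P) ->
           is_mackey_star_shriek H P) &
        (exists P : @pseudofunctor (op (span_cat hJ)) H,
           inhabited (shriek_star_realisation (cf_lower C) P)) /\
        (forall P : @pseudofunctor (op (span_cat hJ)) H,
           inhabited (shriek_star_realisation (cf_lower C) P) ->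
           is_mackey_shriek_star H P)].
Proof.
split; [|split].
- exists (left_adjoint_pf (Hd := H_lower_star X)
    (fun x y f => inverse_image_adjunction A (transition X f))).
  by constructor; exact: left_adjoint_star.
- exists (H_upper_shriek hJ hX hpb); constructor.
  exact: upper_shriek_adjunction.
- move=> Hu Hs adj1 adj2 H.
  have lc := canonical_lower_coherent hJ hpb adj1 adj2.
  have [S] := canonical_realisation_ex hJ hpb adj1 adj2.
  exists (CrossFunctor (cross_exchange_of_lower lc)); split=> //.
  + split; first exact: Sh_top_topos.
      by constructor; exact: modules_disp_iso.
    by constructor; exact: shriek_star_iso.
  + split=> [|P [R]]; last exact: (mackey_star_shriek lc R).
    (* The star-shriek functor consists of left adjoints of the explicit functors on classes of
       spans, with constraints obtained by conjugation. *)
    by exists (left_realisation S); constructor; exact: left_realisationP.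
  + split=> [|P [R]]; last exact: (mackey_shriek_star lc R).
    by exists (span_pf hJ hX hpb).
Qed.
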